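(* Let $d\in\mathbb{N}$, $\beta>1/2$, and let $\lambda\in\ell_1(\mathbb{Z}^d)$ be given by $$\lambda_k=(1+|k|)^{-d}\log^{-2\beta}(e+|k|),\qquad k\in\mathbb{Z}^d,$$ where $|\cdot|$ is the Euclidean norm. Then $$a_n(H_\lambda)\asymp n^{-1/2}\log^{-\beta}n$$ and $$e_n(H_\lambda)\asymp g_n(H_\lambda)\asymp n^{-1/2}\log^{-\beta+1/2}n.$$
   Context: For a non-negative $\lambda\in\ell_1(\mathbb{Z}^d)$, $H_\lambda$ is the reproducing kernel Hilbert space of all continuous $f\colon[0,1]^d\to\mathbb{C}$ with $\hat f(k)=0$ whenever $\lambda_k=0$ and $\|f\|_{H_\lambda}^2=\sum_{k:\lambda_k\ne0}|\hat f(k)|^2/\lambda_k<\infty$, where $\hat f(k)=\int_{[0,1]^d}f(x)e^{-2\pi i\langle k,x\rangle}dx$. Set $$e_n(H_\lambda)=\inf_{\substack{x_1,\dots,x_n\in[0,1]^d\\ a_1,\dots,a_n\in\mathbb{C}}}\ \sup_{\|f\|_{H_\lambda}\le1}\Big|\sum_{k=1}^na_kf(x_k)-\int_{[0,1]^d}f(x)\,dx\Big|,$$ $$g_n(H_\lambda)=\inf_{\substack{x_1,\dots,x_n\in[0,1]^d\\ g_1,\dots,g_n\in L_2([0,1]^d)}}\ \sup_{\|f\|_{H_\lambda}\le1}\Big\|f-\sum_{i=1}^nf(x_i)g_i\Big\|_2,\qquad a_n(H_\lambda)=\inf_{\substack{L_1,\dots,L_n\in H_\lambda'\\ g_1,\dots,g_n\in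 L_2([0,1]^d)}}\ \sup_{\|f\|_{H_\lambda}\le1}\Big\|f-\sum_{i=1}^nL_i(f)g_i\Big\|_2,$$ where $H_\lambda'$ is the space of continuous linear functionals on $H_\lambda$ and $\|\cdot\|_2$ is the norm of $L_2([0,1]^d)$. For sequences, $a_n\lesssim b_n$ means that there is a constant $c>0$ with $a_n\le c\,b_n$ for all but finitely many $n$, and $a_n\asymp b_n$ means $a_n\lesssim b_n$ and $b_n\lesssim a_n$ (constants may depend on $d$ and $\beta$). *)

(* Defs.v *)
From HB Require Import structures.
From mathcomp Require Import all_boot all_order all_algebra.
From mathcomp Require Import all_classical all_reals all_analysis.
From mathcomp Require Import complex.

Set Implicit Arguments.
Unset Strict Implicit.
Unset Printing Implicit Defensive.

Import Order.TTheory GRing.Theory Num.Theory.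
Import numFieldNormedType.Exports.

Local Open Scope classical_set_scope.
Local Open Scope ring_scope.
Local Open Scope complex_scope.

Section lebesgue_cons.
Context (R : realType) (n : nat).
Local Notation T := (measurableTypeR R).
Variable m : {sigma_finite_measure set (n.-tuple T) -> \bar R}.

Definition consp (p : T * n.-tuple T) : n.+1.-tuple T := [tuple of p.1 :: p.2].

Definition unconsp (t : n.+1.-tuple T) : T * n.-tuple T :=
  (thead t, [tuple of behead t]).

Lemma consp_measurable : measurable_fun setT consp.
Proof. exact: (measurable_cons measurable_fst measurable_snd). Qed.

Lemma unconsp_measurable : measurable_fun setT unconsp.
Proof.
apply: measurable_fun_pair; first exact: (measurable_tnth ord0).
exact: measurable_behead.
Qed.

Lemma conspK : cancel consp unconsp.
Proof.
by move=> [x t]; rewrite /unconsp /consp theadE; congr (_, _); exact/val_inj.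
Qed.

Definition lebesgue_cons : set (n.+1.-tuple T) -> \bar R :=
  pushforward (lebesgue_measure \x m)%E consp.

HB.instance Definition _ := Measure.copy lebesgue_cons
  (measure_function_pushforward__canonical__measure_function_Measure
    (lebesgue_measure \x m)%E consp_measurable).

Let mu_sigma_finite : sigma_finite setT lebesgue_cons.
Proof.
have /sigma_finiteP[F [FT ndF Foo]] := sigma_finiteT (@lebesgue_measure R).
have /sigma_finiteP[G [GT ndG Goo]] := sigma_finiteT m.
have FGT : \bigcup_k (F k `*` G k) = setT.
  rewrite -setXTT FT GT predeqE => -[x y]; split.
    by move=> [k _ []/= ? ?]; split; exists k.
  move=> [/= [k _ Fx] [l _ Gy]]; exists (maxn k l) => //; split.
  - by move: x Fx; exact/subsetPset/ndF/leq_maxl.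
  - by move: y Gy; exact/subsetPset/ndG/leq_maxr.
exists (fun k => unconsp @^-1` (F k `*` G k)).
  by rewrite -preimage_bigcup FGT preimage_setT.
move=> k; have [mF Fk] := Foo k; have [mG Gk] := Goo k; split.
  by rewrite -[X in measurable X]setTI; apply: unconsp_measurable => //;
    exact: measurableX.
rewrite /lebesgue_cons /pushforward -comp_preimage.
rewrite (_ : unconsp \o consp = id); last by apply/funext => p; exact: conspK.
by rewrite preimage_id product_measure1E// lte_mul_pinfty// ge0_fin_numE.
Qed.

HB.instance Definition _ := Measure_isSigmaFinite.Build _ _ _ lebesgue_cons
  mu_sigma_finite.

End lebesgue_cons.

(* Lebesgue measure on R^d, as the d-fold product measure on tuples; for d = 0
   it is the unit mass on the one-point space *)
Fixpoint lebesgue_tuple (R : realType) (d : nat) :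
    {sigma_finite_measure set (d.-tuple (measurableTypeR R)) -> \bar R} :=
  if d is d'.+1 then lebesgue_cons (lebesgue_tuple R d')
  else @dirac _ _ [tuple] R.

Section function_space.
Context (R : realType) (d : nat).
Implicit Types (f g : 'rV[R]_d -> R[i]) (x : 'rV[R]_d) (k : 'rV[int]_d).

(* The library puts a topology on 'rV[R]_d and a sigma-algebra on tuples;
   functions are defined on 'rV[R]_d and integrated along this bijection *)
Definition row_of_tuple (t : d.-tuple (measurableTypeR R)) : 'rV[R]_d :=
  \row_i tnth t i.

Definition cube : set 'rV[R]_d := [set x | forall i, 0 <= x 0 i <= 1].

Definition tcube : set (d.-tuple (measurableTypeR R)) :=
  row_of_tuple @^-1` cube.

Definition cube_int f : R[i] :=
  Rintegral (lebesgue_tuple R d) tcube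
    (fun t => complex.Re (f (row_of_tuple t))) +i*
  Rintegral (lebesgue_tuple R d) tcube
    (fun t => complex.Im (f (row_of_tuple t))).

Definition L2norm f : \bar R :=
  ((\int[lebesgue_tuple R d]_(t in tcube)
      (Normc.normc (f (row_of_tuple t)) ^+ 2)%:E) `^ 2^-1)%E.

Definition L2 : set ('rV[R]_d -> R[i]) := [set g |
  [/\ measurable_fun tcube (fun t => complex.Re (g (row_of_tuple t)) : R),
      measurable_fun tcube (fun t => complex.Im (g (row_of_tuple t)) : R) &
      (L2norm g < +oo)%E]].

Definition dotp k x : R := \sum_i (k 0 i)%:~R * x 0 i.

Definition expi (t : R) : R[i] := cos t +i* sin t.

Definition fourier f k : R[i] :=
  cube_int (fun x => f x * expi (- (2 * pi * dotp k x))).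

(* meant for non-negative summable weights *)
Variable lam : 'rV[int]_d -> R.

Definition Hnorm f : \bar R :=
  ((\esum_(k in [set k | lam k != 0%R])
      (Normc.normc (fourier f k) ^+ 2 / lam k)%:E) `^ 2^-1)%E.

(* Elements are functions on the whole of R^d, but everything below depends on
   their restrictions to the cube only: two functions agreeing on the cube are
   at Hnorm-distance 0, so that a continuous linear functional cannot separate
   them *)
Definition Hspace : set ('rV[R]_d -> R[i]) := [set f |
  [/\ {within cube, continuous (f : 'rV[R]_d -> (R[i] : numClosedFieldType))},
      forall k, lam k = 0 -> fourier f k = 0 &
      (Hnorm f < +oo)%E]].

Definition Hball : set ('rV[R]_d -> R[i]) :=
  [set f | Hspace f /\ (Hnorm f <= 1)%E].

Definition Hdual : set (('rV[R]_d -> R[i]) -> R[i]) := [set L |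
  (forall (c : R[i]) f g, Hspace f -> Hspace g ->
     L (fun x => c * f x + g x) = c * L f + L g) /\
  (forall f, Hspace f -> forall eps : R, 0 < eps ->
     exists2 delta : R, 0 < delta & forall g, Hspace g ->
       (Hnorm (fun x => (g x - f x)%R) < delta%:E)%E ->
       Normc.normc (L g - L f) < eps)].

Definition quad_err (n : nat) (x : 'I_n -> 'rV[R]_d) (a : 'I_n -> R[i]) :
    \bar R :=
  ereal_sup [set (Normc.normc (\sum_i a i * f (x i) - cube_int f))%:E
            | f in Hball].

Definition min_quad_err (n : nat) : \bar R :=
  ereal_inf [set v | exists (x : 'I_n -> 'rV[R]_d) (a : 'I_n -> R[i]),
    (forall i, cube (x i)) /\ v = quad_err x a].

Definition approx_err (n : nat) (L : 'I_n -> ('rV[R]_d -> R[i]) -> R[i])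
    (g : 'I_n -> 'rV[R]_d -> R[i]) : \bar R :=
  ereal_sup [set L2norm (fun y => f y - \sum_i L i f * g i y) | f in Hball].

Definition sampling_number (n : nat) : \bar R :=
  ereal_inf [set v | exists (x : 'I_n -> 'rV[R]_d)
      (g : 'I_n -> 'rV[R]_d -> R[i]),
    [/\ forall i, cube (x i), forall i, L2 (g i) &
        v = approx_err (fun i f => f (x i)) g]].

Definition approx_number (n : nat) : \bar R :=
  ereal_inf [set v | exists (L : 'I_n -> ('rV[R]_d -> R[i]) -> R[i])
      (g : 'I_n -> 'rV[R]_d -> R[i]),
    [/\ forall i, Hdual (L i), forall i, L2 (g i) & v = approx_err L g]].

End function_space.

Section asymptotics.
Context (R : realType).
Implicit Types a b : nat -> \bar R.

Definition lesssim a b : Prop :=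
  exists2 c : R, 0 < c & \forall n \near \oo, (a n <= c%:E * b n)%E.

Definition asymp a b : Prop := lesssim a b /\ lesssim b a.

End asymptotics.

Definition euclid (R : realType) (d : nat) (k : 'rV[int]_d) : R :=
  Num.sqrt (\sum_i (k 0 i)%:~R ^+ 2).

Definition log_weight (R : realType) (d : nat) (beta : R) (k : 'rV[int]_d) :
    R :=
  (1 + euclid R k) ^- d * ln (expR 1 + euclid R k) `^ (- (2 * beta)).

Definition log_rate (R : realType) (gamma : R) (n : nat) : \bar R :=
  (n%:R `^ (- 2^-1) * ln n%:R `^ gamma)%:E.

(* Main.v *)
(* Let q = 2p+1 with q^d <= n < (q+2)^d. For a_n, truncate the Fourier series to
   |k|_oo <= p; conversely a trigonometric polynomial with |k|_oo <= p+1 in the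
   kernel of all the functionals is not approximated at all. For g_n, replace
   the Fourier coefficients by their discrete versions on the grid of step 1/q:
   since lambda is almost radial and slowly varying, the aliasing error is
   governed by sum_(v <> 0) lambda(q v), which telescopes to order
   q^-d log(q)^(1 - 2 beta) and exceeds lambda at p by a logarithm. For e_n from
   below, let b_k = sum_i a_i e(<k, x_i>) and let mu be a multiple of lambda on
   the annulus m < |k|_oo <= m^2 + 2m, normalised so that its autocorrelation
   is at most lambda. The matrix sqrt(mu_j mu_l) b_(j-l) has rank at most n and
   trace b_0 sum(mu), so sum_k lambda_k |b_k|^2 >= |b_0|^2 sum(mu)^2 / n, at most
   half of which comes from k = 0:
   either b_0 is far from 1 or the quadrature formula errs on a function whose
   spectrum avoids 0. *)

Require Import Defs.
From mathcomp Require Import all_boot all_order all_algebra.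
From mathcomp Require Import all_classical all_reals all_analysis.
From mathcomp Require Import complex measurable_realfun ring lra zify sesquilinear spectral.

Set Implicit Arguments.
Unset Strict Implicit.
Unset Printing Implicit Defensive.

Import Order.TTheory GRing.Theory Num.Theory.
Import numFieldNormedType.Exports.

Local Open Scope classical_set_scope.
Local Open Scope ring_scope.
Local Open Scope complex_scope.

(** The functions of the space are continuous on the closed cube; they are not assumed periodic, and
    nothing says that their Fourier series converge to them. Yet the grid has nodes on the boundary,
    so the series must be controlled there too. A continuous function is therefore first bounded, on
    the whole cube, by the sum of the moduli of its Fourier coefficients; with Cauchy-Schwarz and
    the summability of lambda, the partial sums then converge uniformly. From there on, finite sums
    over boxes of frequencies suffice. With [gam] = 2 beta - 1, the sums of lambda over the annulus
    and over the whole tail beyond m both have order log(m)^(-gam), whereas m^d lambda(m) has order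
    log(m)^(-1-gam). This one logarithm is the gap between the two rates, and it also absorbs the
    constants when the share of k = 0 has to stay below one half. The annulus reaches to about m^2
    because only there has the logarithm doubled. Its autocorrelation is dominated by lambda
    because, of two frequencies with difference k, one has norm at least |k|_oo / 2. *)

Notation nc := Normc.normc.

(** * Complex numbers *)

Section complex_modulus.
Context (R : realType).
Implicit Types z w : R[i].

Lemma normC_nc z : `|z| = (nc z)%:C.
Proof. by []. Qed.

Lemma nc_sqrE z : nc z ^+ 2 = complex.Re z ^+ 2 + complex.Im z ^+ 2.
Proof. by case: z => a b /=; rewrite sqr_sqrtr// addr_ge0// sqr_ge0. Qed.

Lemma nc_ge0 z : 0 <= nc z.
Proof. by case: z => a b /=; exact: sqrtr_ge0. Qed.

Lemma ncM z w : nc (z * w) = nc z * nc w.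
Proof. exact: Normc.normcM. Qed.

Lemma nc0 : nc (0 : R[i]) = 0.
Proof. exact: Normc.normc0. Qed.

Lemma nc1 : nc (1 : R[i]) = 1.
Proof. exact: Normc.normc1. Qed.

Lemma nc_eq0 z : (nc z == 0) = (z == 0).
Proof.
by apply/eqP/eqP => [/Normc.eq0_normc //|->]; rewrite nc0.
Qed.

Lemma ncD z w : nc (z + w) <= nc z + nc w.
Proof. by have := ler_normD z w; rewrite !normC_nc -rmorphD lecR. Qed.

Lemma ncN z : nc (- z) = nc z.
Proof. by apply: complexI; rewrite -!normC_nc normrN. Qed.

Lemma nc_distC z w : nc (z - w) = nc (w - z).
Proof. by rewrite -ncN opprB. Qed.

Lemma nc_sum I (r : seq I) (P : pred I) (F : I -> R[i]) :
  nc (\sum_(i <- r | P i) F i) <= \sum_(i <- r | P i) nc (F i).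
Proof.
elim/big_ind2 : _ => // [|x1 x2 y1 y2 h1 h2]; first by rewrite nc0.
exact: le_trans (ncD _ _) (lerD h1 h2).
Qed.

Lemma nc_conj z : nc z^*%C = nc z.
Proof. by case: z => a b /=; rewrite sqrrN. Qed.

Lemma mulJc z : z * z^*%C = (nc z ^+ 2)%:C.
Proof. by rewrite -sqr_normc normC_nc rmorphXn. Qed.

Lemma nc_real (x : R) : nc x%:C = `|x|.
Proof. by rewrite /= expr0n/= addr0 sqrtr_sqr. Qed.

Lemma Re_le_nc z : complex.Re z <= nc z.
Proof.
case: z => a b /=; apply: le_trans (ler_norm a) _.
by rewrite -sqrtr_sqr ler_wsqrtr// lerDl sqr_ge0.
Qed.

Lemma normr_Re_le_nc z : `|complex.Re z| <= nc z.
Proof.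
rewrite ler_norml Re_le_nc andbT lerNl.
by have := Re_le_nc (- z); rewrite ncN; case: z.
Qed.

Lemma normr_Im_le_nc z : `|complex.Im z| <= nc z.
Proof.
case: z => a b /=.
by rewrite -sqrtr_sqr ler_wsqrtr// lerDr sqr_ge0.
Qed.

Lemma nc_le_ReIm z : nc z <= `|complex.Re z| + `|complex.Im z|.
Proof.
rewrite -[leLHS]ger0_norm ?nc_ge0// -ler_sqr ?nnegrE ?addr_ge0//.
rewrite real_normK ?num_real// nc_sqrE sqrrD !real_normK ?num_real//.
by rewrite addrAC lerDl mulrn_wge0// mulr_ge0.
Qed.

Lemma cReM z w : complex.Re (z * w) =
  complex.Re z * complex.Re w - complex.Im z * complex.Im w.
Proof. by case: z; case: w. Qed.

Lemma cImM z w : complex.Im (z * w) =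
  complex.Re z * complex.Im w + complex.Im z * complex.Re w.
Proof. by case: z; case: w. Qed.

Lemma cReD z w : complex.Re (z + w) = complex.Re z + complex.Re w.
Proof. by case: z; case: w. Qed.

Lemma cImD z w : complex.Im (z + w) = complex.Im z + complex.Im w.
Proof. by case: z; case: w. Qed.

Lemma cReN z : complex.Re (- z) = - complex.Re z.
Proof. by case: z. Qed.

Lemma cImN z : complex.Im (- z) = - complex.Im z.
Proof. by case: z. Qed.

Lemma complex_eta z : z = complex.Re z +i* complex.Im z.
Proof. by case: z. Qed.

Lemma real_complex_sum I (r : seq I) (P : pred I) (F : I -> R) :
  (\sum_(i <- r | P i) F i)%:C = \sum_(i <- r | P i) (F i)%:C.
Proof. exact: rmorph_sum. Qed.

Lemma conjc_sum I (r : seq I) (P : pred I) (F : I -> R[i]) :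
  (\sum_(i <- r | P i) F i)^*%C = \sum_(i <- r | P i) (F i)^*%C.
Proof. exact: rmorph_sum. Qed.

Lemma conjcM z w : (z * w)^*%C = z^*%C * w^*%C.
Proof. exact: rmorphM. Qed.

Lemma real_complexM (x y : R) : (x * y)%:C = x%:C * y%:C.
Proof. exact: rmorphM. Qed.

Lemma expi0 : expi 0 = 1 :> R[i].
Proof. by rewrite /expi cos0 sin0. Qed.

Lemma expiD (s t : R) : expi (s + t) = expi s * expi t.
Proof. by rewrite /expi cosD sinD /GRing.mul/= [X in _ +i* X]addrC. Qed.

Lemma expiN (t : R) : expi (- t) = (expi t)^*%C.
Proof. by rewrite /expi cosN sinN /=. Qed.

Lemma nc_expi (t : R) : nc (expi t) = 1.
Proof. by rewrite /expi /= cos2Dsin2 sqrtr1. Qed.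

Lemma expi_sum I (r : seq I) (P : pred I) (F : I -> R) :
  expi (\sum_(i <- r | P i) F i) = \prod_(i <- r | P i) expi (F i).
Proof.
elim/big_rec2 : _ => [|i x y _ <-]; first exact: expi0.
by rewrite expiD.
Qed.

Lemma cos_2piz (m : int) (t : R) : cos (t + 2 * pi * m%:~R) = cos t.
Proof.
have H (n : nat) (s : R) : cos (s + 2 * pi * n%:R) = cos s.
  elim: n => [|n IH] in s *; first by rewrite mulr0 addr0.
  by rewrite -[n.+1%:R]natr1 mulrDr mulr1 addrA [2 * pi in X in _ + X]mulr_natl (cosD2pi (_ + _)) IH.
case: m => n; first exact: H.
by rewrite NegzE mulrNz mulrN -(H n.+1 (t - _)) subrK.
Qed.

Lemma expi_2piz (m : int) : expi (2 * pi * m%:~R) = 1 :> R[i].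
Proof.
rewrite /expi -[2 * pi * _]add0r cos_2piz cos0.
have : sin (0 + 2 * pi * m%:~R : R) ^+ 2 = 0.
  by rewrite sin2cos2 cos_2piz cos0 expr1n subrr.
by move/eqP; rewrite sqrf_eq0 => /eqP ->.
Qed.

End complex_modulus.

Section complex_continuity.
Context (R : realType) (T : topologicalType).
Implicit Types f : T -> R[i].

Lemma continuous_complexP f :
  continuous (f : T -> (R[i] : numClosedFieldType)) <->
  continuous (fun x => complex.Re (f x) : R) /\
  continuous (fun x => complex.Im (f x) : R).
Proof.
split=> [cf|[cr ci] x].
  split=> x; apply/cvgrPdist_lt => e e0.
    have /cvgrPdist_lt /(_ e%:C) := cf x; rewrite ltcR => /(_ e0).
    apply: filterS => y; rewrite normC_nc ltcR; apply: le_lt_trans.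
    rewrite -cReN -cReD; exact: normr_Re_le_nc.
  have /cvgrPdist_lt /(_ e%:C) := cf x; rewrite ltcR => /(_ e0).
  apply: filterS => y; rewrite normC_nc ltcR; apply: le_lt_trans.
  by rewrite -cImN -cImD; exact: normr_Im_le_nc.
apply/cvgrPdist_lt => e; rewrite ltcE => /andP[/eqP/= ie e0].
have e20 : 0 < complex.Re e / 2 by rewrite divr_gt0.
near=> y.
rewrite normC_nc ltcE/= ie eqxx/=; apply: le_lt_trans (nc_le_ReIm _) _.
rewrite [ltRHS]splitr cReD cImD cReN cImN ltrD//; near: y.
  by have /cvgrPdist_lt /(_ _ e20) := cr x.
by have /cvgrPdist_lt /(_ _ e20) := ci x.
Unshelve. all: by end_near. Qed.

End complex_continuity.

Section real_continuity.
Context (R : realType) (T : topologicalType).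
Implicit Types f g : T -> R.

Lemma continuous_addf f g : continuous f -> continuous g ->
  continuous (fun x => f x + g x).
Proof. by move=> cf cg x; apply: cvgD; [exact: cf|exact: cg]. Qed.

Lemma continuous_subf f g : continuous f -> continuous g ->
  continuous (fun x => f x - g x).
Proof. by move=> cf cg x; apply: cvgB; [exact: cf|exact: cg]. Qed.

Lemma continuous_mulf f g : continuous f -> continuous g ->
  continuous (fun x => f x * g x).
Proof. by move=> cf cg x; apply: cvgM; [exact: cf|exact: cg]. Qed.

End real_continuity.

Arguments Normc.normc : simpl never.
Arguments cube_int : simpl never.
Arguments fourier : simpl never.

(** * Integration on the unit cube *)

Section tuple_measurability.
Context (R : realType) (d : nat).
Local Notation T := (measurableTypeR R).
Implicit Types (a b : 'I_d -> R).

Lemma measurable_tuple_forall (P : 'I_d -> set T) :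
  (forall i, measurable (P i)) ->
  measurable [set t : d.-tuple T | forall i, P i (tnth t i)].
Proof.
move=> mP.
have -> : [set t : d.-tuple T | forall i, P i (tnth t i)] =
    \bigcap_(i in [set: 'I_d]) (fun t : d.-tuple T => tnth t i) @^-1` P i.
  by apply/seteqP; split=> t /= h i => [_|]; exact: h.
apply: fin_bigcap_measurable; first exact: finite_finset.
move=> i _; rewrite -[X in measurable X]setTI.
exact: (measurable_tnth i).
Qed.

Definition tbox a b : set (d.-tuple T) :=
  [set t | forall i, `[a i, b i]%classic (tnth t i)].

Lemma measurable_tbox a b : measurable (tbox a b).
Proof.
apply: (@measurable_tuple_forall (fun i => `[a i, b i]%classic)) => i.
exact: measurable_itv.
Qed.

Lemma tcubeE : @tcube R d = tbox (fun=> 0) (fun=> 1).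
Proof.
apply/seteqP; split=> t /= h i; have := h i; rewrite /= ?in_itv/=.
  by rewrite mxE.
by rewrite mxE.
Qed.

Lemma measurable_tcube : measurable (@tcube R d).
Proof. by rewrite tcubeE; exact: measurable_tbox. Qed.

(** The topology lives on rows and the sigma-algebra on tuples. They meet because an open set is the
    countable union of the cubes with rational centre and radius that it contains. *)
Lemma measurable_row_open (U : set 'rV[R]_d) : open U ->
  measurable (@row_of_tuple R d @^-1` U).
Proof.
move=> oU.
pose B (cr : 'rV[rat]_d * rat) : set (d.-tuple T) :=
  [set t | forall i, `]ratr (cr.1 0 i) - ratr cr.2,
                      ratr (cr.1 0 i) + ratr cr.2[%classic (tnth t i)].
pose F cr := if `[< B cr `<=` @row_of_tuple R d @^-1` U >] then B cr else set0.
have -> : @row_of_tuple R d @^-1` U = \bigcup_cr F cr.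
  apply/seteqP; split=> [t /= Ut|t [cr _]]; last first.
    by rewrite /F; case: asboolP => // h /h.
  move: oU; rewrite openE => /(_ _ Ut); rewrite /interior => /nbhs_ballP[e /= e0 eU].
  have e20 : 0 < e / 2 by rewrite divr_gt0.
  have [r] := rat_in_itvoo e20; rewrite in_itv/= => /andP[r0 re].
  have h i : exists q : rat, `|tnth t i - ratr q| < ratr r.
    have : tnth t i - ratr r < tnth t i + ratr r by lra.
    move=> /rat_in_itvoo[q]; rewrite in_itv/= => /andP[q1 q2].
    by exists q; rewrite ltr_norml; apply/andP; split; lra.
  have [c cP] := choice h.
  have Bt : B (\row_i c i, r) t.
    move=> i /=; rewrite in_itv/= mxE; have := cP i.
    by rewrite ltr_norml => /andP[? ?]; apply/andP; split; lra.
  exists (\row_i c i, r) => //; rewrite /F; case: asboolP => // -[] s Bs.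
  apply: eU; split => // i j; rewrite !mxE /ball/=.
  have := Bs j; have := Bt j; rewrite /= !in_itv/= !mxE.
  by move=> /andP[? ?] /andP[? ?]; rewrite ltr_norml; apply/andP; split; lra.
apply: countable_bigcupT_measurable.
  exact: countableP.
move=> cr; rewrite /F; case: asboolP => // _.
apply: (@measurable_tuple_forall (fun i => `]ratr (cr.1 0 i) - ratr cr.2,
  ratr (cr.1 0 i) + ratr cr.2[%classic)) => i.
exact: measurable_itv.
Qed.

Lemma measurable_cube_continuous (g : 'rV[R]_d -> R) :
  {within @cube R d, continuous g} ->
  measurable_fun (@tcube R d) (g \o @row_of_tuple R d : _ -> T).
Proof.
move=> /continuousP cg.
apply: (measurability _ (RGenOpens.measurableE R)).
move=> _ [_ [a [b ->] <-]].
have /open_subspaceP[V oV VE] := cg _ (@interval_open R (BRight a) (BLeft b) isT isT).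
rewrite (_ : _ `&` _ = @row_of_tuple R d @^-1` V `&` @tcube R d).
  by apply: measurableI; [exact: measurable_row_open|exact: measurable_tcube].
by rewrite setIC /tcube -preimage_setI VE preimage_setI.
Qed.

End tuple_measurability.

Section cons_integral.
Context (R : realType).
Local Notation T := (measurableTypeR R).

Lemma tbox_cons d (a b : 'I_d.+1 -> R) :
  @consp R d @^-1` (tbox a b) =
  `[a ord0, b ord0]%classic `*` tbox (a \o lift ord0) (b \o lift ord0).
Proof.
apply/seteqP; split=> -[x t] /=.
  move=> h; split; first exact: (h ord0).
  by move=> i; have := h (lift ord0 i); rewrite tnthS.
move=> [h0 h] i; case: (unliftP ord0 i) => [j ->|->]; last exact: h0.
by rewrite tnthS; exact: h.
Qed.

Lemma lebesgue_tbox d (a b : 'I_d -> R) : (forall i, a i <= b i) ->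
  lebesgue_tuple R d (tbox a b) = (\prod_i (b i - a i))%:E.
Proof.
elim: d a b => [|d IH] a b ab.
  rewrite big_ord0 /=; rewrite diracE mem_set//.
  by move=> -[].
rewrite /= /lebesgue_cons /pushforward tbox_cons product_measure1E//; last first.
  exact: measurable_tbox.
rewrite IH; last by move=> i; exact: ab.
rewrite big_ord_recl EFinM; congr (_ * _)%E.
transitivity (lebesgue_measure (`[a ord0, b ord0]%classic : set R)); first by []. rewrite lebesgue_measure_itv/=.
rewrite lte_fin; have := ab ord0; rewrite le_eqVlt => /predU1P[->|ltab].
  by rewrite ltxx subrr.
by rewrite ltab EFinB.
Qed.

Lemma lebesgue_tcube d : lebesgue_tuple R d (@tcube R d) = 1%E.
Proof.
by rewrite tcubeE lebesgue_tbox ?ler01// big1// => i _; rewrite subr0.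
Qed.

Lemma integral_tcubeS d (F : d.+1.-tuple T -> \bar R) :
  measurable_fun (@tcube R d.+1) F -> (forall t, @tcube R d.+1 t -> (0 <= F t)%E) ->
  (\int[lebesgue_tuple R d.+1]_(t in @tcube R d.+1) F t =
   \int[lebesgue_measure]_(x in `[0%R, 1%R])
     \int[lebesgue_tuple R d]_(t in @tcube R d) F (consp (x, t)))%E.
Proof.
move=> mF F0; have mQ := @measurable_tcube R d.+1.
have mQd := @measurable_tcube R d.
(* Extension by zero gives an integral over the whole space, to which the push-forward along [consp]
   and Tonelli apply. *)
rewrite [LHS]integral_mkcond.
set G := F \_ _.
have mG : measurable_fun setT G by apply/(measurable_restrictT _ mQ).
have G0 t : (0 <= G t)%E.
  by rewrite /G patchE; case: ifPn => //; rewrite inE => /F0.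
have -> : (\int[lebesgue_tuple R d.+1]_t G t =
    \int[lebesgue_measure \x lebesgue_tuple R d]_p G (consp p))%E.
  have := ge0_integral_pushforward (@consp_measurable R d)
    (lebesgue_measure \x lebesgue_tuple R d)%E measurableT mG (fun t _ => G0 t).
  by rewrite preimage_setT => <-.
rewrite fubini_tonelli1/=; last 2 first.
- by apply: measurableT_comp => //; exact: consp_measurable.
- by move=> x; exact: G0.
rewrite [RHS]integral_mkcond; apply: eq_integral => x _.
rewrite patchE /fubini_F.
have QE t : (consp (x, t) \in @tcube R d.+1) = (x \in `[0, 1]%classic) && (t \in @tcube R d).
  apply/idP/andP; rewrite !inE !tcubeE.
    by rewrite -[tbox _ _ (consp _)]/((@consp R d @^-1` _) _) tbox_cons => -[].
  by move=> h; rewrite -[tbox _ _ (consp _)]/((@consp R d @^-1` _) _) tbox_cons.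
case: ifPn => x01.
  rewrite [RHS]integral_mkcond; apply: eq_integral => t _.
  by rewrite /G /= !patchE QE x01.
under eq_integral do rewrite /G /= patchE QE (negbTE x01).
by rewrite integral0.
Qed.

End cons_integral.

Section cube_integral.
Context (R : realType) (d : nat).
Local Notation T := (measurableTypeR R).
Local Notation Q := (@tcube R d).
Local Notation mu := (lebesgue_tuple R d).
Local Notation row := (@row_of_tuple R d).
Implicit Types (f g : 'rV[R]_d -> R[i]) (G : 'rV[R]_d -> R) (c z : R[i]).

Let mQ : measurable Q := @measurable_tcube R d.

Definition rintegrable G := mu.-integrable Q (EFin \o (G \o row)).

Definition cintegrable f :=
  rintegrable (fun x => complex.Re (f x)) /\ rintegrable (fun x => complex.Im (f x)).

Definition rint G : R := Rintegral mu Q (G \o row).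

Lemma cube_intE f :
  cube_int f = rint (fun x => complex.Re (f x)) +i* rint (fun x => complex.Im (f x)).
Proof. by []. Qed.

Lemma eq_rint G G' : (forall x, cube x -> G x = G' x) -> rint G = rint G'.
Proof. by move=> h; apply: eq_Rintegral => t; rewrite inE => /h. Qed.

Lemma eq_cube_int f g : (forall x, cube x -> f x = g x) ->
  cube_int f = cube_int g.
Proof.
by move=> h; rewrite !cube_intE; congr (_ +i* _); apply: eq_rint => x /h ->.
Qed.

Lemma eq_rintegrable G G' : (forall x, cube x -> G x = G' x) ->
  rintegrable G -> rintegrable G'.
Proof.
by move=> h; apply: eq_integrable => // t; rewrite inE => /h /= ->.
Qed.

Lemma eq_cintegrable f g : (forall x, cube x -> f x = g x) ->
  cintegrable f -> cintegrable g.
Proof.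
by move=> h [h1 h2]; split; [move: h1|move: h2]; apply: eq_rintegrable => x /h ->.
Qed.

Lemma rintegrable_cst (r : R) : rintegrable (cst r).
Proof.
apply: measurable_bounded_integrable; first exact: mQ.
- by rewrite [ltLHS]lebesgue_tcube ltry.
- exact: measurable_cst.
- exact: bounded_cst.
Qed.

Lemma rint_cst (r : R) : rint (cst r) = r.
Proof.
by rewrite /rint (Rintegral_cst _ mQ) [X in fine X]lebesgue_tcube mulr1.
Qed.

Lemma rintegrableD G G' : rintegrable G -> rintegrable G' ->
  rintegrable (fun x => G x + G' x).
Proof. by move=> h h'; exact: (integrableD mQ h h'). Qed.

Lemma rintegrableZ (r : R) G : rintegrable G -> rintegrable (fun x => r * G x).
Proof. by move=> h; exact: (integrableZl mQ r h). Qed.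

Lemma rintegrableB G G' : rintegrable G -> rintegrable G' ->
  rintegrable (fun x => G x - G' x).
Proof. by move=> h h'; exact: (integrableB mQ h h'). Qed.

Lemma rintD G G' : rintegrable G -> rintegrable G' ->
  rint (fun x => G x + G' x) = rint G + rint G'.
Proof. by move=> h h'; rewrite /rint -(RintegralD mQ h h'). Qed.

Lemma rintB G G' : rintegrable G -> rintegrable G' ->
  rint (fun x => G x - G' x) = rint G - rint G'.
Proof. by move=> h h'; rewrite /rint -(RintegralB mQ h h'). Qed.

Lemma rintZ (r : R) G : rintegrable G -> rint (fun x => r * G x) = r * rint G.
Proof. by move=> h; rewrite /rint -(RintegralZl _ mQ h). Qed.

Lemma le_rint G G' : rintegrable G -> rintegrable G' ->
  (forall x, cube x -> G x <= G' x) -> rint G <= rint G'.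
Proof. by move=> h h' GG; apply: le_Rintegral => // t /GG. Qed.

Lemma rint_ge0 G : (forall x, cube x -> 0 <= G x) -> 0 <= rint G.
Proof. by move=> h; apply: Rintegral_ge0 => t /h. Qed.

Lemma rint_ereal G : rintegrable G ->
  (\int[mu]_(t in Q) (G (row t))%:E)%E = (rint G)%:E.
Proof.
by move=> h; rewrite /rint /Rintegral fineK//; exact: integrable_fin_num.
Qed.

Lemma cintegrableZ c f : cintegrable f -> cintegrable (fun x => c * f x).
Proof.
move=> [h1 h2]; split.
  apply: (@eq_rintegrable
    (fun x => complex.Re c * complex.Re (f x) - complex.Im c * complex.Im (f x))).
    by move=> x _; rewrite cReM.
  by apply: rintegrableB; exact: rintegrableZ.
apply: (@eq_rintegrable
  (fun x => complex.Re c * complex.Im (f x) + complex.Im c * complex.Re (f x))).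
  by move=> x _; rewrite cImM.
by apply: rintegrableD; exact: rintegrableZ.
Qed.

Lemma cintegrableD f g : cintegrable f -> cintegrable g ->
  cintegrable (fun x => f x + g x).
Proof.
move=> [h1 h2] [h3 h4]; split.
  by apply: eq_rintegrable (rintegrableD h1 h3) => x _; rewrite cReD.
by apply: eq_rintegrable (rintegrableD h2 h4) => x _; rewrite cImD.
Qed.

Lemma cintegrableN f : cintegrable f -> cintegrable (fun x => - f x).
Proof.
by move=> /(cintegrableZ (-1)); apply: eq_cintegrable => x _; rewrite mulN1r.
Qed.

Lemma cintegrableB f g : cintegrable f -> cintegrable g ->
  cintegrable (fun x => f x - g x).
Proof. by move=> hf /cintegrableN; exact: cintegrableD. Qed.

Lemma cintegrable_cst c : cintegrable (cst c).
Proof. by split; exact: rintegrable_cst. Qed.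

Lemma cintegrable_sum I (s : seq I) (P : pred I) (F : I -> 'rV[R]_d -> R[i]) :
  (forall i, cintegrable (F i)) ->
  cintegrable (fun x => \sum_(i <- s | P i) F i x).
Proof.
move=> h; elim: s => [|i s IH].
  by apply: eq_cintegrable (cintegrable_cst 0) => x _; rewrite big_nil.
have [Pi|nPi] := boolP (P i).
  by apply: eq_cintegrable (cintegrableD (h i) IH) => x _; rewrite big_cons Pi.
by apply: eq_cintegrable IH => x _; rewrite big_cons (negbTE nPi).
Qed.

Lemma cube_intD f g : cintegrable f -> cintegrable g ->
  cube_int (fun x => f x + g x) = cube_int f + cube_int g.
Proof.
move=> [h1 h2] [h3 h4]; rewrite !cube_intE [RHS]/GRing.add/=; congr (_ +i* _).
  by rewrite -rintD//; apply: eq_rint => x _; rewrite cReD.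
by rewrite -rintD//; apply: eq_rint => x _; rewrite cImD.
Qed.

Lemma cube_intZ c f : cintegrable f -> cube_int (fun x => c * f x) = c * cube_int f.
Proof.
move=> [h1 h2]; rewrite !cube_intE [RHS]complex_eta cReM cImM /=; congr (_ +i* _).
  rewrite -!rintZ// -rintB; [|exact: rintegrableZ..].
  by apply: eq_rint => x _; rewrite cReM.
rewrite -!rintZ// -rintD; [|exact: rintegrableZ..].
by apply: eq_rint => x _; rewrite cImM.
Qed.

Lemma cube_int_cst c : cube_int (cst c : 'rV[R]_d -> R[i]) = c.
Proof. by rewrite cube_intE !rint_cst; case: c. Qed.

Lemma cube_intN f : cintegrable f -> cube_int (fun x => - f x) = - cube_int f.
Proof.
by move=> h; rewrite -mulN1r -cube_intZ//; apply: eq_cube_int => x _; rewrite mulN1r.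
Qed.

Lemma cube_intB f g : cintegrable f -> cintegrable g ->
  cube_int (fun x => f x - g x) = cube_int f - cube_int g.
Proof. by move=> hf hg; rewrite cube_intD ?cube_intN//; exact: cintegrableN. Qed.

Lemma cube_int_sum I (s : seq I) (P : pred I) (F : I -> 'rV[R]_d -> R[i]) :
  (forall i, cintegrable (F i)) ->
  cube_int (fun x => \sum_(i <- s | P i) F i x) =
  \sum_(i <- s | P i) cube_int (F i).
Proof.
move=> h; elim: s => [|i s IH].
  rewrite big_nil -[RHS](cube_int_cst 0).
  by apply: eq_cube_int => x _; rewrite big_nil.
have [Pi|nPi] := boolP (P i).
  rewrite big_cons Pi -IH -cube_intD//; last exact: cintegrable_sum.
  by apply: eq_cube_int => x _; rewrite big_cons Pi.
by rewrite big_cons (negbTE nPi) -IH; apply: eq_cube_int => x _;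
  rewrite big_cons (negbTE nPi).
Qed.

(** Multiplying by the conjugate of the integral rotates it onto the positive real axis, so that
    bounds on a complex integral reduce to monotonicity of a real one. *)
Lemma nc_cube_int_sqr f : cintegrable f ->
  nc (cube_int f) ^+ 2 = rint (fun x => complex.Re ((cube_int f)^*%C * f x)).
Proof.
move=> hf; transitivity (complex.Re ((cube_int f)^*%C * cube_int f)).
  by rewrite mulrC mulJc.
by rewrite -cube_intZ.
Qed.

Lemma nc_cube_int_le f G : cintegrable f -> rintegrable G ->
  (forall x, cube x -> nc (f x) <= G x) -> nc (cube_int f) <= rint G.
Proof.
move=> hf hG fG; set N := nc _.
have [N0|N0] := leP N 0.
  apply: le_trans N0 (rint_ge0 _) => x /fG; exact/le_trans/nc_ge0.
rewrite -(ler_pM2l N0) -expr2 nc_cube_int_sqr// -rintZ//.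
apply: le_rint; [|exact: rintegrableZ|].
  exact: (cintegrableZ _ hf).1.
move=> x /fG h; apply: le_trans (Re_le_nc _) _.
by rewrite ncM nc_conj ler_wpM2l// ltW.
Qed.

Lemma nc_cube_int_sqr_le f : cintegrable f ->
  rintegrable (fun x => nc (f x) ^+ 2) ->
  nc (cube_int f) ^+ 2 <= rint (fun x => nc (f x) ^+ 2).
Proof.
move=> hf h2; set N := nc _.
(* The pointwise bound N |f| <= (N^2 + |f|^2) / 2 takes the place of the Cauchy-Schwarz inequality
   for integrals. *)
suff : N ^+ 2 <= 2^-1 * (N ^+ 2 + rint (fun x => nc (f x) ^+ 2)) by lra.
have hc := rintegrable_cst (N ^+ 2).
have -> : 2^-1 * (N ^+ 2 + rint (fun x => nc (f x) ^+ 2)) =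
    rint (fun x => 2^-1 * (N ^+ 2 + nc (f x) ^+ 2)).
  by rewrite rintZ ?rintD ?rint_cst//; exact: rintegrableD.
rewrite [leLHS](nc_cube_int_sqr hf); apply: le_rint.
- exact: (cintegrableZ _ hf).1.
- exact/rintegrableZ/rintegrableD.
- move=> x _; apply: le_trans (Re_le_nc _) _; rewrite ncM nc_conj -/N /cst.
  by have := sqr_ge0 (N - nc (f x)); nra.
Qed.

Lemma compact_cube : compact (@cube R d).
Proof.
rewrite (_ : @cube R d =
    [set v : 'rV[R]_d | forall i, `[(0:R), 1]%classic (v ord0 i)]).
  apply: (@rV_compact _  _ (fun=> `[(0:R), 1]%classic)) => _.
  exact: segment_compact.
by apply/seteqP; split => x h i; have := h i; rewrite /= in_itv.
Qed.

Lemma continuous_cube_bounded G : {within @cube R d, continuous G} ->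
  exists M, forall x, cube x -> `|G x| <= M.
Proof.
move=> cG; have [M [Mr hM]] := compact_bounded (continuous_compact cG compact_cube).
by exists (M + 1) => x cx; apply: hM; [rewrite ltrDl|exists x].
Qed.

Lemma continuous_rintegrable G : {within @cube R d, continuous G} -> rintegrable G.
Proof.
move=> cG; apply: measurable_bounded_integrable; first exact: mQ.
- by rewrite [ltLHS]lebesgue_tcube ltry.
- exact: measurable_cube_continuous.
- have [M hM] := continuous_cube_bounded cG.
  by exists M; split; [exact: num_real|move=> M' /ltW MM' t /hM/le_trans; exact].
Qed.

Definition ccontinuous f :=
  {within @cube R d, continuous (f : 'rV[R]_d -> (R[i] : numClosedFieldType))}.

Lemma ccontinuousP f : ccontinuous f <->
  {within @cube R d, continuous (fun x => complex.Re (f x) : R)} /\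
  {within @cube R d, continuous (fun x => complex.Im (f x) : R)}.
Proof. exact: (@continuous_complexP R (subspace (@cube R d)) f). Qed.

Lemma ccontinuous_cintegrable f : ccontinuous f -> cintegrable f.
Proof.
by move=> /ccontinuousP[h1 h2]; split; exact: continuous_rintegrable.
Qed.

Lemma ccontinuousD f g : ccontinuous f -> ccontinuous g ->
  ccontinuous (fun x => f x + g x).
Proof.
move=> /ccontinuousP[h1 h2] /ccontinuousP[h3 h4]; apply/ccontinuousP; split.
  rewrite (_ : (fun x => _) = fun x => complex.Re (f x) + complex.Re (g x)).
    exact: continuous_addf.
  by apply/funext => x; rewrite cReD.
rewrite (_ : (fun x => _) = fun x => complex.Im (f x) + complex.Im (g x)).
  exact: continuous_addf.
by apply/funext => x; rewrite cImD.
Qed.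

Lemma ccontinuousM f g : ccontinuous f -> ccontinuous g ->
  ccontinuous (fun x => f x * g x).
Proof.
move=> /ccontinuousP[h1 h2] /ccontinuousP[h3 h4]; apply/ccontinuousP; split.
  rewrite (_ : (fun x => _) = fun x =>
      complex.Re (f x) * complex.Re (g x) - complex.Im (f x) * complex.Im (g x)).
    by apply: continuous_subf; exact: continuous_mulf.
  by apply/funext => x; rewrite cReM.
rewrite (_ : (fun x => _) = fun x =>
    complex.Re (f x) * complex.Im (g x) + complex.Im (f x) * complex.Re (g x)).
  by apply: continuous_addf; exact: continuous_mulf.
by apply/funext => x; rewrite cImM.
Qed.

Lemma ccontinuous_cst c : ccontinuous (cst c).
Proof. by apply/ccontinuousP; split=> x; exact: cst_continuous. Qed.

Lemma ccontinuousB f g : ccontinuous f -> ccontinuous g ->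
  ccontinuous (fun x => f x - g x).
Proof.
move=> hf hg; rewrite (_ : (fun x => _) = fun x => f x + (-1) * g x).
  exact: (ccontinuousD hf (ccontinuousM (@ccontinuous_cst (-1)) hg)).
by apply/funext => x; rewrite mulN1r.
Qed.

Lemma ccontinuous_sum I (s : seq I) (P : pred I) (F : I -> 'rV[R]_d -> R[i]) :
  (forall i, ccontinuous (F i)) ->
  ccontinuous (fun x => \sum_(i <- s | P i) F i x).
Proof.
move=> h; elim: s => [|i s IH].
  rewrite (_ : (fun x => _) = cst 0); first exact: ccontinuous_cst.
  by apply/funext => x; rewrite big_nil.
have [Pi|nPi] := boolP (P i).
  rewrite (_ : (fun x => _) = fun x => F i x + \sum_(j <- s | P j) F j x).
    exact: (ccontinuousD (h i) IH).
  by apply/funext => x; rewrite big_cons Pi.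
rewrite (_ : (fun x => _) = fun x => \sum_(j <- s | P j) F j x) //.
by apply/funext => x; rewrite big_cons (negbTE nPi).
Qed.

Lemma ccontinuous_nc_sqr f : ccontinuous f ->
  {within @cube R d, continuous (fun x => nc (f x) ^+ 2)}.
Proof.
move=> /ccontinuousP[h1 h2].
rewrite (_ : (fun x => _) = fun x =>
    complex.Re (f x) * complex.Re (f x) + complex.Im (f x) * complex.Im (f x)).
  by apply: continuous_addf; exact: continuous_mulf.
by apply/funext => x; rewrite nc_sqrE !expr2.
Qed.

End cube_integral.

(** * Characters and trigonometric polynomials *)

Section characters.
Context (R : realType) (d : nat).
Implicit Types (k l : 'rV[int]_d) (x y : 'rV[R]_d) (phi : R).

Definition chi k x : R[i] := expi (2 * pi * dotp k x).

Lemma dotpDl k l x : dotp (k + l) x = dotp k x + dotp l x.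
Proof.
rewrite /dotp -big_split/=; apply: eq_bigr => i _.
by rewrite mxE intrD mulrDl.
Qed.

Lemma dotpNl k x : dotp (- k) x = - dotp k x.
Proof.
rewrite /dotp -sumrN; apply: eq_bigr => i _.
by rewrite mxE mulrNz mulNr.
Qed.

Lemma dotp0l x : dotp (0 : 'rV[int]_d) x = 0.
Proof. by rewrite /dotp big1// => i _; rewrite mxE mul0r. Qed.

Lemma chiD k l x : chi (k + l) x = chi k x * chi l x.
Proof. by rewrite /chi dotpDl mulrDr expiD. Qed.

Lemma chiN k x : chi (- k) x = (chi k x)^*%C.
Proof. by rewrite /chi dotpNl mulrN expiN. Qed.

Lemma chi0 x : chi 0 x = 1.
Proof. by rewrite /chi dotp0l mulr0 expi0. Qed.

Lemma nc_chi k x : nc (chi k x) = 1.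
Proof. exact: nc_expi. Qed.

Lemma continuous_dotp k : continuous (fun x : 'rV[R]_d => dotp k x : R).
Proof.
rewrite /dotp; elim: (index_enum _) => [|i s IH].
  rewrite (_ : (fun x => _) = cst 0); first exact: cst_continuous.
  by apply/funext => x; rewrite big_nil.
rewrite (_ : (fun x => _) = fun x : 'rV[R]_d =>
    (k 0 i)%:~R * x 0 i + \sum_(j <- s) (k 0 j)%:~R * x 0 j); last first.
  by apply/funext => x; rewrite big_cons.
apply: continuous_addf => //; apply: continuous_mulf; last exact: coord_continuous.
exact: cst_continuous.
Qed.

(** The phase lets one statement serve both the real and the imaginary part of a character, since
    sine is a shifted cosine. *)
Lemma continuous_cos_dotp k phi :
  continuous (fun x : 'rV[R]_d => cos (2 * pi * dotp k x + phi) : R).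
Proof.
move=> x; apply: (@continuous_comp _ _ _ (fun x => 2 * pi * dotp k x + phi) cos);
  last exact: continuous_cos.
move: x; apply: continuous_addf; last exact: cst_continuous.
apply: continuous_mulf; last exact: continuous_dotp.
exact: cst_continuous.
Qed.

Lemma ccontinuous_chi k : ccontinuous (chi k).
Proof.
apply/ccontinuousP; split.
  apply: continuous_subspaceT.
  rewrite (_ : (fun x => _) = fun x => cos (2 * pi * dotp k x + 0)).
    exact: continuous_cos_dotp.
  by apply/funext => x; rewrite addr0.
apply: continuous_subspaceT.
rewrite (_ : (fun x => _) = fun x => cos (2 * pi * dotp k x + - (pi / 2))).
  exact: continuous_cos_dotp.
by apply/funext => x; rewrite cosBpihalf.
Qed.

Lemma fourierE (f : 'rV[R]_d -> R[i]) k :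
  fourier f k = cube_int (fun x => f x * (chi k x)^*%C).
Proof. by apply: eq_cube_int => x _; rewrite /chi expiN. Qed.

End characters.

Arguments chi : simpl never.

Section cosine_integral.
Context (R : realType).
Local Notation T := (measurableTypeR R).

(* Adding 1 makes the integrand non-negative, so that the integral over a
   product can be iterated without integrability conditions. *)
Lemma integral_cos1 (m : int) (phi : R) :
  (\int[lebesgue_measure]_(x in `[0%R, 1%R])
     (cos (2 * pi * (m%:~R * x) + phi) + 1)%:E =
   ((m == 0)%:R * cos phi + 1)%:E)%E.
Proof.
have [->|m0] := eqVneq m 0.
  under eq_integral do rewrite mul0r mulr0 add0r.
  rewrite integral_cst//= lebesgue_measure_itv/= lte_fin ltr01.
  by rewrite mul1r oppr0 adde0 mule1.
pose w : R := 2 * pi * m%:~R.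
have w0 : w != 0.
  by rewrite /w mulf_neq0 ?intr_eq0// mulf_neq0 ?pnatr_eq0// gt_eqF ?pi_gt0.
pose F (x : R) : R := w^-1 * sin (w * x + phi) + x.
have dF (x : R) : is_derive x 1 F (cos (w * x + phi) + 1).
  rewrite /F; apply: is_derive_eq.
  by rewrite /GRing.scale/= mulr1 addr0 mulrCA mulVf// mulr1.
have dF' (x : R) : derivable F x 1 by have [] := dF x.
have cF : continuous F by move=> x; apply/differentiable_continuous/derivable1_diffP.
transitivity (\int[lebesgue_measure]_(x in `[0%R, 1%R]) (cos (w * x + phi) + 1)%:E)%E.
  by apply: eq_integral => x _; rewrite /w -!mulrA.
rewrite (@continuous_FTC2 _ _ F)//; first last.
- by move=> x _; rewrite derive1E; have [_ ->] := dF x.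
- split => [x _| |]; first exact: dF'.
    exact/cvg_at_right_filter/cF.
  exact/cvg_at_left_filter/cF.
- apply: continuous_subspaceT; apply: continuous_addf; last exact: cst_continuous.
  move=> x.
  apply: (@continuous_comp _ _ _ (fun x => w * x + phi) cos); last exact: continuous_cos.
  move: x; apply: continuous_addf; last exact: cst_continuous.
  apply: continuous_mulf; first exact: cst_continuous.
  by move=> x; exact: cvg_id.
rewrite -EFinB; congr (_%:E); rewrite /F mul0r add0r mulr1 mulr0 add0r addr0.
have -> : sin (w + phi) = sin phi.
  rewrite -[LHS]cosBpihalf -[RHS]cosBpihalf -[RHS](cos_2piz m) /w.
  by congr cos; ring.
by rewrite addrAC subrr add0r.
Qed.

(** The phase is arbitrary for the sake of the induction: the first coordinate moves into the phase
    of the integral over the others. *)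
Lemma integral_cos d (k : 'rV[int]_d) (phi : R) :
  (\int[lebesgue_tuple R d]_(t in @tcube R d)
     (cos (2 * pi * dotp k (row_of_tuple t) + phi) + 1)%:E =
   ((k == 0)%:R * cos phi + 1)%:E)%E.
Proof.
elim: d k phi => [|d IH] k phi.
  have -> : k = 0 by apply/rowP => -[].
  under eq_integral do rewrite dotp0l mulr0 add0r.
  rewrite integral_cst; last exact: measurable_tcube.
  by rewrite eqxx mul1r [X in (_ * X)%E](lebesgue_tcube R 0) mule1.
rewrite integral_tcubeS; last 2 first.
- apply/measurable_EFinP.
  apply: (@measurable_cube_continuous R d.+1 (fun x => cos (2 * pi * dotp k x + phi) + 1)).
  apply: continuous_subspaceT; apply: continuous_addf; first exact: continuous_cos_dotp.
  exact: cst_continuous.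
- by move=> t _; rewrite lee_fin; have := cos_geN1 (2 * pi * dotp k (row_of_tuple t) + phi); lra.
pose k' : 'rV[int]_d := \row_i k 0 (lift ord0 i).
have dE x t : dotp k (row_of_tuple (@consp R d (x, t))) =
    (k 0 ord0)%:~R * x + dotp k' (row_of_tuple t).
  rewrite /dotp big_ord_recl mxE; congr (_ * _ + _).
  by apply: eq_bigr => i _; rewrite !mxE tnthS.
transitivity (\int[lebesgue_measure]_(x in `[0%R, 1%R])
    ((k' == 0)%:R * cos (2 * pi * ((k 0 ord0)%:~R * x) + phi) + 1)%:E)%E.
  apply: eq_integral => x _; rewrite -IH; apply: eq_integral => t _.
  by rewrite dE; congr (_%:E); congr (cos _ + 1); ring.
have [k'0|k'0] := eqVneq k' 0; last first.
  under eq_integral do rewrite mul0r add0r.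
  rewrite integral_cst//= lebesgue_measure_itv/= lte_fin ltr01 oppr0 adde0 mule1.
  rewrite (_ : k == 0 = false) ?mul0r ?add0r//.
  by apply: contraNF k'0 => /eqP k0; apply/eqP/rowP => i; rewrite !mxE k0 mxE.
under eq_integral do rewrite mul1r.
rewrite integral_cos1; suff -> : (k 0 ord0 == 0) = (k == 0) by [].
apply/eqP/eqP => [k0|k0]; last by rewrite k0 mxE.
apply/rowP => i; rewrite mxE; case: (unliftP ord0 i) => [j ->|->//].
by move/rowP/(_ j): k'0; rewrite !mxE.
Qed.

End cosine_integral.

Lemma sum_seq_delta (V : pzSemiRingType) (I : eqType) (s : seq I) (F : I -> V) k :
  uniq s -> \sum_(l <- s) F l * (l == k)%:R = if k \in s then F k else 0.
Proof.
move=> us; case: ifPn => ks.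
  rewrite (bigD1_seq k)//= eqxx mulr1 big1 ?addr0// => l /negbTE ->.
  by rewrite mulr0.
rewrite big_seq big1// => l ls; case: eqVneq => [lk|]; last by rewrite mulr0.
by rewrite -lk ls in ks.
Qed.

Section orthogonality.
Context (R : realType) (d : nat).
Implicit Types (k l : 'rV[int]_d) (c : 'rV[int]_d -> R[i]) (s : seq 'rV[int]_d).

Lemma rint_cos k (phi : R) :
  rint (fun x => cos (2 * pi * dotp k x + phi)) = (k == 0)%:R * cos phi.
Proof.
have ic : rintegrable (fun x : 'rV[R]_d => cos (2 * pi * dotp k x + phi)).
  by apply: continuous_rintegrable; apply: continuous_subspaceT; exact: continuous_cos_dotp.
have i1 := @rintegrable_cst R d 1.
have := integral_cos k phi; rewrite (rint_ereal (rintegrableD ic i1)) => -[].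
by rewrite rintD// (rint_cst d 1) => /addIr.
Qed.

Lemma cube_int_chi k : cube_int (@chi R d k) = (k == 0)%:R.
Proof.
rewrite cube_intE.
have -> : rint (fun x => complex.Re (@chi R d k x)) = (k == 0)%:R.
  transitivity (rint (fun x : 'rV[R]_d => cos (2 * pi * dotp k x + 0))).
    by apply: eq_rint => x _; rewrite addr0.
  by rewrite rint_cos cos0 mulr1.
have -> : rint (fun x => complex.Im (@chi R d k x)) = 0.
  transitivity (rint (fun x : 'rV[R]_d => cos (2 * pi * dotp k x - pi / 2))).
    by apply: eq_rint => x _; rewrite cosBpihalf.
  by rewrite rint_cos cosN cos_pihalf mulr0.
by case: (k == 0).
Qed.

Definition tp s c (x : 'rV[R]_d) : R[i] := \sum_(k <- s) c k * chi k x.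

Lemma ccontinuous_tp s c : ccontinuous (tp s c).
Proof.
apply: ccontinuous_sum => k.
exact: (ccontinuousM (@ccontinuous_cst R d (c k)) (@ccontinuous_chi R d k)).
Qed.

Lemma cube_int_chiMJ k l :
  cube_int (fun x => @chi R d k x * (chi l x)^*%C) = (k == l)%:R.
Proof.
rewrite -subr_eq0 -cube_int_chi; apply: eq_cube_int => x _.
by rewrite chiD chiN.
Qed.

Lemma fourier_tp s c k : uniq s ->
  fourier (tp s c) k = if k \in s then c k else 0.
Proof.
move=> us; rewrite fourierE.
transitivity (cube_int (fun x => \sum_(l <- s) c l * (@chi R d l x * (chi k x)^*%C))).
  apply: eq_cube_int => x _; rewrite /tp mulr_suml.
  by apply: eq_bigr => l _; rewrite mulrA.
have ic l : cintegrable (fun x => @chi R d l x * (chi k x)^*%C).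
  rewrite (_ : (fun x => _) = @chi R d (l - k)).
    exact/ccontinuous_cintegrable/ccontinuous_chi.
  by apply/funext => x; rewrite chiD chiN.
rewrite cube_int_sum; last by move=> l; exact: cintegrableZ.
under eq_bigr do rewrite cube_intZ// cube_int_chiMJ.
exact: sum_seq_delta.
Qed.

Lemma rint_real (G : 'rV[R]_d -> R) : cube_int (fun x => (G x)%:C) = (rint G)%:C.
Proof. by rewrite cube_intE /= (rint_cst d 0). Qed.

Lemma parseval_tp s c : uniq s ->
  rint (fun x => nc (tp s c x) ^+ 2) = \sum_(k <- s) nc (c k) ^+ 2.
Proof.
move=> us; apply: complexI; rewrite -rint_real real_complex_sum.
have ct := @ccontinuous_tp s c.
have ic k : cintegrable (fun x => tp s c x * (chi k x)^*%C).
  rewrite (_ : (fun x => _) = fun x => tp s c x * chi (- k) x).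
    exact: (ccontinuous_cintegrable (ccontinuousM ct (@ccontinuous_chi R d (- k)))). 
  by apply/funext => x; rewrite chiN.
transitivity (cube_int (fun x =>
    \sum_(k <- s) (c k)^*%C * (tp s c x * (chi k x)^*%C))).
  apply: eq_cube_int => x _; rewrite -mulJc /tp conjc_sum mulr_sumr.
  by apply: eq_bigr => k _; rewrite conjcM mulrCA.
rewrite cube_int_sum; last by move=> k; exact: cintegrableZ.
rewrite big_seq [RHS]big_seq; apply: eq_bigr => k ks.
by rewrite cube_intZ// -fourierE fourier_tp// ks mulrC mulJc.
Qed.

End orthogonality.

(** * The unit ball *)

Lemma sum_seq_swap (V : nmodType) (I : eqType) (s s' : seq I) (F : I -> V) :
  uniq s -> uniq s' ->
  \sum_(k <- s | k \in s') F k = \sum_(k <- s' | k \in s) F k.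
Proof.
move=> us us'; rewrite -[LHS]big_filter -[RHS]big_filter.
suff p : perm_eq [seq k <- s | k \in s'] [seq k <- s' | k \in s] by rewrite (perm_big _ p).
apply: uniq_perm; [exact: filter_uniq..|].
by move=> k; rewrite !mem_filter andbC.
Qed.

Lemma sum_seq_sub (V : nmodType) (I : eqType) (s s' : seq I) (F : I -> V) :
  uniq s -> uniq s' -> {subset s <= s'} ->
  \sum_(k <- s' | k \in s) F k = \sum_(k <- s) F k.
Proof.
move=> us us' ss; rewrite sum_seq_swap// big_mkcond big_seq [RHS]big_seq.
by apply: eq_bigr => k /ss ->.
Qed.

Lemma sum_seqD1 (V : nmodType) (I : eqType) (s : seq I) (P : pred I) (F : I -> V) j :
  uniq s -> j \in s -> P j ->
  \sum_(k <- s | P k) F k = F j + \sum_(k <- s | P k && (k != j)) F k.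
Proof.
move=> us js Pj; rewrite big_mkcond (bigD1_seq j)//= Pj; congr (_ + _).
by rewrite big_mkcond [RHS]big_mkcond; apply: eq_bigr => k _; rewrite andbC; case: eqP.
Qed.

Section seq_sums.
Context (R : realFieldType) (I : eqType).
Implicit Types (s : seq I) (F G : I -> R).

Lemma ler_sum_seq_sub s s' F : uniq s -> uniq s' -> {subset s <= s'} ->
  (forall k, 0 <= F k) -> \sum_(k <- s) F k <= \sum_(k <- s') F k.
Proof.
move=> us us' ss F0; rewrite -(sum_seq_sub F us us' ss).
by rewrite [leRHS](bigID (mem s))/= lerDl sumr_ge0.
Qed.

Lemma sum_CauchySchwarz s (P : pred I) F G : (forall k, 0 < G k) ->
  (\sum_(k <- s | P k) F k) ^+ 2 <=
  (\sum_(k <- s | P k) F k ^+ 2 / G k) * (\sum_(k <- s | P k) G k).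
Proof.
move=> G0; set A := \sum_(k <- s | P k) F k; set B := \sum_(_ <- _ | _) _ / _.
set S := \sum_(_ <- _ | _) G _.
have S0 : 0 <= S by apply: sumr_ge0 => k _; exact: ltW.
have [S1|S1] := eqVneq S 0.
  have s0 k : k \in s -> P k -> F k = 0.
    move=> ks Pk; have : \sum_(k <- s | P k) G k == 0 by rewrite -/S S1.
    rewrite psumr_eq0; last by move=> i _; exact: ltW.
    by move=> /allP/(_ k ks); rewrite Pk/= gt_eqF.
  rewrite S1 mulr0 /A big_seq_cond big1 ?expr0n//.
  by move=> k /andP[ks Pk]; exact: s0.
have {}S0 : 0 < S by rewrite lt_neqAle eq_sym S1.
(* The weighted variance of F / G about its mean A / S, with weights G, equals B - A^2 / S. *)
have : 0 <= \sum_(k <- s | P k) G k * (F k / G k - A / S) ^+ 2.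
  by apply: sumr_ge0 => k _; rewrite mulr_ge0 ?sqr_ge0// ltW.
rewrite (eq_bigr (fun k => F k ^+ 2 / G k - (2 * (A / S)) * F k + (A / S) ^+ 2 * G k)); last first.
  by move=> k _; field; rewrite ?gt_eqF.
rewrite big_split/= sumrB -!mulr_sumr -/A -/B -/S => h.
have : A ^+ 2 / S <= B.
  by rewrite -subr_ge0; apply: le_trans h _; rewrite le_eqVlt; apply/orP; left; apply/eqP; field; rewrite ?gt_eqF.
by rewrite ler_pdivrMr.
Qed.

End seq_sums.

Section ereal_sqrt.
Context (R : realType).
Implicit Types (x : \bar R) (a : R).

Lemma le_poweR_half x a : (0 <= x)%E -> 0 <= a ->
  (x `^ 2^-1 <= a%:E)%E = (x <= (a ^+ 2)%:E)%E.
Proof.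
case: x => [r r0 a0| _ a0|//]; last by rewrite poweRyr ?invr_eq0.
rewrite poweR_EFin powR12_sqrt// !lee_fin.
rewrite -{1}(ger0_norm a0) -sqrtr_sqr ler_sqrt//.
exact: sqr_ge0.
Qed.

Lemma ge_poweR_half x a : (0 <= x)%E -> 0 <= a ->
  (a%:E <= x `^ 2^-1)%E = ((a ^+ 2)%:E <= x)%E.
Proof.
case: x => [r r0 a0| _ a0|//]; last by rewrite poweRyr ?invr_eq0// !leey.
rewrite poweR_EFin powR12_sqrt// !lee_fin.
by rewrite -{1}(ger0_norm a0) -sqrtr_sqr ler_sqrt.
Qed.

Lemma poweR_half_lty x : (0 <= x)%E -> (x `^ 2^-1 < +oo)%E = (x < +oo)%E.
Proof.
by case: x => [r _|_|//]; [rewrite poweR_EFin !ltry|rewrite poweRyr ?invr_eq0].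
Qed.

End ereal_sqrt.

Section weighted_space.
Context (R : realType) (d : nat) (lam : 'rV[int]_d -> R).
Hypothesis lam0 : forall k, 0 < lam k.
Implicit Types (f g : 'rV[R]_d -> R[i]) (c : 'rV[int]_d -> R[i]).
Implicit Type s : seq 'rV[int]_d.

(** The square of [Hnorm]; norms are compared through it, before the root is taken. *)
Definition Hsum f : \bar R :=
  \esum_(k in [set k | lam k != 0%R]) (nc (fourier f k) ^+ 2 / lam k)%:E.

Let term_ge0 f k : 0 <= nc (fourier f k) ^+ 2 / lam k.
Proof. by rewrite divr_ge0 ?sqr_ge0// ltW. Qed.

Lemma Hsum_ge0 f : (0 <= Hsum f)%E.
Proof. by apply: esum_ge0 => k _; rewrite lee_fin. Qed.

Lemma Hsum_ge f s : uniq s ->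
  ((\sum_(k <- s) nc (fourier f k) ^+ 2 / lam k)%:E <= Hsum f)%E.
Proof.
move=> us; apply: esum_ge; exists [set` s].
  by split=> [|k _ /=]; [exact: finite_seq|rewrite gt_eqF].
by rewrite -fsbig_seq// sumEFin.
Qed.

Lemma Hsum_tp s c : uniq s ->
  (Hsum (tp s c) <= (\sum_(k <- s) nc (c k) ^+ 2 / lam k)%:E)%E.
Proof.
move=> us; apply: ge_ereal_sup => _ [X [finX XI] <-].
rewrite fsbig_finite// sumEFin lee_fin.
under eq_bigr do rewrite fourier_tp//.
rewrite [leLHS](bigID (mem s))/= [X in _ + X]big1 ?addr0; last first.
  by move=> k /negbTE ->; rewrite nc0 expr0n/= mul0r.
rewrite (eq_bigr (fun k => nc (c k) ^+ 2 / lam k)); last by move=> k ->.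
rewrite -[leLHS]big_filter; apply: ler_sum_seq_sub => //.
- exact/filter_uniq/finmap.fset_uniq.
- by move=> k; rewrite mem_filter => /andP[].
- by move=> k; rewrite divr_ge0 ?sqr_ge0// ltW.
Qed.

Lemma tp_Hspace s c : uniq s -> Hspace lam (tp s c).
Proof.
move=> us; split; first exact: ccontinuous_tp.
  by move=> k /eqP; rewrite gt_eqF.
rewrite poweR_half_lty ?Hsum_ge0//.
exact: le_lt_trans (Hsum_tp c us) (ltry _).
Qed.

Lemma tp_Hball s c : uniq s -> \sum_(k <- s) nc (c k) ^+ 2 / lam k <= 1 ->
  Hball lam (tp s c).
Proof.
move=> us c1; split; first exact: tp_Hspace.
rewrite (@le_poweR_half R _ 1) ?Hsum_ge0// expr1n.
by apply: le_trans (Hsum_tp c us) _; rewrite lee_fin.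
Qed.

Lemma Hball_sum f s : Hball lam f -> uniq s ->
  \sum_(k <- s) nc (fourier f k) ^+ 2 / lam k <= 1.
Proof.
move=> [_ f1] us; rewrite -lee_fin; apply: le_trans (Hsum_ge f us) _.
by move: f1; rewrite (@le_poweR_half R _ 1) ?Hsum_ge0// expr1n.
Qed.

Lemma Hball_ccontinuous f : Hball lam f -> ccontinuous f.
Proof. by move=> [[]]. Qed.

End weighted_space.

Section frequency_box.
Context (d : nat).
Implicit Types (k l : 'rV[int]_d) (N : nat).

Definition ninf k : nat := \max_i `|(k 0 i)%R|%N.

Lemma ninf_leP k N : reflect (forall i, (`|(k 0 i)%R| <= N)%N) (ninf k <= N)%N.
Proof.
by rewrite /ninf; apply: (iffP (bigmax_leqP _ _ _)) => [h i|h i _]; exact: h.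
Qed.

Lemma abs_le_ninf k i : (`|(k 0 i)%R| <= ninf k)%N.
Proof. exact: (leq_bigmax i). Qed.

Lemma ninf0 : ninf 0 = 0%N.
Proof. by apply/eqP; rewrite -leqn0; apply/ninf_leP => i; rewrite mxE. Qed.

Lemma ninf_eq0 k : (ninf k == 0%N) = (k == 0).
Proof.
apply/eqP/eqP => [h|->]; last exact: ninf0.
apply/rowP => i; rewrite mxE; have := abs_le_ninf k i.
by rewrite h leqn0 absz_eq0 => /eqP.
Qed.

Lemma ninfN k : ninf (- k) = ninf k.
Proof. by apply: eq_bigr => i _; rewrite mxE abszN. Qed.

Lemma ninfD k l : (ninf (k + l) <= ninf k + ninf l)%N.
Proof.
have h (a b : int) : (`|(a + b)%R| <= `|a| + `|b|)%N by lia.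
apply/ninf_leP => i; rewrite mxE; apply: leq_trans (h _ _) _.
exact: leq_add (abs_le_ninf k i) (abs_le_ninf l i).
Qed.

(** The frequencies of sup norm at most N. Shifting vectors of ordinals makes the size an exact
    power, to be compared with the number of functionals and of grid nodes. *)
Definition box N : seq 'rV[int]_d :=
  [seq \row_i ((a 0 i)%:Z - N%:Z) | a : 'rV['I_N.*2.+1]_d].

Lemma box_uniq N : uniq (box N).
Proof.
rewrite map_inj_uniq ?enum_uniq// => a b /rowP h.
by apply/rowP => i; have := h i; rewrite !mxE => /addIr [] /val_inj.
Qed.

Lemma mem_box N k : (k \in box N) = (ninf k <= N)%N.
Proof.
apply/mapP/ninf_leP => [[a _ ->] i|h].
  have h (m n : nat) : (m < n.*2.+1)%N -> (`|(m%:Z - n%:Z)%R| <= n)%N by lia.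
  by rewrite mxE; apply/h/ltn_ord.
have h1 (a : int) : (`|a| <= N)%N -> (`|(a + N%:Z)%R|%N < N.*2.+1)%N by lia.
have h2 (a : int) : (`|a| <= N)%N -> a = `|(a + N%:Z)%R|%N%:Z - N%:Z by lia.
have p i := h1 _ (h i).
exists (\row_i Ordinal (p i)); first by rewrite mem_enum.
by apply/rowP => i; rewrite !mxE /= -h2.
Qed.

Lemma size_box N : size (box N) = (N.*2.+1 ^ d)%N.
Proof. by rewrite size_map -cardE card_mx card_ord mul1n. Qed.

Lemma sub_box M N : (M <= N)%N -> {subset box M <= box N}.
Proof. by move=> MN k; rewrite !mem_box => /leq_trans; exact. Qed.

End frequency_box.

(** * Uniform bounds from Fourier coefficients *)

Section trigonometric_polynomials.
Context (R : realType) (d : nat).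
Implicit Types (g : 'rV[R]_d -> R[i]) (x y : 'rV[R]_d).

(** A list of terms in which frequencies may repeat makes closure under sums and products immediate;
    [trig_tp] merges equal frequencies afterwards. *)
Definition trig g := exists s : seq (R[i] * 'rV[int]_d),
  forall x, g x = \sum_(p <- s) p.1 * chi p.2 x.

Lemma trig_cst (z : R[i]) : trig (cst z).
Proof. by exists [:: (z, 0)] => x; rewrite big_seq1 chi0 mulr1. Qed.

Lemma trig_chi k : trig (chi k).
Proof. by exists [:: (1, k)] => x; rewrite big_seq1 mul1r. Qed.

Lemma trigD g1 g2 : trig g1 -> trig g2 -> trig (fun x => g1 x + g2 x).
Proof. by move=> [s1 h1] [s2 h2]; exists (s1 ++ s2) => x; rewrite big_cat h1 h2. Qed.

Lemma trigM g1 g2 : trig g1 -> trig g2 -> trig (fun x => g1 x * g2 x).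
Proof.
move=> [s1 h1] [s2 h2].
exists [seq (p.1 * q.1, p.2 + q.2) | p <- s1, q <- s2] => x.
rewrite big_allpairs_dep h1 h2 mulr_suml; apply: eq_bigr => p _.
by rewrite mulr_sumr; apply: eq_bigr => q _ /=; rewrite chiD mulrACA.
Qed.

Lemma trig_prod I (r : seq I) (F : I -> 'rV[R]_d -> R[i]) :
  (forall i, trig (F i)) -> trig (fun x => \prod_(i <- r) F i x).
Proof.
move=> h; elim: r => [|i r IH].
  by have [s hs] := trig_cst 1; exists s => x; rewrite big_nil -hs.
by have [s hs] := trigM (h i) IH; exists s => x; rewrite big_cons -hs.
Qed.

Lemma trig_exp g m : trig g -> trig (fun x => g x ^+ m).
Proof.
move=> h; elim: m => [|m IH].
  by have [s hs] := trig_cst 1; exists s => x; rewrite expr0 -hs.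
by have [s hs] := trigM h IH; exists s => x; rewrite exprS -hs.
Qed.

Lemma trig_tp g : trig g -> exists N c, forall x, g x = tp (box d N) c x.
Proof.
move=> [s hs]; exists (\max_(p <- s) ninf p.2)%N.
exists (fun k => \sum_(p <- s | p.2 == k) p.1) => x.
rewrite hs /tp; under [RHS]eq_bigr do rewrite mulr_suml big_mkcond/=.
rewrite exchange_big/= big_seq [RHS]big_seq; apply: eq_bigr => p ps.
have pN : p.2 \in box d (\max_(q <- s) ninf q.2)%N.
  rewrite mem_box.
  exact: (@leq_bigmax_seq _ s xpredT (fun p : R[i] * 'rV[int]_d => ninf p.2) p ps isT).
rewrite (bigD1_seq p.2) ?box_uniq//= eqxx [X in _ + X]big1 ?addr0// => k.
by rewrite eq_sym => /negbTE ->.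
Qed.

(** A non-negative G has all its Fourier coefficients bounded by the one at 0, which is its
    integral. Expanding G turns the integral of h G into a finite combination of Fourier
    coefficients of h. *)
Lemma nc_cube_int_trig_le (h : 'rV[R]_d -> R[i]) (G : 'rV[R]_d -> R) (tau : R) :
  ccontinuous h -> (forall x, 0 <= G x) -> trig (fun x => (G x)%:C) ->
  (forall N, \sum_(k <- box d N) nc (fourier h k) <= tau) ->
  nc (cube_int (fun x => h x * (G x)%:C)) <= tau * rint G.
Proof.
move=> ch G0 /trig_tp[N [c hc]] htau.
have bu := @box_uniq d N.
have cG : ccontinuous (fun x => (G x)%:C).
  by rewrite (_ : (fun x => (G x)%:C) = tp (box d N) c);
    [exact: ccontinuous_tp|exact/funext].
have iG : rintegrable G by have [] := ccontinuous_cintegrable cG.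
have cc k : ccontinuous (fun x : 'rV[R]_d => (chi k x)^*%C).
  rewrite (_ : (fun x => _) = chi (- k)); first exact: ccontinuous_chi.
  by apply/funext => x; rewrite chiN.
have cle k : k \in box d N -> nc (c k) <= rint G.
  move=> kN; have -> : c k = fourier (fun x => (G x)%:C) k.
    by rewrite (_ : (fun x => _) = tp (box d N) c) ?fourier_tp ?kN//; exact/funext.
  rewrite fourierE; apply: nc_cube_int_le => //.
    exact: (ccontinuous_cintegrable (ccontinuousM cG (cc k))).
  by move=> x _; rewrite ncM nc_conj nc_chi mulr1 nc_real ger0_norm.
have -> : cube_int (fun x => h x * (G x)%:C) =
    \sum_(k <- box d N) (c k)^*%C * fourier h k.
  transitivity (cube_int (fun x => \sum_(k <- box d N) (c k)^*%C * (h x * (chi k x)^*%C))).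
    apply: eq_cube_int => x _.
    (* G is real; expanding its conjugate instead produces conjugate characters, hence Fourier
       coefficients of h. *)
    have -> : (G x)%:C = ((G x)%:C)^*%C by rewrite conjc_real.
    rewrite hc /tp conjc_sum mulr_sumr; apply: eq_bigr => k _.
    by rewrite conjcM mulrCA.
  have ic k : cintegrable (fun x => h x * (chi k x)^*%C).
    exact: (ccontinuous_cintegrable (ccontinuousM ch (cc k))).
  rewrite cube_int_sum; last by move=> k; exact: cintegrableZ.
  by apply: eq_bigr => k _; rewrite cube_intZ// fourierE.
apply: le_trans (nc_sum _ _ _) _.
have r0 : 0 <= rint G by apply: rint_ge0.
apply: (@le_trans _ _ (\sum_(k <- box d N) rint G * nc (fourier h k))).
  rewrite big_seq [leRHS]big_seq; apply: ler_sum => k kN.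
  by rewrite ncM nc_conj ler_wpM2r ?nc_ge0 ?cle.
by rewrite -mulr_sumr mulrC ler_wpM2r.
Qed.

End trigonometric_polynomials.

(** * Trigonometric polynomials concentrating at a point *)

Section peaks.
Context (R : realType) (d : nat).
Implicit Types (x y : 'rV[R]_d).

(** A 1-periodic trigonometric polynomial in y with values in [0, 1], equal to 1 at y = x; its
    normalised powers play the part of a Fejer kernel. *)
Definition peak x y : R := \prod_i cos (pi * (y 0 i - x 0 i)) ^+ 2.

Lemma peak_ge0 x y : 0 <= peak x y.
Proof. by apply: prodr_ge0 => i _; exact: sqr_ge0. Qed.

Lemma cos_sqr_le1 (t : R) : cos t ^+ 2 <= 1.
Proof. by rewrite cos2sin2 gerBl sqr_ge0. Qed.

Lemma trig_peak x m : trig (fun y => (peak x y ^+ m)%:C).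
Proof.
have h i : trig (fun y => (cos (pi * (y 0 i - x 0 i)) ^+ 2)%:C).
  pose e : 'rV[int]_d := delta_mx 0 i.
  have de y : dotp e y = y 0 i.
    rewrite /dotp (bigD1 i)//= big1 ?addr0 ?mxE ?eqxx ?mul1r// => j ji.
    by rewrite mxE eqxx (negbTE ji) mul0r.
  (* The identity cos^2 t = 1/2 + (e^(2it) + e^(-2it)) / 4, with the factors depending on x kept as
     constants. *)
  have [s hs] := trigD (trig_cst d (2^-1 : R)%:C)
    (trigM (trig_cst d (4^-1 : R)%:C)
     (trigD (trigM (trig_cst d (chi (- e) x)) (trig_chi R e))
            (trigM (trig_cst d (chi e x)) (trig_chi R (- e))))).
  exists s => y; rewrite -hs /cst /=.
  rewrite !chiN /chi !de.
  have -> : pi * (y 0 i - x 0 i) = pi * y 0 i - pi * x 0 i by rewrite mulrBr.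
  have D (t : R) : 2 * pi * t = pi * t *+ 2 by rewrite mulr2n; ring.
  rewrite !D; set a := pi * y 0 i; set b := pi * x 0 i.
  have -> : cos (a - b) ^+ 2 = 2^-1 + 4^-1 * (2 * (cos (b *+ 2) * cos (a *+ 2) + sin (b *+ 2) * sin (a *+ 2))).
    have : cos (a *+ 2 - b *+ 2) = cos (a - b) ^+ 2 *+ 2 - 1.
      by rewrite -cos_mulr2n mulrnBl.
    rewrite cosB; lra.
  rewrite /expi; apply/eqP; rewrite eq_complex /=; apply/andP; split; apply/eqP.
    by simpc => /=; field.
  by simpc => /=; field.
have [s hs] := trig_exp m (trig_prod (index_enum _) h).
exists s => y; rewrite -hs rmorphXn; congr (_ ^+ _).
by rewrite /peak rmorph_prod.
Qed.

Lemma continuous_peak x : continuous (peak x : 'rV[R]_d -> R).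
Proof.
rewrite /peak; elim: (index_enum _) => [|i s IH].
  rewrite (_ : (fun y => _) = cst 1); first exact: cst_continuous.
  by apply/funext => y; rewrite big_nil.
rewrite (_ : (fun y => _) = fun y : 'rV[R]_d =>
    (cos (pi * (y 0 i - x 0 i)) * cos (pi * (y 0 i - x 0 i))) *
    \prod_(j <- s) cos (pi * (y 0 j - x 0 j)) ^+ 2); last first.
  by apply/funext => y; rewrite big_cons expr2.
apply: continuous_mulf => //.
have c : continuous (fun y : 'rV[R]_d => cos (pi * (y 0 i - x 0 i))).
  move=> y; apply: (@continuous_comp _ _ _ (fun y : 'rV[R]_d => pi * (y 0 i - x 0 i)) cos);
    last exact: continuous_cos.
  move: y; apply: continuous_mulf; first exact: cst_continuous.
  by apply: continuous_subf; [exact: coord_continuous|exact: cst_continuous].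
exact: continuous_mulf.
Qed.

(** By periodicity a factor is close to 1 again when |y_i - x_i| is close to 1. Keeping x at
    distance delta from the faces confines this difference to [delta, 1 - delta]. *)
Lemma peak_far (delta : R) : 0 < delta -> delta <= 2^-1 ->
  exists2 q : R, 0 <= q < 1 & forall x y, (forall i, delta <= x 0 i <= 1 - delta) ->
    cube y -> (exists i, delta <= `|y 0 i - x 0 i|) -> peak x y <= q.
Proof.
move=> d0 d2.
have cf : {within `[delta, 1 - delta], continuous (fun t : R => cos (pi * t) ^+ 2)}.
  apply: continuous_subspaceT.
  rewrite (_ : (fun t => _) = fun t => cos (pi * t) * cos (pi * t)).
    have c : continuous (fun t : R => cos (pi * t)).
      move=> t; apply: (@continuous_comp _ _ _ (fun t => pi * t) cos); last exact: continuous_cos.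
      move: t; apply: continuous_mulf; first exact: cst_continuous.
      by move=> t; exact: cvg_id.
    exact: continuous_mulf.
  by apply/funext => t; rewrite expr2.
have dd : delta <= 1 - delta by lra.
(* The maximum over the compact interval is attained at some t0 in ]0, 1[, where sin (pi t0) > 0;
   this makes the bound strictly less than 1. *)
have [t0] := EVT_max dd cf; rewrite in_itv/= => /andP[t01 t02] tmax.
exists (cos (pi * t0) ^+ 2).
  rewrite sqr_ge0/= cos2sin2 gtrBl exprn_gt0//; apply: sin_gt0_pi.
  rewrite mulr_gt0 ?pi_gt0//=; last lra.
  by rewrite gtr_pMr ?pi_gt0//; lra.
move=> x y hx cy [i hi]; rewrite /peak (bigD1 i)//=.
rewrite -[leRHS]mulr1; apply: ler_pM.
- exact: sqr_ge0.
- by apply: prodr_ge0 => j _; exact: sqr_ge0.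
- have := cy i; have := hx i => /andP[? ?] /andP[? ?].
  have -> : cos (pi * (y 0 i - x 0 i)) = cos (pi * `|y 0 i - x 0 i|).
    by case: (ger0P (y 0 i - x 0 i)) => // _; rewrite mulrN cosN.
  apply: tmax; rewrite in_itv/= hi/=.
  by rewrite ler_norml; apply/andP; split; lra.
- by apply: prodr_ile1 => j _; rewrite sqr_ge0 cos_sqr_le1.
Qed.

Lemma peak_near x (q : R) : q < 1 ->
  exists2 eta : R, 0 < eta & forall y, (forall i, `|y 0 i - x 0 i| <= eta) -> q <= peak x y.
Proof.
move=> q1; have /cvgrPdist_lt /(_ (1 - q)) := @continuous_peak x x.
rewrite subr_gt0 => /(_ q1) /nbhs_ballP[e /= e0 he].
exists (e / 2); first by rewrite divr_gt0.
move=> y hy.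
have p1 : peak x x = 1.
  by rewrite /peak big1// => i _; rewrite subrr mulr0 cos0 expr1n.
have : ball x e y.
  split => // i j; rewrite !ord1 /ball/= distrC; apply: le_lt_trans (hy j) _.
  by rewrite gtr_pMr// invf_lt1// ltr1n.
move=> /he /=; rewrite p1 ltr_norml => /andP[_ h]; lra.
Qed.

(** V does not depend on m: it is the volume of a box around x on which the peak is at least q.
    Hence the mass of the powers decays no faster than q^m, for any q < 1. *)
Lemma rint_peak_ge x (q : R) : (forall i, 0 < x 0 i < 1) -> 0 <= q < 1 ->
  exists2 V : R, 0 < V & forall m, V * q ^+ m <= rint (fun y => peak x y ^+ m).
Proof.
move=> hx /andP[q0 q1]; have [eta e0 he] := peak_near x q1.
(* Small enough for the box of half-side e around x to lie in the cube as well as within eta of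
   x. *)
pose e := \big[Num.min/eta]_i Num.min (x 0 i) (1 - x 0 i).
have e_eta : e <= eta by exact: bigmin_le_id.
have e_x i : e <= x 0 i /\ e <= 1 - x 0 i.
  have : e <= Num.min (x 0 i) (1 - x 0 i) by exact: bigmin_le.
  by rewrite le_min => /andP.
have e_gt0 : 0 < e.
  apply/bigmin_gtP; split => // i _; rewrite lt_min; have /andP[? ?] := hx i.
  by apply/andP; split; lra.
pose a i := x 0 i - e; pose b i := x 0 i + e.
have ab i : a i <= b i by rewrite /a /b; lra.
have sub : tbox a b `<=` @tcube R d.
  rewrite tcubeE => t ht i; have := ht i; have := e_x i; rewrite /= !in_itv/= /a /b.
  by move=> [? ?] /andP[? ?]; apply/andP; split; lra.
exists (\prod_i (b i - a i)).
  by apply: prodr_gt0 => i _; rewrite /a /b; lra.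
move=> m.
have cm : continuous (fun y => peak x y ^+ m).
  elim: m => [|m IH].
    rewrite (_ : (fun y => _) = cst 1); first exact: cst_continuous.
    by apply/funext => y; rewrite expr0.
  rewrite (_ : (fun y => _) = fun y => peak x y * peak x y ^+ m).
    by apply: continuous_mulf => //; exact: continuous_peak.
  by apply/funext => y; rewrite exprS.
have im : rintegrable (fun y => peak x y ^+ m).
  by apply: continuous_rintegrable; exact: continuous_subspaceT.
rewrite -lee_fin -rint_ereal//.
have mf : measurable_fun (@tcube R d) (fun t => (peak x (row_of_tuple t) ^+ m)%:E).
  by case/integrableP : im.
apply: (@le_trans _ _ (\int[lebesgue_tuple R d]_(t in tbox a b) (peak x (row_of_tuple t) ^+ m)%:E)%E); last first.
  apply: ge0_subset_integral => //.
    exact: measurable_tbox.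
    exact: measurable_tcube.
  by move=> t _; rewrite lee_fin exprn_ge0// peak_ge0.
rewrite EFinM muleC -lebesgue_tbox// -integral_cst; last exact: measurable_tbox.
apply: ge0_le_integral.
- exact: measurable_tbox.
- by move=> t _; rewrite lee_fin exprn_ge0.
- exact: measurable_cst.
- exact: (measurable_funS (@measurable_tcube R d) sub mf).
- move=> t ht; rewrite lee_fin lerXn2r// ?nnegrE ?peak_ge0//; apply: he => i.
  have := ht i; rewrite mxE /= in_itv/= /a /b => /andP[? ?].
  by rewrite ler_norml; apply/andP; split; lra.
Qed.

End peaks.

Section fourier_sup_bound.
Context (R : realType) (d : nat).
Implicit Types (h : 'rV[R]_d -> R[i]) (x y : 'rV[R]_d).

Lemma ccontinuous_eps h x (e : R) : ccontinuous h -> cube x -> 0 < e ->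
  exists2 delta : R, 0 < delta & forall y, cube y ->
    (forall i, `|y 0 i - x 0 i| < delta) -> nc (h y - h x) < e.
Proof.
move=> /(@subspace_continuousP _ (@cube R d)) /(_ x) ch cx e0.
have /cvgrPdist_lt /(_ e%:C) := ch cx.
rewrite ltcR => /(_ e0); rewrite /within/= => /nbhs_ballP[r /= r0 hr].
exists r => // y cy hy; rewrite nc_distC -ltcR -normC_nc; apply: hr => //.
by split => // i j; rewrite !ord1 /ball/= distrC.
Qed.

Lemma ccontinuous_bounded h : ccontinuous h ->
  exists2 M : R, 0 <= M & forall x, cube x -> nc (h x) <= M.
Proof.
move=> /ccontinuous_nc_sqr/continuous_cube_bounded[M hM].
exists (1 + `|M|); first by rewrite addr_ge0.
move=> x /hM; rewrite ger0_norm ?sqr_ge0// => hx.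
have := ler_norm M; have := nc_ge0 (h x).
by have := sqr_ge0 (nc (h x) - 1); nra.
Qed.

(* Integrate h against the normalised powers of the peak at x, which are
   trigonometric polynomials concentrating at x. *)
Lemma nc_le_interior h (tau : R) x : ccontinuous h -> 0 <= tau ->
  (forall N, \sum_(k <- box d N) nc (fourier h k) <= tau) ->
  (forall i, 0 < x 0 i < 1) -> nc (h x) <= tau.
Proof.
move=> ch t0 htau hx; rewrite leNgt; apply/negP.
pose a : R := nc (h x); rewrite -/a => lt_tau; pose e := (a - tau) / 2.
have a0 : 0 < a by exact: le_lt_trans t0 lt_tau.
have e0 : 0 < e by rewrite divr_gt0 ?subr_gt0.
have cx : cube x by move=> i; have /andP[? ?] := hx i; rewrite !ltW.
have [r r0 hr] := ccontinuous_eps ch cx e0.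
have [M M0 hM] := ccontinuous_bounded ch.
pose delta := \big[Num.min/Num.min r 2^-1]_i Num.min (x 0 i) (1 - x 0 i).
have dr : delta <= Num.min r 2^-1 by exact: bigmin_le_id.
have {dr} [dr d2] : delta <= r /\ delta <= 2^-1 by move: dr; rewrite le_min => /andP.
have dx i : delta <= x 0 i <= 1 - delta.
  have : delta <= Num.min (x 0 i) (1 - x 0 i) by exact: bigmin_le.
  by rewrite le_min => /andP[? ?]; apply/andP; split; lra.
have d0 : 0 < delta.
  apply/bigmin_gtP; split; first by rewrite lt_min r0/=; lra.
  by move=> i _; rewrite lt_min; have /andP[? ?] := hx i; apply/andP; split; lra.
have [q /andP[q0 q1] far] := @peak_far R d delta d0 d2.
(* Any p strictly between q and 1 would do: the mass near x decays at most like p^m and the values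
   away from x at least like q^m, so [key] fails for large m. *)
pose p := (1 + q) / 2.
have p01 : 0 <= p < 1 by apply/andP; split; rewrite /p; lra.
have [V V0 hV] := rint_peak_ge hx p01.
pose K := M + a.
have K0' : 0 <= K by rewrite /K addr_ge0// ltW.
have key m : e * V * p ^+ m <= K * q ^+ m.
  set G := fun y => peak x y ^+ m.
  have G0 y : 0 <= G y by rewrite exprn_ge0// peak_ge0.
  have tG : trig (fun y => (G y)%:C) by exact: trig_peak.
  have := nc_cube_int_trig_le ch G0 tG htau; set I := cube_int _ => hI.
  have cG : ccontinuous (fun y => (G y)%:C).
    have [N [c hc]] := trig_tp tG.
    by rewrite (_ : (fun y => (G y)%:C) = tp (box d N) c);
      [exact: ccontinuous_tp|exact/funext].
  have iG : rintegrable G by have [] := ccontinuous_cintegrable cG.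
  have chG : cintegrable (fun y => h y * (G y)%:C).
    exact: (ccontinuous_cintegrable (ccontinuousM ch cG)).
  (* Near x the integrand on the right is at least a (a - e) G by continuity. Elsewhere it is at
     least - a M G with G <= q^m, and K = M + a pays for both terms. *)
  have le1 : rint (fun y => a * (a - e) * G y - a * K * q ^+ m) <=
      rint (fun y => complex.Re ((h x)^*%C * (h y * (G y)%:C))).
    apply: le_rint.
    - by apply: rintegrableB; [exact: rintegrableZ|exact: rintegrable_cst].
    - exact: (cintegrableZ _ chG).1.
    move=> y cy.
    have -> : complex.Re ((h x)^*%C * (h y * (G y)%:C)) =
        complex.Re ((h x)^*%C * h y) * G y.
      by rewrite mulrA cReM /= mulr0 subr0.
    have lo : - (a * M) <= complex.Re ((h x)^*%C * h y).
      rewrite lerNl -cReN; apply: le_trans (Re_le_nc _) _.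
      by rewrite ncN ncM nc_conj ler_wpM2l ?nc_ge0// hM.
    have [[i hi]|near] := pselect (exists i, delta <= `|y 0 i - x 0 i|).
      have Gq : G y <= q ^+ m.
        by rewrite /G lerXn2r// ?nnegrE ?peak_ge0// far//; exists i.
      have := G0 y; move: (complex.Re _) lo (G y) (q ^+ m) Gq => z lo g Q Gq g0.
      have h1 : - (a * M) * g <= z * g by exact: ler_wpM2r.
      have h2 : a * K * g <= a * K * Q.
        by apply: ler_wpM2l => //; apply: mulr_ge0 => //; exact: ltW.
      have h3 : 0 <= a * e * g.
        by apply: mulr_ge0 => //; apply: mulr_ge0; exact: ltW.
      rewrite /K in h2 *; nra.
    have hy : nc (h y - h x) < e.
      apply: hr => // i; rewrite ltNge; apply/negP => ri; apply: near.
      by exists i; exact: le_trans dr ri.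
    have hz : a * (a - e) <= complex.Re ((h x)^*%C * h y).
      have -> : (h x)^*%C * h y = (a ^+ 2)%:C + (h x)^*%C * (h y - h x).
        by rewrite mulrBr /a -mulJc [h x * _]mulrC addrCA subrr addr0.
      rewrite cReD /=.
      have : complex.Re (- ((h x)^*%C * (h y - h x))) <= a * e.
        apply: le_trans (Re_le_nc _) _.
        by rewrite ncN ncM nc_conj ler_wpM2l ?nc_ge0// ltW.
      by rewrite cReN; lra.
    have h1 : a * (a - e) * G y <= complex.Re ((h x)^*%C * h y) * G y.
      exact: ler_wpM2r.
    have h2 : 0 <= a * K * q ^+ m.
      by apply: mulr_ge0; [apply: mulr_ge0 => //; exact: ltW|exact: exprn_ge0].
    by lra.
  have le2 : rint (fun y => complex.Re ((h x)^*%C * (h y * (G y)%:C))) <= a * (tau * rint G).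
    rewrite -[leLHS]/(complex.Re (cube_int (fun y => (h x)^*%C * (h y * (G y)%:C)))).
    rewrite cube_intZ//; apply: le_trans (Re_le_nc _) _.
    by rewrite ncM nc_conj ler_wpM2l ?nc_ge0.
  move: le1; rewrite rintB; [|exact: rintegrableZ|exact: rintegrable_cst].
  rewrite (rint_cst d (a * K * q ^+ m)) rintZ//.
  move=> /le_trans /(_ le2) le3.
  have hVm := hV m; rewrite -/G in hVm.
  have : a * (e * rint G) <= a * (K * q ^+ m).
    have -> : a * (e * rint G) = a * (a - e) * rint G - a * (tau * rint G).
      by rewrite /e; field.
    lra.
  rewrite ler_pM2l// => /(le_trans _); apply.
  by rewrite -mulrA ler_wpM2l// ltW.
have p0 : 0 < p by rewrite /p; lra.
have qp : `|q / p| < 1.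
  have qp0 : 0 <= q / p by apply: divr_ge0 => //; exact: ltW.
  by rewrite (ger0_norm qp0) ltr_pdivrMr// mul1r /p; lra.
have K0 : 0 < K by rewrite /K ltr_wpDl.
have eVK : 0 < e * V / K by apply: divr_gt0 => //; exact: mulr_gt0.
have /cvgrPdist_lt cv := cvg_expr qp.
have [n _ /(_ n (leqnn n))] := cv _ eVK.
have qpn : 0 <= (q / p) ^+ n by apply: exprn_ge0; apply: divr_ge0 => //; exact: ltW.
rewrite /= sub0r normrN ger0_norm//.
rewrite ltNge => /negP; apply.
have pn0 : 0 < p ^+ n by exact: exprn_gt0.
rewrite ler_pdivrMr// expr_div_n (_ : q ^+ n / p ^+ n * K = K * q ^+ n / p ^+ n).
  by rewrite ler_pdivlMr.
by rewrite mulrAC [q ^+ n * K]mulrC.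
Qed.

(** The peaks only reach interior points; a boundary point is approached along the segment to the
    centre of the cube, and continuity up to the boundary concludes. *)
Lemma nc_le_of_fourier h (tau : R) x : ccontinuous h -> 0 <= tau ->
  (forall N, \sum_(k <- box d N) nc (fourier h k) <= tau) ->
  cube x -> nc (h x) <= tau.
Proof.
move=> ch t0 htau cx; apply/ler_addgt0Pr => e e0.
have [r r0 hr] := ccontinuous_eps ch cx e0.
pose t := Num.min 2^-1 (r / 2).
have t_gt0 : 0 < t by rewrite lt_min; apply/andP; split; lra.
have [t2 tr] : t <= 2^-1 /\ t <= r / 2 by split; rewrite ge_min lexx ?orbT.
pose y : 'rV[R]_d := \row_i (x 0 i + t * (2^-1 - x 0 i)).
have hy i : 0 < y 0 i < 1.
  rewrite mxE; have /andP[x0 x1] := cx i; apply/andP; split; nra.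
have cy : cube y by move=> i; have /andP[? ?] := hy i; rewrite !ltW.
have := hr y cy; have := nc_le_interior ch t0 htau hy => h1 h2.
have {}h2 : nc (h y - h x) < e.
  apply: h2 => i; rewrite mxE addrAC subrr add0r normrM (gtr0_norm t_gt0).
  have /andP[x0 x1] := cx i.
  have : `|2^-1 - x 0 i| <= 1 by rewrite ler_norml; apply/andP; split; lra.
  by move=> ?; nra.
rewrite (_ : h x = h y - (h y - h x)); last by rewrite opprB addrC subrK.
by apply: le_trans (ncD _ _) _; rewrite ncN; lra.
Qed.

End fourier_sup_bound.

Section L2norm_bounds.
Context (R : realType) (d : nat).
Implicit Types (f g : 'rV[R]_d -> R[i]).

Lemma L2int_ge0 f :
  (0 <= \int[lebesgue_tuple R d]_(t in @tcube R d) (nc (f (row_of_tuple t)) ^+ 2)%:E)%E.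
Proof. by apply: integral_ge0 => t _; rewrite lee_fin sqr_ge0. Qed.

Lemma L2norm_le f (a : R) : 0 <= a -> rintegrable (fun x => nc (f x) ^+ 2) ->
  (L2norm f <= a%:E)%E = (rint (fun x => nc (f x) ^+ 2) <= a ^+ 2).
Proof.
move=> a0 hf; rewrite /L2norm le_poweR_half ?L2int_ge0//.
by rewrite (rint_ereal hf) lee_fin.
Qed.

Lemma L2norm_ge f (a : R) : 0 <= a -> rintegrable (fun x => nc (f x) ^+ 2) ->
  (a%:E <= L2norm f)%E = (a ^+ 2 <= rint (fun x => nc (f x) ^+ 2)).
Proof.
move=> a0 hf; rewrite /L2norm ge_poweR_half ?L2int_ge0//.
by rewrite (rint_ereal hf) lee_fin.
Qed.

Lemma ccontinuous_rintegrable_nc_sqr f : ccontinuous f ->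
  rintegrable (fun x => nc (f x) ^+ 2).
Proof. by move=> /ccontinuous_nc_sqr; exact: continuous_rintegrable. Qed.

End L2norm_bounds.

(** * Uniform convergence of Fourier series in the unit ball *)

Section density.
Context (R : realType) (d : nat) (lam : 'rV[int]_d -> R).
Hypothesis lam0 : forall k, 0 < lam k.
Hypothesis lam_tail : forall e : R, 0 < e -> exists N, forall M,
  \sum_(k <- box d M | k \notin box d N) lam k <= e.
Implicit Types (f g p : 'rV[R]_d -> R[i]).

Lemma cintegrable_fourier f k : ccontinuous f ->
  cintegrable (fun x => f x * (chi k x)^*%C).
Proof.
move=> cf; apply: (@eq_cintegrable R d (fun x => f x * chi (- k) x)).
  by move=> x _; rewrite chiN.
exact: (ccontinuous_cintegrable (ccontinuousM cf (@ccontinuous_chi R d (- k)))).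
Qed.

Lemma fourierB f g k : ccontinuous f -> ccontinuous g ->
  fourier (fun x => f x - g x) k = fourier f k - fourier g k.
Proof.
move=> cf cg; rewrite !fourierE -cube_intB; [|exact: cintegrable_fourier..].
by apply: eq_cube_int => x _; rewrite mulrBl.
Qed.

Lemma fourier_lin (z : R[i]) f g k : ccontinuous f -> ccontinuous g ->
  fourier (fun x => z * f x + g x) k = z * fourier f k + fourier g k.
Proof.
move=> cf cg; have if_ := cintegrable_fourier k cf.
rewrite !fourierE -cube_intZ// -cube_intD.
- by apply: eq_cube_int => x _; rewrite mulrDl mulrA.
- exact: cintegrableZ.
- exact: cintegrable_fourier.
Qed.

Lemma nc_fourier_le f k (M : R) : ccontinuous f ->
  (forall x, cube x -> nc (f x) <= M) -> nc (fourier f k) <= M.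
Proof.
move=> cf hM; rewrite fourierE -(rint_cst d M); apply: nc_cube_int_le.
- exact: cintegrable_fourier.
- exact: rintegrable_cst.
- by move=> x cx; rewrite ncM nc_conj nc_chi mulr1 hM.
Qed.

(** The coefficients of the remainder vanish on the box. By Cauchy-Schwarz with weights [lam], the
    moduli of the others sum to at most the root of the tail of [lam], which bounds the remainder in
    the sup norm. *)
Lemma Hball_approx f (e : R) : Hball lam f -> 0 < e ->
  exists N0, forall N, (N0 <= N)%N ->
    forall x, cube x -> nc (f x - tp (box d N) (fourier f) x) <= e.
Proof.
move=> hf e0; have e20 : 0 < e ^+ 2 by rewrite exprn_gt0.
have [N0 hN0] := lam_tail e20; exists N0 => N N0N x cx.
have hN M : \sum_(k <- box d M | k \notin box d N) lam k <= e ^+ 2.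
  apply: le_trans (hN0 M); rewrite big_mkcond [leRHS]big_mkcond/=.
  apply: ler_sum => k _; case: ifPn => kN; last by case: ifP => // _; exact: ltW.
  by rewrite (contra (@sub_box d _ _ N0N k) kN).
have cf := Hball_ccontinuous hf.
have ct := @ccontinuous_tp R d (box d N) (fourier f).
apply: (@nc_le_of_fourier R d (fun x => f x - tp (box d N) (fourier f) x) e x
  (ccontinuousB cf ct) (ltW e0) _ cx).
move=> M; rewrite (eq_bigr (fun k => if k \notin box d N then nc (fourier f k) else 0)); last first.
  move=> k _; rewrite fourierB// fourier_tp ?box_uniq//.
  by case: ifP => /=; rewrite ?subrr ?nc0 ?subr0.
rewrite -big_mkcond/=.
have S0 : 0 <= \sum_(k <- box d M | k \notin box d N) nc (fourier f k).
  by apply: sumr_ge0 => k _; exact: nc_ge0.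
rewrite -(ler_sqr S0) ?nnegrE; last exact: ltW.
apply: le_trans (sum_CauchySchwarz _ _ _ lam0) _.
rewrite -[leRHS]mul1r; apply: ler_pM.
- by apply: sumr_ge0 => k _; rewrite divr_ge0 ?sqr_ge0// ltW.
- by apply: sumr_ge0 => k _; rewrite ltW.
- rewrite -big_filter; apply: (Hball_sum lam0 hf).
  exact/filter_uniq/box_uniq.
- exact: hN.
Qed.

(* Reduces the error of an operator U that is bounded in the sup norm to its
   errors on the trigonometric polynomials of the unit ball. *)
Lemma L2norm_residual_le (U : ('rV[R]_d -> R[i]) -> 'rV[R]_d -> R[i]) (K b : R) m f :
  Hball lam f -> 0 <= K -> 0 <= b ->
  (forall p, ccontinuous p -> ccontinuous (U p)) ->
  (forall p (e : R), ccontinuous p ->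
    (forall x, cube x -> nc (f x - p x) <= e) ->
    forall x, cube x -> nc (U f x - U p x) <= K * e) ->
  (forall N c, (m <= N)%N -> \sum_(k <- box d N) nc (c k) ^+ 2 / lam k <= 1 ->
    rint (fun x => nc (U (tp (box d N) c) x) ^+ 2) <= b ^+ 2) ->
  (L2norm (U f) <= b%:E)%E.
Proof.
move=> hf K0 b0 cU hK hb; have cf := Hball_ccontinuous hf.
have iU p : ccontinuous p -> rintegrable (fun x => nc (U p x) ^+ 2).
  by move=> cp; exact/ccontinuous_rintegrable_nc_sqr/cU.
rewrite L2norm_le//; last exact: iU.
apply/ler_addgt0Pr => e e0.
pose B := b ^+ 2; have B0 : 0 <= B by exact: sqr_ge0.
(* Chosen so that (1 + e1) B + e1 + e1^2 <= B + e1 (B + 2) <= B + e. *)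
pose e1 := Num.min 1 (e / (B + 2)).
have B20 : 0 < B + 2 by lra.
have e10 : 0 < e1 by rewrite lt_min ltr01/= divr_gt0.
have [e11 e12] : e1 <= 1 /\ e1 <= e / (B + 2) by split; rewrite ge_min lexx ?orbT.
have {}e12 : e1 * (B + 2) <= e by rewrite -ler_pdivlMr.
have K10 : 0 < K + 1 by lra.
have e20 : 0 < e1 / (K + 1) by rewrite divr_gt0.
have [N0 hN0] := Hball_approx hf e20.
have [N0N mN] : (N0 <= maxn N0 m /\ m <= maxn N0 m)%N by rewrite leq_maxl leq_maxr.
move: (maxn N0 m) N0N mN => N /hN0 hN mN.
set p := tp _ _ in hN.
have cp : ccontinuous p by exact: ccontinuous_tp.
have hp : rint (fun x => nc (U p x) ^+ 2) <= B.
  by apply: hb => //; exact: (Hball_sum lam0 hf (box_uniq d N)).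
have near x : cube x -> nc (U f x - U p x) <= e1.
  move=> cx; apply: le_trans (hK p _ cp hN x cx) _.
  by rewrite mulrA ler_pdivrMr// mulrC ler_wpM2l ?ltW//; lra.
have ic := @rintegrable_cst R d (e1 + e1 ^+ 2).
have iZ : rintegrable (fun x => (1 + e1) * nc (U p x) ^+ 2).
  by apply: rintegrableZ; exact: iU.
(* Pointwise (u + e1)^2 <= (1 + e1) u^2 + e1 + e1^2, because 2 u <= u^2 + 1. *)
have : rint (fun x => nc (U f x) ^+ 2) <=
    rint (fun x => (1 + e1) * nc (U p x) ^+ 2 + (e1 + e1 ^+ 2)).
  apply: le_rint; [exact: iU|exact: (rintegrableD iZ ic)|].
  move=> x /near h.
  have : nc (U f x) <= nc (U p x) + e1.
    rewrite (_ : U f x = U p x + (U f x - U p x)); last by rewrite addrC subrK.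
    by apply: le_trans (ncD _ _) _; rewrite lerD2l.
  have := nc_ge0 (U f x); have := nc_ge0 (U p x).
  have := sqr_ge0 (nc (U p x) - 1); nra.
move=> /le_trans; apply.
rewrite (rintD iZ ic) (rint_cst d (e1 + e1 ^+ 2)) rintZ -/B; last exact: iU.
have h1 : (1 + e1) * rint (fun x => nc (U p x) ^+ 2) <= (1 + e1) * B.
  by rewrite ler_wpM2l//; lra.
have h2 : e1 ^+ 2 <= e1 by rewrite expr2 ler_piMr// ltW.
lra.
Qed.

End density.

(** The infima range over exactly n terms, while a box or a grid supplies at most n of them; the
    remaining ones are padded with zeros. *)
Lemma sum_ord_pad (V : nmodType) (I : Type) (x0 : I) (s : seq I) (n : nat) (F : I -> V) :
  (size s <= n)%N ->
  \sum_(i < n) (if (i < size s)%N then F (nth x0 s i) else 0) = \sum_(k <- s) F k.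
Proof.
move=> sn; rewrite (big_nth x0) -(big_mkord xpredT (fun i => if (i < size s)%N then F (nth x0 s i) else 0)).
rewrite (big_cat_nat (leq0n _) sn)//= [X in _ + X]big_nat_cond [X in _ + X]big1 ?addr0.
  by rewrite big_nat_cond [RHS]big_nat_cond; apply: eq_bigr => i /andP[/andP[_ ->]].
by move=> i /andP[/andP[si _] _]; rewrite ltnNge si.
Qed.

Lemma sum_cst_seq (R : pzSemiRingType) (I : Type) (s : seq I) (e : R) :
  \sum_(k <- s) e = (size s)%:R * e.
Proof.
elim: s => [|x s IH]; first by rewrite big_nil mul0r.
by rewrite big_cons IH /= -natr1 mulrDl mul1r addrC.
Qed.

(** * Approximation numbers *)

Section approximation_upper.
Context (R : realType) (d : nat) (lam : 'rV[int]_d -> R).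
Hypothesis lam0 : forall k, 0 < lam k.
Hypothesis lam_tail : forall e : R, 0 < e -> exists N, forall M,
  \sum_(k <- box d M | k \notin box d N) lam k <= e.
Implicit Types (f g p : 'rV[R]_d -> R[i]).

Lemma fourier_Hdual k : Hdual lam (@fourier R d ^~ k).
Proof.
split=> [z f g [cf _ _] [cg _ _]|f [cf _ _] e e0].
  exact: (@fourier_lin R d z f g k cf cg).
(* A single term of the norm already shows that the coefficient at k is at most sqrt (lam k) times
   the norm. *)
exists (e / Num.sqrt (lam k)); first by rewrite divr_gt0 ?sqrtr_gt0.
move=> g [cg _ _] hgf; rewrite -(@fourierB R d g f k cg cf).
have /= := Hsum_ge lam0 (fun x => g x - f x) (s := [:: k]) isT.
rewrite big_seq1 => h.
have e1 : 0 <= nc (fourier (fun x => g x - f x) k) / Num.sqrt (lam k).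
  by rewrite divr_ge0 ?nc_ge0 ?sqrtr_ge0.
have : ((nc (fourier (fun x => g x - f x)%R k) / Num.sqrt (lam k))%:E <=
    Hnorm lam (fun x => g x - f x)%R)%E.
  rewrite (ge_poweR_half (Hsum_ge0 lam0 _) e1) expr_div_n [Num.sqrt (lam k) ^+ 2]sqr_sqrtr; last exact/ltW/lam0.
  exact: h.
move=> /le_lt_trans /(_ hgf); rewrite lte_fin.
by rewrite ltr_pM2r// invr_gt0 sqrtr_gt0.
Qed.

Lemma zero_Hdual : Hdual lam (fun=> 0).
Proof.
split=> [z f g _ _|f _ e e0]; first by rewrite mulr0 addr0.
by exists 1 => // g _ _; rewrite subrr nc0.
Qed.

Lemma ccontinuous_L2 g : ccontinuous g -> L2 g.
Proof.
move=> cg; have [h1 h2] := (ccontinuousP g).1 cg; split.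
- exact: (measurable_cube_continuous h1).
- exact: (measurable_cube_continuous h2).
- rewrite /L2norm poweR_half_lty ?L2int_ge0//.
  by rewrite (rint_ereal (ccontinuous_rintegrable_nc_sqr cg)) ltry.
Qed.

Lemma approx_number_le (m n : nat) (b : R) : (m.*2.+1 ^ d <= n)%N -> 0 <= b ->
  (forall k, k \notin box d m -> lam k <= b ^+ 2) ->
  (approx_number lam n <= b%:E)%E.
Proof.
move=> mn b0 hb; have bu := @box_uniq d m.
pose x0 : 'rV[int]_d := 0; pose s := box d m.
pose L (i : 'I_n) := if (i < size s)%N then (@fourier R d)^~ (nth x0 s i) else fun=> 0.
pose g (i : 'I_n) := if (i < size s)%N then @chi R d (nth x0 s i) else cst 0.
have sn : (size s <= n)%N by rewrite size_box.
have LE f y : \sum_i L i f * g i y = tp s (fourier f) y.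
  rewrite /tp -(sum_ord_pad x0 _ sn); apply: eq_bigr => i _.
  by rewrite /L /g; case: ifP => //; rewrite mul0r.
apply: (@le_trans _ _ (approx_err lam L g)).
  apply: ereal_inf_lbound; exists L, g; split=> // i.
    by rewrite /L; case: ifP => _; [exact: fourier_Hdual|exact: zero_Hdual].
  apply: ccontinuous_L2; rewrite /g; case: ifP => _; first exact: ccontinuous_chi.
  exact: (@ccontinuous_cst R d 0).
apply: ge_ereal_sup => _ [f hf <-].
(* Each Fourier coefficient is bounded by the sup norm and characters have modulus 1, so the
   remainder operator has sup-norm constant 1 + [size s]. *)
apply: (@L2norm_residual_le R d lam lam0 lam_tail
  (fun f y => f y - \sum_i L i f * g i y) (1 + (size s)%:R) b m f hf _ b0).
- exact: addr_ge0.
- move=> p cp; rewrite (_ : (fun y => _) = fun y => p y - tp s (fourier p) y).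
    exact: (ccontinuousB cp (@ccontinuous_tp R d s (fourier p))).
  by apply/funext => y; rewrite LE.
- move=> p e cp hp x cx; rewrite !LE.
  have cf := Hball_ccontinuous hf.
  have -> : f x - tp s (fourier f) x - (p x - tp s (fourier p) x) =
      (f x - p x) - \sum_(k <- s) fourier (fun x => f x - p x) k * chi k x.
    rewrite (eq_bigr (fun k => fourier f k * chi k x - fourier p k * chi k x)).
      by rewrite sumrB /tp; ring.
    by move=> k _; rewrite fourierB// mulrBl.
  apply: le_trans (ncD _ _) _; rewrite ncN mulrDl mul1r lerD ?hp//.
  apply: le_trans (nc_sum _ _ _) _.
  rewrite -sum_cst_seq; apply: ler_sum => k _.
  rewrite ncM nc_chi mulr1; apply: (nc_fourier_le _ (ccontinuousB cf cp)).
  exact: hp.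
- move=> N c mN hc.
  (* The coefficients that survive the truncation; they all lie where [lam] is at most b^2. *)
  pose c' k := if k \in s then 0 else c k.
  have -> : rint (fun x => nc (tp (box d N) c x -
      \sum_(i < n) L i (tp (box d N) c) * g i x) ^+ 2) =
      rint (fun x => nc (tp (box d N) c' x) ^+ 2).
    apply: eq_rint => x _; rewrite LE; congr (nc _ ^+ 2); apply/eqP; rewrite subr_eq; apply/eqP.
    have -> : tp s (fourier (tp (box d N) c)) x =
        \sum_(k <- box d N | k \in s) c k * chi k x.
      rewrite -sum_seq_swap ?box_uniq// [RHS]big_mkcond/= [LHS]/tp.
      apply: eq_bigr => k _; rewrite fourier_tp ?box_uniq//.
      by case: ifP => //; rewrite mul0r.
    rewrite [RHS]addrC /tp (bigID (mem s))/=; congr (_ + _).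
    by rewrite big_mkcond/=; apply: eq_bigr => k _; rewrite /c'; case: (k \in s) => //=; rewrite mul0r.
  rewrite parseval_tp ?box_uniq// -[leRHS]mulr1.
  apply: (@le_trans _ _ (\sum_(k <- box d N) b ^+ 2 * (nc (c k) ^+ 2 / lam k))).
    apply: ler_sum => k _; rewrite /c'; case: ifPn => ks.
      rewrite nc0 expr0n/= mulr_ge0 ?sqr_ge0// divr_ge0 ?sqr_ge0// ltW//.
    rewrite mulrA ler_pdivlMr// [leRHS]mulrC ler_wpM2l ?sqr_ge0//.
    exact: hb.
  by rewrite -mulr_sumr ler_wpM2l ?sqr_ge0.
Qed.

End approximation_upper.

Section linear_functionals.
Context (R : realType) (d : nat) (lam : 'rV[int]_d -> R).
Hypothesis lam0 : forall k, 0 < lam k.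
Implicit Types (f g : 'rV[R]_d -> R[i]) (c : 'rV[int]_d -> R[i]).

Lemma Hdual_tp (L : ('rV[R]_d -> R[i]) -> R[i]) s c : Hdual lam L -> uniq s ->
  L (tp s c) = \sum_(k <- s) c k * L (chi k).
Proof.
move=> [lin _]; elim: s => [_|k s IH /andP[ks us]].
  have tp0 : tp [::] c = (fun x : 'rV[R]_d => 0 : R[i]).
    by apply/funext => x; rewrite /tp big_nil.
  have H0 : Hspace lam (fun x : 'rV[R]_d => 0 : R[i]).
    by rewrite -tp0; exact: tp_Hspace.
  (* At the zero function, linearity reads L 0 = L 0 + L 0. *)
  have := lin 1 _ _ H0 H0.
  rewrite big_nil tp0 (_ : (fun x => 1 * 0 + 0) = (fun x : 'rV[R]_d => 0 : R[i])).
    by rewrite mul1r -[LHS]addr0 => /addrI <-.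
  by apply/funext => x; rewrite mulr0 addr0.
have Hk : Hspace lam (@chi R d k).
  rewrite (_ : chi k = tp [:: k] (fun=> 1)); first exact: tp_Hspace.
  by apply/funext => x; rewrite /tp big_seq1 mul1r.
rewrite big_cons -IH// -(lin _ _ _ Hk (tp_Hspace lam0 c us)); congr L.
by apply/funext => x; rewrite /tp big_cons.
Qed.

End linear_functionals.

Lemma exists_kernel_vector (F : fieldType) (I : eqType) (s : seq I) (n : nat)
    (A : I -> 'I_n -> F) : uniq s -> (n < size s)%N ->
  exists2 c : I -> F, (exists2 k, k \in s & c k != 0) &
    forall j, \sum_(k <- s) c k * A k j = 0.
Proof.
move=> us ns; have [x0 _] : exists x0 : I, true.
  by case: s us ns => // x0 s _ _; exists x0.
pose M : 'M[F]_(size s, n) := \matrix_(i, j) A (nth x0 s i) j.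
have kM : kermx M != 0.
  rewrite kermx_eq0 /row_free; apply: contraL ns => /eqP <-.
  by rewrite -leqNgt rank_leq_col.
have [v vM v0] := rowV0Pn kM.
(* The kernel vector is indexed by positions in s; [index] carries it over to the elements,
   consistently because s has no repetition. *)
pose c k := if insub (index k s) is Some i then v 0 i else 0.
have cE (i : 'I_(size s)) : c (nth x0 s i) = v 0 i.
  by rewrite /c index_uniq// valK.
exists c.
  have /existsP[i vi] : [exists i, v 0 i != 0].
    apply: contraR v0; rewrite negb_exists => /forallP h.
    by apply/eqP/rowP => i; rewrite mxE; apply/eqP; have := h i; rewrite negbK.
  by exists (nth x0 s i); [exact: mem_nth|rewrite cE].
move=> j; rewrite (big_nth x0) big_mkord.
move/sub_kermxP/rowP/(_ j): vM; rewrite !mxE => {2}<-.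
by apply: eq_bigr => i _; rewrite cE mxE.
Qed.

Section lower_bounds.
Context (R : realType) (d : nat) (lam : 'rV[int]_d -> R).
Hypothesis lam0 : forall k, 0 < lam k.
Implicit Types (f g : 'rV[R]_d -> R[i]).

Lemma approx_number_ge (m n : nat) (b : R) : (n < m.*2.+1 ^ d)%N -> 0 <= b ->
  (forall k, k \in box d m -> b ^+ 2 <= lam k) ->
  (b%:E <= approx_number lam n)%E.
Proof.
move=> nm b0 hb; apply: le_ereal_inf_tmp => _ [L [g [hL hg ->]]].
have us := @box_uniq d m; set s := box d m in us hb.
have [|c [k0 k0s ck0] hc] := exists_kernel_vector (fun k j => L j (@chi R d k)) us (n := n).
  by rewrite size_box.
pose E := \sum_(k <- s) nc (c k) ^+ 2 / lam k.
have E0 : 0 < E.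
  rewrite /E (bigD1_seq k0)//= ltr_pwDl//.
    by rewrite divr_gt0// exprn_gt0// lt_neqAle nc_ge0 eq_sym nc_eq0 ck0.
  by apply: sumr_ge0 => k _; rewrite divr_ge0 ?sqr_ge0// ltW.
pose r := (Num.sqrt E)^-1.
have rE : r ^+ 2 = E^-1 by rewrite exprVn sqr_sqrtr// ltW.
pose c' k := r%:C * c k.
have nc' k : nc (c' k) ^+ 2 = E^-1 * nc (c k) ^+ 2.
  by rewrite ncM nc_real exprMn real_normK ?num_real// rE.
have c'1 : \sum_(k <- s) nc (c' k) ^+ 2 / lam k = 1.
  under eq_bigr do rewrite nc' -mulrA; rewrite -mulr_sumr mulVf// gt_eqF//.
have hf : Hball lam (tp s c') by apply: tp_Hball => //; rewrite c'1.
apply: le_trans (ereal_sup_ubound _) ; last by exists (tp s c').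
rewrite (_ : (fun y => _) = tp s c'); last first.
  apply/funext => y; rewrite big1 ?subr0// => i _.
  rewrite (Hdual_tp lam0 _ (hL i) us).
  by under eq_bigr do rewrite -mulrA; rewrite -mulr_sumr hc mulr0 mul0r.
rewrite L2norm_ge//; last exact/ccontinuous_rintegrable_nc_sqr/ccontinuous_tp.
rewrite parseval_tp// -[leLHS]mulr1 -c'1 mulr_sumr big_seq [leRHS]big_seq.
apply: ler_sum => k ks; rewrite mulrA ler_pdivrMr// mulrC.
by rewrite ler_wpM2l ?sqr_ge0// hb.
Qed.

Lemma L2_sqr_rintegrable g : L2 g -> rintegrable (fun x => nc (g x) ^+ 2).
Proof.
move=> [m1 m2]; rewrite poweR_half_lty ?L2int_ge0// => hfin.
apply/integrableP; split.
  apply/measurable_EFinP.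
  rewrite (_ : _ \o _ = (fun t => complex.Re (g (row_of_tuple t)) ^+ 2 +
      complex.Im (g (row_of_tuple t)) ^+ 2)).
    by apply: measurable_funD; exact: measurable_funX.
  by apply/funext => t; rewrite /= nc_sqrE.
by under eq_integral do rewrite gee0_abs ?lee_fin ?sqr_ge0//.
Qed.

(** Both parts are dominated by 1 + |g|^2, which is integrable because the cube has finite
    measure. *)
Lemma L2_cintegrable g : L2 g -> cintegrable g.
Proof.
move=> hg; have h2 := L2_sqr_rintegrable hg; have [m1 m2 _] := hg.
have h3 := rintegrableD (rintegrable_cst d (1 : R)) h2.
have mQ := @measurable_tcube R d.
split; apply: (le_integrable mQ _ _ h3).
- exact/measurable_EFinP.
- move=> t _ /=; rewrite lee_fin [leRHS]ger0_norm ?addr_ge0 ?sqr_ge0// /cst.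
  apply: le_trans (normr_Re_le_nc _) _.
  by have := sqr_ge0 (nc (g (row_of_tuple t)) - 1); have := nc_ge0 (g (row_of_tuple t)); nra.
- exact/measurable_EFinP.
- move=> t _ /=; rewrite lee_fin [leRHS]ger0_norm ?addr_ge0 ?sqr_ge0// /cst.
  apply: le_trans (normr_Im_le_nc _) _.
  by have := sqr_ge0 (nc (g (row_of_tuple t)) - 1); have := nc_ge0 (g (row_of_tuple t)); nra.
Qed.

Lemma cintegrable_nc_le_L2norm g : cintegrable g -> ((nc (cube_int g))%:E <= L2norm g)%E.
Proof.
move=> hg; have [->|fin] := eqVneq (L2norm g) +oo%E; first exact: leey.
have [h1 h2] := hg.
have hL : L2 g.
  split; last by rewrite lt_neqAle fin leey.
    by case/integrableP : h1 => /measurable_EFinP.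
  by case/integrableP : h2 => /measurable_EFinP.
have hs := L2_sqr_rintegrable hL.
by rewrite L2norm_ge ?nc_ge0// nc_cube_int_sqr_le.
Qed.

(** Integrating the approximant yields a quadrature formula with weights the integrals of the g_i;
    its error is the integral of the residual, at most its L2 norm on a cube of volume 1. *)
Lemma min_quad_err_le_sampling_number n :
  (min_quad_err lam n <= sampling_number lam n)%E.
Proof.
apply: le_ereal_inf_tmp => _ [x [g [hx hg ->]]].
apply: (@le_trans _ _ (quad_err lam x (fun i => cube_int (g i)))).
  by apply: ereal_inf_lbound; exists x, (fun i => cube_int (g i)).
apply: ge_ereal_sup => _ [f hf <-].
apply: le_trans (ereal_sup_ubound _); last by exists f.
have ig i := L2_cintegrable (hg i).
have if_ := ccontinuous_cintegrable (Hball_ccontinuous hf).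
have is_ : cintegrable (fun y => \sum_i f (x i) * g i y).
  by apply: cintegrable_sum => i; exact: cintegrableZ.
apply: le_trans (cintegrable_nc_le_L2norm (cintegrableB if_ is_)).
rewrite lee_fin cube_intB// cube_int_sum; last by move=> i; exact: cintegrableZ.
rewrite nc_distC le_eqVlt; apply/orP; left; apply/eqP; congr (nc (_ - _)).
by apply: eq_bigr => i _; rewrite cube_intZ// mulrC.
Qed.

End lower_bounds.

(** * Sampling on the equispaced grid *)

Section equispaced_grid.
Context (R : realType) (d q : nat).
Local Notation Q := (q.+1).
Implicit Types (k l : 'rV[int]_d) (a b : 'rV['I_Q]_d).

(* The grid has q.+1 nodes per axis. *)
Definition node a : 'rV[R]_d := \row_i ((a 0 i)%:R / Q%:R).

(** The modulus is [q.+1]: [divall m.*2] below is divisibility by the odd number 2m + 1. *)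
Definition divall k := [forall i, (Q%:Z %| (k 0 i)%R)%Z].

Lemma cube_node a : cube (node a).
Proof.
move=> i; rewrite mxE; apply/andP; split; first by rewrite divr_ge0.
by rewrite ler_pdivrMr ?ltr0n// mul1r ler_nat ltnW.
Qed.

Lemma chi_prod k (x : 'rV[R]_d) : chi k x = \prod_i expi (2 * pi * ((k 0 i)%:~R * x 0 i)).
Proof. by rewrite /chi /dotp mulr_sumr expi_sum. Qed.

(** Addition of ordinals is modulo Q; this is why k defines a character of the finite group of
    nodes. *)
Lemma expi_modn (z : int) (n : nat) :
  expi (2 * pi * (z%:~R * ((n %% Q)%N%:R / Q%:R))) =
  expi (2 * pi * (z%:~R * (n%:R / Q%:R))) :> R[i].
Proof.
have Q0 : Q%:R != 0 :> R by rewrite pnatr_eq0.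
have -> : n%:R / Q%:R = (n %/ Q)%N%:R + (n %% Q)%N%:R / Q%:R :> R.
  by rewrite {1}(divn_eq n Q) [LHS]/= (natrD _ (_ * _)) natrM mulrDl mulfK.
rewrite [z%:~R * (_ + _)]mulrDr [2 * pi * (_ + _)]mulrDr expiD.
rewrite (_ : z%:~R * (n %/ Q)%N%:R = (z * (n %/ Q)%N%:Z)%:~R); last by rewrite intrM.
by rewrite expi_2piz mul1r.
Qed.

Lemma chi_nodeD k a b : chi k (node (a + b)) = chi k (node a) * chi k (node b).
Proof.
rewrite !chi_prod -big_split/=; apply: eq_bigr => i _.
rewrite !mxE /= expi_modn -expiD natrD; congr expi.
by rewrite [(_ + _) / _]mulrDl; ring.
Qed.

Lemma chi_node_divall k a : divall k -> chi k (node a) = 1.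
Proof.
move=> /forallP h; rewrite chi_prod big1// => i _.
have /dvdzP[z ->] := h i.
have Q0 : Q%:R != 0 :> R by rewrite pnatr_eq0.
rewrite mxE (_ : _ * _ = (z * (a 0 i)%:Z)%:~R); first exact: expi_2piz.
by rewrite !intrM mulrACA; field.
Qed.

Lemma chi_node_neq1 k : ~~ divall k -> exists b, chi k (node b) != 1.
Proof.
rewrite negb_forall => /existsP[i hi].
have q0 : (0 < q)%N.
  by move: hi; case: (q) => // /negP; rewrite dvd1z.
(* One grid step in a direction i where Q does not divide k_i. As q > 0, [inord 1] is really 1. *)
exists (\row_j (if j == i then inord 1 else 0)).
rewrite chi_prod (bigD1 i)//= big1 ?mulr1; last first.
  by move=> j /negbTE ji; rewrite !mxE ji mul0r mulr0 mulr0 expi0.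
rewrite !mxE eqxx inordK//.
set z := k 0 i in hi *.
have Qn0 : Q%:Z != 0 by [].
set r := (z %% Q%:Z)%Z.
have r0 : (0 <= r)%R by exact: modz_ge0.
have rQ : (r < Q%:Z)%R by apply: ltz_pmod.
have rn0 : r != 0 by apply: contra hi => /eqP h; apply/dvdz_mod0P.
have Q0 : 0 < Q%:R :> R by rewrite ltr0n.
pose t : R := r%:~R / Q%:R.
have t01 : 0 < t < 1.
  rewrite /t divr_gt0//=; last by rewrite ltr0z lt_neqAle eq_sym rn0.
  by rewrite ltr_pdivrMr// mul1r -[Q%:R]/(Q%:Z%:~R) ltr_int.
have -> : 2 * pi * (z%:~R * (1%:R / Q%:R)) = 2 * pi * t + 2 * pi * (z %/ Q%:Z)%Z%:~R :> R.
  have := divz_eq z Q%:Z; rewrite -/r => /(congr1 (fun y => y%:~R : R)) ->.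
  rewrite intrD intrM /t -[Q%:Z%:~R]/(Q%:R : R); field.
  by rewrite gt_eqF.
(* Here t is the remainder of k_i modulo Q divided by Q, so 0 < t < 1 and cos (2 pi t) = 1 - 2 sin^2
   (pi t) < 1. *)
rewrite expiD expi_2piz mulr1; apply/eqP => /(congr1 (@complex.Re R)) /=.
have -> : 2 * pi * t = (pi * t) *+ 2 by rewrite mulr2n; ring.
rewrite cos_mulr2n cos2sin2 => h.
have : 0 < sin (pi * t).
  have /andP[? ?] := t01.
  by apply: sin_gt0_pi; rewrite mulr_gt0 ?pi_gt0//= gtr_pMr ?pi_gt0.
move=> s0; have : 0 < sin (pi * t) ^+ 2 by rewrite exprn_gt0.
by move: h; rewrite mulr2n; lra.
Qed.

Lemma sum_chi_node k :
  \sum_a chi k (node a) = if divall k then (Q ^ d)%N%:R else 0 :> R[i].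
Proof.
case: ifPn => hk.
  rewrite (eq_bigr (fun=> 1)); last by move=> a _; exact: chi_node_divall.
  by rewrite sumr_const card_mx card_ord mul1n.
have [b hb] := chi_node_neq1 hk.
(* Translating the nodes by b permutes them, so the sum is multiplied by a factor other than 1 and
   yet unchanged. *)
have : \sum_a chi k (node a) = chi k (node b) * \sum_a chi k (node a) :> R[i].
  rewrite mulr_sumr (reindex_inj (addrI b))/=.
  by apply: eq_bigr => a _; rewrite chi_nodeD.
move=> /eqP; rewrite -subr_eq0 -{1}[X in X - _]mul1r -mulrBl mulf_eq0 subr_eq0.
by rewrite eq_sym (negbTE hb)/= => /eqP.
Qed.

End equispaced_grid.

(** Coordinates in the box range over 2m + 1 consecutive integers, so two distinct frequencies of
    the box are never aliases of each other. *)
Lemma divall_box_eq d m (k k' : 'rV[int]_d) : k \in box d m -> k' \in box d m ->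
  divall m.*2 (k - k') -> k = k'.
Proof.
rewrite !mem_box => /ninf_leP hk /ninf_leP hk' /forallP hd.
apply/rowP => i; have := hd i; have := hk i; have := hk' i; rewrite !mxE.
move: (k 0 i) (k' 0 i) => x y.
move=> hy hx /dvdzP[z hz].
have [z0|z0] := eqVneq z 0; first by move: hz; rewrite z0 mul0r => /eqP; rewrite subr_eq0 => /eqP.
have : (`|x - y| < m.*2.+1)%N by lia.
have -> : `|(x - y)%R|%N = (`|z| * m.*2.+1)%N by rewrite hz abszM.
have : (0 < `|z|)%N by rewrite absz_gt0.
by move: (`|z|)%N => n; nia.
Qed.

Section sampling_upper.
Context (R : realType) (d : nat) (lam : 'rV[int]_d -> R).
Hypothesis lam0 : forall k, 0 < lam k.
Hypothesis lam_tail : forall e : R, 0 < e -> exists N, forall M,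
  \sum_(k <- box d M | k \notin box d N) lam k <= e.
Variables m : nat.
Local Notation Qd := ((m.*2.+1 ^ d)%N).
Implicit Types (f p : 'rV[R]_d -> R[i]) (a : 'rV['I_m.*2.+1]_d).

(** The Dirichlet kernel of the box centred at a node, divided by the number of nodes; [sample_op]
    then has the discrete Fourier coefficients of f as its coefficients. *)
Definition sample_kernel a : 'rV[R]_d -> R[i] :=
  tp (box d m) (fun k => (Qd%:R)^-1 * (chi k (node R a))^*%C).

Definition sample_op f (y : 'rV[R]_d) : R[i] :=
  \sum_a f (node R a) * sample_kernel a y.

(** Aliasing: by orthogonality on the grid, the discrete coefficient at k collects every coefficient
    whose frequency is congruent to k. *)
Lemma sample_op_tp N c y : sample_op (tp (box d N) c) y =
  \sum_(k <- box d m) (\sum_(l <- box d N | divall m.*2 (l - k)) c l) * chi k y.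
Proof.
rewrite /sample_op /sample_kernel /tp.
under eq_bigr do rewrite mulr_sumr.
rewrite exchange_big/=; apply: eq_bigr => k _.
under eq_bigr do rewrite mulrA.
rewrite -mulr_suml; congr (_ * _).
rewrite (eq_bigr (fun a => \sum_(l <- box d N)
    (c l * (Qd%:R)^-1) * chi (l - k) (node R a))); last first.
  move=> a _; rewrite mulr_suml; apply: eq_bigr => l _.
  by rewrite chiD chiN mulrACA.
rewrite exchange_big/= [RHS]big_mkcond/=; apply: eq_bigr => l _.
rewrite -mulr_sumr.
rewrite sum_chi_node; case: ifP => _; last by rewrite mulr0.
by rewrite mulfVK// pnatr_eq0 -lt0n expn_gt0.
Qed.

Lemma ccontinuous_sample_op f : ccontinuous (sample_op f).
Proof.
apply: ccontinuous_sum => a.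
exact: (ccontinuousM (@ccontinuous_cst R d (f (node R a))) (@ccontinuous_tp R d _ _)).
Qed.

Lemma nc_sample_kernel_le a y : nc (sample_kernel a y) <= 1.
Proof.
apply: le_trans (nc_sum _ _ _) _.
rewrite (eq_bigr (fun=> (Qd%:R)^-1)).
  by rewrite sum_cst_seq size_box divff// pnatr_eq0 -lt0n expn_gt0.
move=> k _; rewrite !ncM nc_conj !nc_chi !mulr1.
rewrite (_ : (Qd%:R)^-1 = ((Qd%:R)^-1)%:C) ?nc_real ?ger0_norm//.
by rewrite -[in RHS]/(real_complex R _) fmorphV rmorph_nat.
Qed.

Lemma sampling_number_le (n : nat) (B S : R) : (Qd <= n)%N ->
  0 <= B -> 0 <= S -> (forall k, k \notin box d m -> lam k <= B) ->
  (forall N k, k \in box d m ->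
    \sum_(l <- box d N | divall m.*2 (l - k) && (l != k)) lam l <= S) ->
  (sampling_number lam n <= (Num.sqrt (B + S))%:E)%E.
Proof.
move=> Qn B0 S0 hB hS.
have BS0 : 0 <= B + S by exact: addr_ge0.
pose s := enum {: 'rV['I_m.*2.+1]_d}.
have ss : (size s <= n)%N by rewrite -cardE card_mx card_ord mul1n.
pose x (i : 'I_n) : 'rV[R]_d := node R (nth 0 s i).
pose g (i : 'I_n) := if (i < size s)%N then sample_kernel (nth 0 s i) else cst 0.
have LE f y : \sum_i f (x i) * g i y = sample_op f y.
  transitivity (\sum_(a <- s) f (node R a) * sample_kernel a y); last by rewrite /s big_enum.
  rewrite -(sum_ord_pad 0 _ ss); apply: eq_bigr => i _.
  by rewrite /x /g; case: ifP => //; rewrite mulr0.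
apply: (@le_trans _ _ (approx_err lam (fun i f => f (x i)) g)).
  apply: ereal_inf_lbound; exists x, g; split=> // i.
    exact: cube_node.
  apply: ccontinuous_L2; rewrite /g; case: ifP => _; first exact: ccontinuous_tp.
  exact: (@ccontinuous_cst R d 0).
apply: ge_ereal_sup => _ [f hf <-].
rewrite (_ : (fun y => _) = fun y => f y - sample_op f y); last first.
  by apply/funext => y; rewrite LE.
apply: (@L2norm_residual_le R d lam lam0 lam_tail
  (fun f y => f y - sample_op f y) (1 + (size s)%:R) _ m f hf _ (sqrtr_ge0 _)).
- exact: addr_ge0.
- move=> p cp; exact: (ccontinuousB cp (@ccontinuous_sample_op p)).
- move=> p e cp hp z cz.
  have -> : f z - sample_op f z - (p z - sample_op p z) =
      (f z - p z) - \sum_a (f (node R a) - p (node R a)) * sample_kernel a z.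
    rewrite (eq_bigr (fun a => f (node R a) * sample_kernel a z -
      p (node R a) * sample_kernel a z)); last by move=> a _; rewrite mulrBl.
    by rewrite sumrB /sample_op; ring.
  apply: le_trans (ncD _ _) _; rewrite ncN mulrDl mul1r lerD ?hp//.
  apply: le_trans (nc_sum _ _ _) _.
  rewrite -sum_cst_seq /s big_enum/=; apply: ler_sum => a _.
  rewrite ncM -[leRHS]mulr1; apply: ler_pM; rewrite ?nc_ge0//.
    exact: hp (cube_node _ _).
  exact: nc_sample_kernel_le.
- move=> N c mN hc; rewrite sqr_sqrtr//.
  have us := box_uniq d N; have um := box_uniq d m.
  pose r k := \sum_(l <- box d N | divall m.*2 (l - k) && (l != k)) c l.
  (* Spectrum of the error: outside the box the untouched coefficient, inside it only the aliases.
     Parseval separates the two, and they contribute B and S. *)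
  pose c' k := if k \in box d m then - r k else c k.
  have -> : rint (fun y => nc (tp (box d N) c y - sample_op (tp (box d N) c) y) ^+ 2) =
      rint (fun y => nc (tp (box d N) c' y) ^+ 2).
    apply: eq_rint => y _; congr (nc _ ^+ 2); rewrite sample_op_tp.
    apply/eqP; rewrite subr_eq; apply/eqP.
    have E k : k \in box d m -> \sum_(l <- box d N | divall m.*2 (l - k)) c l = c k + r k.
      move=> km; apply: sum_seqD1 => //; first exact: sub_box mN _ km.
      by rewrite subrr; apply/forallP => i; rewrite mxE; exact: dvdz0.
    rewrite [X in _ = _ + X]big_seq (eq_bigr (fun k => (c k + r k) * chi k y)); last first.
      by move=> k /E ->.
    rewrite -big_seq.
    have -> : \sum_(k <- box d m) (c k + r k) * chi k y =
        \sum_(k <- box d N | k \in box d m) (c k + r k) * chi k y.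
      by rewrite -(sum_seq_sub _ um us)//; exact: sub_box.
    rewrite big_mkcond/= /tp -big_split/=; apply: eq_bigr => k _.
    by rewrite /c'; case: ifP => _; [ring|rewrite addr0].
  rewrite parseval_tp// (bigID (mem (box d m)))/= addrC.
  apply: lerD.
    rewrite -[leRHS]mulr1; apply: (@le_trans _ _ (\sum_(k <- box d N) B * (nc (c k) ^+ 2 / lam k))).
      rewrite big_mkcond/=; apply: ler_sum => k _; rewrite /c'; case: ifPn => km.
        rewrite (negbTE km) mulrA ler_pdivlMr// [leRHS]mulrC ler_wpM2l ?sqr_ge0//.
        exact: hB.
      by rewrite mulr_ge0// divr_ge0 ?sqr_ge0// ltW.
    by rewrite -mulr_sumr ler_wpM2l.
  rewrite -[leRHS]mulr1.
  (* Cauchy-Schwarz on each alias class, the class sums of [lam] being at most S. *)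
  apply: (@le_trans _ _ (\sum_(k <- box d m) \sum_(l <- box d N | divall m.*2 (l - k) && (l != k))
      S * (nc (c l) ^+ 2 / lam l))).
    rewrite (sum_seq_swap _ us um) big_mkcond/= big_seq [leRHS]big_seq.
    apply: ler_sum => k km; rewrite (sub_box mN km) /c' km ncN.
    have r2 : nc (r k) ^+ 2 <= (\sum_(l <- box d N | divall m.*2 (l - k) && (l != k)) nc (c l)) ^+ 2.
      by rewrite ler_sqr ?nnegrE ?nc_ge0 ?nc_sum// sumr_ge0// => l _; exact: nc_ge0.
    apply: le_trans r2 _.
    apply: le_trans (sum_CauchySchwarz _ _ _ lam0) _.
    rewrite -mulr_sumr [leRHS]mulrC; apply: ler_wpM2l; last exact: hS.
    by apply: sumr_ge0 => l _; rewrite divr_ge0 ?sqr_ge0// ltW.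
  under eq_bigr do rewrite big_mkcond/=.
  rewrite exchange_big/=.
  apply: (@le_trans _ _ (\sum_(l <- box d N) S * (nc (c l) ^+ 2 / lam l))); last first.
    by rewrite -mulr_sumr ler_wpM2l.
  apply: ler_sum => l _.
  have F0 : 0 <= S * (nc (c l) ^+ 2 / lam l).
    by rewrite mulr_ge0// divr_ge0 ?sqr_ge0// ltW.
  (* A frequency l is an alias of at most one k in the box, so its term is counted at most once. *)
  have [/hasP[k km hk]|/hasPn no] := boolP (has (fun k => divall m.*2 (l - k)) (box d m)).
    rewrite (bigD1_seq k)//= big_seq_cond [X in _ + X]big1 ?addr0; first by case: ifP.
    move=> k' /andP[k'm k'k]; case: ifP => // /andP[hk' _].
    case/eqP: k'k; apply: (divall_box_eq k'm km).
    have -> : k' - k = (l - k) - (l - k') by rewrite opprB [RHS]addrC subrKA.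
    move/forallP: hk => hk; move/forallP: hk' => hk'; apply/forallP => i.
    rewrite [(_ - (l - k')) 0 i]mxE [(- (l - k')) 0 i]mxE.
    by apply: rpredB; [exact: hk|exact: hk'].
  by rewrite big_seq big1// => k /no /negbTE ->.
Qed.

End sampling_upper.

(** * Quadrature from below *)

Lemma sum_mul_sqr_le (R : realFieldType) (I : eqType) (s : seq I) (X Y : I -> R) :
  (\sum_(i <- s) X i * Y i) ^+ 2 <= (\sum_(i <- s) X i ^+ 2) * (\sum_(i <- s) Y i ^+ 2).
Proof.
(* The value 1 is a filler that keeps the weights positive; indices with Y i = 0 are dropped from
   the sums. *)
pose G i := if Y i == 0 then 1 else Y i ^+ 2.
have G0 i : 0 < G i.
  by rewrite /G; case: ifPn => // h; rewrite lt_neqAle sqr_ge0 eq_sym sqrf_eq0 h.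
have -> : \sum_(i <- s) X i * Y i = \sum_(i <- s | Y i != 0) X i * Y i.
  rewrite [RHS]big_mkcond/=; apply: eq_bigr => i _.
  by case: eqP => //= ->; rewrite mulr0.
apply: le_trans (sum_CauchySchwarz _ _ _ G0) _; apply: ler_pM.
- by apply: sumr_ge0 => i _; rewrite divr_ge0 ?sqr_ge0// ltW.
- by apply: sumr_ge0 => i _; exact: ltW.
- rewrite big_mkcond/=; apply: ler_sum => i _; case: ifPn => h; last exact: sqr_ge0.
  by rewrite /G (negbTE h) exprMn mulfK// sqrf_eq0.
- rewrite big_mkcond/=; apply: ler_sum => i _; case: ifPn => h; last exact: sqr_ge0.
  by rewrite /G (negbTE h).
Qed.

Section low_rank.
Local Open Scope sesquilinear_scope.

(* The trace of B is its Hilbert-Schmidt product with the orthogonal projection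
   onto the row space of U, whose squared Hilbert-Schmidt norm is its rank. *)
Lemma low_rank_trace (R : realType) (n N : nat) (W : 'M[R[i]]_(N, n)) (U : 'M[R[i]]_(n, N)) :
  nc (\tr (W *m U)) ^+ 2 <= n%:R * \sum_p \sum_q nc ((W *m U) p q) ^+ 2.
Proof.
set B := W *m U; set S := \sum_p _.
have S0 : 0 <= S by apply: sumr_ge0 => p _; apply: sumr_ge0 => q _; exact: sqr_ge0.
pose r := \rank U; pose V := schmidt (row_base U).
have rN : (r <= N)%N by exact: rank_leq_col.
have uV : V \is unitarymx by exact: schmidt_unitarymx.
have UV : (U <= V)%MS.
  by apply: (submx_trans _ (schmidt_sub _)); rewrite eq_row_base.
have [X UX] := submxP UV.
pose P := V^t* *m V.
have BP : B *m P = B.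
  rewrite /B -mulmxA; congr (W *m _); transitivity (X *m V *m P); first by rewrite -UX.
  by rewrite /P mulmxA -[X *m V *m _]mulmxA (unitarymxP uV) mulmx1 -UX.
have trP : (\sum_p \sum_q nc (P p q) ^+ 2)%:C = r%:R :> R[i].
  transitivity (\tr (P *m P^t*)).
    rewrite /mxtrace rmorph_sum/=; apply: eq_bigr => p _.
    rewrite mxE rmorph_sum/=; apply: eq_bigr => q _.
    by rewrite !mxE -normCK normC_nc rmorphXn.
  have -> : P^t* = P by rewrite /P trmx_mul map_mxM trmxCK.
  have -> : P *m P = P.
    by rewrite /P mulmxA -[_ *m V *m _]mulmxA (unitarymxP uV) mulmx1.
  by rewrite /P mxtrace_mulC (unitarymxP uV) mxtrace1.
have {trP} trP : \sum_p \sum_q nc (P p q) ^+ 2 = r%:R.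
  by apply: complexI; rewrite trP rmorph_nat.
have pairE (F : 'I_N -> 'I_N -> R) :
    \sum_(pq : 'I_N * 'I_N) F pq.1 pq.2 = \sum_p \sum_q F p q.
  by rewrite pair_bigA.
have tB : nc (\tr B) <= \sum_(pq : 'I_N * 'I_N) nc (B pq.1 pq.2) * nc (P pq.2 pq.1).
  rewrite -[in leLHS]BP /mxtrace; apply: le_trans (nc_sum _ _ _) _.
  rewrite (pairE (fun p q => nc (B p q) * nc (P q p))).
  apply: ler_sum => p _; rewrite mxE; apply: le_trans (nc_sum _ _ _) _.
  by apply: ler_sum => q _; rewrite ncM.
apply: (@le_trans _ _ ((\sum_(pq : 'I_N * 'I_N) nc (B pq.1 pq.2) * nc (P pq.2 pq.1)) ^+ 2)).
  rewrite ler_sqr ?nnegrE ?nc_ge0//.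
  by apply: sumr_ge0 => pq _; rewrite mulr_ge0 ?nc_ge0.
apply: le_trans (sum_mul_sqr_le _ _ _) _.
rewrite (pairE (fun p q => nc (B p q) ^+ 2)) -/S.
rewrite (pairE (fun p q => nc (P q p) ^+ 2)) exchange_big/= trP mulrC.
by rewrite ler_wpM2r// ler_nat rank_leq_row.
Qed.

End low_rank.

Section quadrature_lower.
Context (R : realType) (d : nat) (lam : 'rV[int]_d -> R).
Hypothesis lam0 : forall k, 0 < lam k.
Implicit Types (f : 'rV[R]_d -> R[i]).

(* Apply low_rank_trace to the matrix sqrt(mu_j mu_l) b_(j-l), where
   b_k = sum_i a_i chi_k(x_i): it has rank at most n. *)
Lemma schur_sum_ge (n : nat) (x : 'I_n -> 'rV[R]_d) (a : 'I_n -> R[i])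
    (J : seq 'rV[int]_d) (mu : 'rV[int]_d -> R) : (forall k, 0 <= mu k) ->
  nc (\sum_i a i) ^+ 2 * (\sum_(j <- J) mu j) ^+ 2 <=
  n%:R * \sum_(j <- J) \sum_(l <- J) mu j * mu l * nc (\sum_i a i * chi (j - l) (x i)) ^+ 2.
Proof.
move=> mu0; pose v i k : R[i] := (Num.sqrt (mu k))%:C * chi k (x i).
pose W : 'M[R[i]]_(size J, n) := \matrix_(p, i) (a i * v i (nth 0 J p)).
pose U : 'M[R[i]]_(n, size J) := \matrix_(i, q) (v i (nth 0 J q))^*%C.
have E p q : (W *m U) p q = (Num.sqrt (mu (nth 0 J p)) * Num.sqrt (mu (nth 0 J q)))%:C *
    \sum_i a i * chi (nth 0 J p - nth 0 J q) (x i).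
  rewrite mxE mulr_sumr; apply: eq_bigr => i _; rewrite !mxE /v conjcM conjc_real.
  rewrite chiD chiN real_complexM.
  by rewrite [a i * _]mulrCA mulrACA -[a i * _ * _]mulrA.
have := low_rank_trace W U.
have -> : \tr (W *m U) = (\sum_(j <- J) mu j)%:C * \sum_i a i.
  rewrite (big_nth 0) big_mkord rmorph_sum/= mulr_suml /mxtrace; apply: eq_bigr => p _.
  rewrite E -expr2 sqr_sqrtr// subrr; congr (_ * _).
  by apply: eq_bigr => i _; rewrite chi0 mulr1.
rewrite ncM nc_real ger0_norm ?sumr_ge0// exprMn mulrC => /le_trans; apply.
rewrite (big_nth 0) big_mkord le_eqVlt; apply/orP; left; apply/eqP; congr (_ * _).
apply: eq_bigr => p _; rewrite [RHS](big_nth 0) big_mkord; apply: eq_bigr => q _.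
by rewrite E ncM nc_real exprMn real_normK ?num_real// exprMn !sqr_sqrtr.
Qed.

(** Duality: the error functional maps [chi k] to w k, and among polynomials on the box it is
    extremal at the one with coefficients lam k times the conjugate of w k, divided by sqrt E. *)
Lemma quad_err_ge (n : nat) (x : 'I_n -> 'rV[R]_d) (a : 'I_n -> R[i]) M (E := \sum_(k <- box d M)
    lam k * nc (\sum_i a i * chi k (x i) - (k == 0)%:R) ^+ 2) :
  ((Num.sqrt E)%:E <= quad_err lam x a)%E.
Proof.
pose w k : R[i] := \sum_i a i * chi k (x i) - (k == 0)%:R.
have us := box_uniq d M.
have E0 : 0 <= E.
  by apply: sumr_ge0 => k _; rewrite mulr_ge0 ?sqr_ge0// ltW.
(* The extremal polynomial is normalised by sqrt E; for E = 0 the zero function, which lies in the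
   ball, is enough. *)
have [Ez|Enz] := eqVneq E 0.
  rewrite Ez sqrtr0; apply: le_trans (ereal_sup_ubound _); last first.
    exists (tp (box d M) (fun=> 0)) => //; apply: tp_Hball => //.
    by rewrite big1// => k _; rewrite nc0 expr0n/= mul0r.
  by rewrite lee_fin nc_ge0.
have {}E0 : 0 < E by rewrite lt_neqAle eq_sym Enz.
pose r := (Num.sqrt E)^-1.
have s0 : 0 < Num.sqrt E by rewrite sqrtr_gt0.
pose c k : R[i] := (r * lam k)%:C * (w k)^*%C.
have cE : \sum_(k <- box d M) nc (c k) ^+ 2 / lam k = 1.
  transitivity (r ^+ 2 * E).
    rewrite /E mulr_sumr; apply: eq_bigr => k _; rewrite -/(w k).
    rewrite ncM nc_conj nc_real exprMn real_normK ?num_real//; field.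
    by rewrite gt_eqF.
  by rewrite /r exprVn sqr_sqrtr ?mulVf// ltW.
apply: le_trans (ereal_sup_ubound _); last first.
  by exists (tp (box d M) c) => //; apply: tp_Hball => //; rewrite cE.
rewrite lee_fin.
have -> : cube_int (tp (box d M) c) = c 0.
  have := fourier_tp c 0 us; rewrite mem_box ninf0 leq0n fourierE => <-.
  by apply: eq_cube_int => y _; rewrite chi0 conjc1 mulr1.
have -> : \sum_i a i * tp (box d M) c (x i) - c 0 = (Num.sqrt E)%:C.
  transitivity (\sum_(k <- box d M) c k * w k).
    rewrite /w; under [RHS]eq_bigr do rewrite mulrBr.
    rewrite sumrB; congr (_ - _).
      rewrite /tp; under eq_bigr do rewrite mulr_sumr.
      rewrite exchange_big/=; apply: eq_bigr => k _.
      by rewrite mulr_sumr; apply: eq_bigr => i _; rewrite mulrCA.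
    rewrite (sum_seq_delta c 0 us) mem_box ninf0 leq0n//.
  transitivity ((r * E)%:C).
    rewrite /E mulr_sumr rmorph_sum/=; apply: eq_bigr => k _; rewrite -/(w k).
    rewrite /c -mulrA [_^*%C * _]mulrC mulJc -real_complexM.
    by congr (_%:C); rewrite -mulrA.
  congr (_%:C); transitivity (r * (Num.sqrt E * Num.sqrt E)).
    by rewrite -expr2 sqr_sqrtr// ltW.
  by rewrite mulrA /r mulVf ?mul1r// gt_eqF.
by rewrite nc_real ger0_norm// ltW.
Qed.

(** The autocorrelation of mu is replaced by [lam] at k != 0. The bound on the sum of mu^2 keeps the
    term k = 0 below half of the Schur sum, and the two conditions on b cover a sum of weights away
    from 1 and away from 0. *)
Lemma min_quad_err_ge (n : nat) (J : seq 'rV[int]_d) (mu : 'rV[int]_d -> R) (b : R) :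
  (0 < n)%N -> 0 <= b -> (forall k, 0 <= mu k) ->
  (forall k, \sum_(j <- J) \sum_(l <- J | j - l == k) mu j * mu l <= lam k) ->
  (2 * n%:R) * (\sum_(j <- J) mu j ^+ 2) <= (\sum_(j <- J) mu j) ^+ 2 ->
  2 * b ^+ 2 <= lam 0 ->
  4 * n%:R * b ^+ 2 <= (\sum_(j <- J) mu j) ^+ 2 ->
  uniq J ->
  (b%:E <= min_quad_err lam n)%E.
Proof.
move=> n0 b0 mu0 hnu hmu hb0 hb uJ.
apply: le_ereal_inf_tmp => _ [x [a [_ ->]]].
(* Twice the radius of J, so that the box contains all differences of its elements. *)
pose M := (\max_(j <- J) ninf j + \max_(j <- J) ninf j)%N.
apply: le_trans (quad_err_ge x a M); rewrite lee_fin.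
rewrite -(ger0_norm b0) -sqrtr_sqr ler_wsqrtr//.
pose bk k : R[i] := \sum_i a i * chi k (x i).
pose A : R := nc (\sum_i a i).
pose nu k := \sum_(j <- J) \sum_(l <- J | j - l == k) mu j * mu l.
have us := box_uniq d M.
have o_in : 0 \in box d M by rewrite mem_box ninf0.
have b_0 : bk 0 = \sum_i a i by apply: eq_bigr => i _; rewrite chi0 mulr1.
have JM j l : j \in J -> l \in J -> j - l \in box d M.
  move=> jJ lJ; rewrite mem_box; apply: leq_trans (ninfD _ _) _; rewrite ninfN.
  by apply: leq_add; exact: (@leq_bigmax_seq _ J xpredT (@ninf d)).
have nuE : \sum_(k <- box d M) nu k * nc (bk k) ^+ 2 =
    \sum_(j <- J) \sum_(l <- J) mu j * mu l * nc (bk (j - l)) ^+ 2.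
  under eq_bigr do rewrite mulr_suml.
  rewrite exchange_big/= big_seq [RHS]big_seq; apply: eq_bigr => j jJ.
  under eq_bigr do rewrite mulr_suml big_mkcond/=.
  rewrite exchange_big/= big_seq [RHS]big_seq; apply: eq_bigr => l lJ.
  rewrite (bigD1_seq (j - l)) ?JM//= eqxx [X in _ + X]big1 ?addr0// => k.
  by rewrite eq_sym => /negbTE ->.
have nu0 : nu 0 = \sum_(j <- J) mu j ^+ 2.
  rewrite /nu big_seq [RHS]big_seq; apply: eq_bigr => j jJ.
  rewrite big_mkcond (bigD1_seq j)//= subrr eqxx [X in _ + X]big1 ?addr0// => l.
  by rewrite subr_eq0 eq_sym => /negbTE ->.
have hs := schur_sum_ge x a J mu0; rewrite -/A in hs.
have nn0 : 0 < n%:R :> R by rewrite ltr0n.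
set s := \sum_(j <- J) mu j in hmu hb hs.
set X := \sum_(j <- J) \sum_(l <- J) _ in hs.
rewrite (bigD1_seq 0)//= eqxx -/(bk 0) b_0.
have low : A ^+ 2 * s ^+ 2 <= 2 * n%:R *
    \sum_(k <- box d M | k != 0) lam k * nc (bk k - (k == 0)%:R) ^+ 2.
  have -> : \sum_(k <- box d M | k != 0) lam k * nc (bk k - (k == 0)%:R) ^+ 2 =
      \sum_(k <- box d M | k != 0) lam k * nc (bk k) ^+ 2.
    by apply: eq_bigr => k /negbTE ->; rewrite subr0.
  have le1 : \sum_(k <- box d M | k != 0) nu k * nc (bk k) ^+ 2 <=
      \sum_(k <- box d M | k != 0) lam k * nc (bk k) ^+ 2.
    by apply: ler_sum => k _; rewrite ler_wpM2r ?sqr_ge0// hnu.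
  have : X = nu 0 * A ^+ 2 + \sum_(k <- box d M | k != 0) nu k * nc (bk k) ^+ 2.
    by rewrite -[LHS]nuE (bigD1_seq 0)//= b_0.
  rewrite nu0 => XE.
  have : 2 * n%:R * (\sum_(j <- J) mu j ^+ 2) * A ^+ 2 <= s ^+ 2 * A ^+ 2.
    by rewrite ler_wpM2r// sqr_ge0.
  move: le1 XE hs; set P := \sum_(k <- _ | _) _; set P' := \sum_(k <- _ | _) _.
  set m2 := \sum_(j <- J) mu j ^+ 2 => le1 XE; rewrite XE => hs h2.
  have : n%:R * P <= n%:R * P' by rewrite ler_wpM2l// ltW.
  by lra.
have tri : 1 <= nc (\sum_i a i - 1) + A.
  rewrite -ncN opprB /A; apply: le_trans (ncD _ _).
  by rewrite subrK nc1.
move: low; set P := \sum_(k <- _ | _) _ => low.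
set D := nc (\sum_i a i - 1) in tri *.
have A0 : 0 <= A by exact: nc_ge0.
have D0 : 0 <= D by exact: nc_ge0.
have h1 : 2 * b ^+ 2 * D ^+ 2 <= lam 0 * D ^+ 2 by rewrite ler_wpM2r// sqr_ge0.
have h2 : 2 * b ^+ 2 * A ^+ 2 <= P.
  have : 4 * n%:R * b ^+ 2 * A ^+ 2 <= s ^+ 2 * A ^+ 2 by rewrite ler_wpM2r// sqr_ge0.
  move=> h; have : 2 * n%:R * (2 * b ^+ 2 * A ^+ 2) <= 2 * n%:R * P by lra.
  by rewrite ler_pM2l// mulr_gt0.
(* From D + A >= 1 one gets D^2 + A^2 >= 1/2; this is where the factor 2 in h1 and h2 is spent. *)
have h3 : b ^+ 2 * 1 <= b ^+ 2 * (2 * (D ^+ 2 + A ^+ 2)).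
  rewrite ler_wpM2l ?sqr_ge0//; have := sqr_ge0 (D - A); nra.
lra.
Qed.

End quadrature_lower.

(** * Logarithmic weights *)

Section real_powers.
Context (R : realType).
Implicit Types (x y t g : R).

Lemma ln_ge_1subV x : 0 < x -> 1 - x^-1 <= ln x.
Proof.
move=> x0; rewrite -[ln x]opprK -lnV ?posrE// lerNr opprB.
have := @le_ln1Dx R (x^-1 - 1); rewrite [1 + _]addrC subrK; apply.
by rewrite ltrBrDr addNr invr_gt0.
Qed.

Lemma powRN_anti x y g : 0 < x -> x <= y -> 0 <= g -> y `^ (- g) <= x `^ (- g).
Proof.
move=> x0 xy g0; have y0 : 0 < y by exact: lt_le_trans xy.
rewrite !powRN lef_pV2 ?posrE ?powR_gt0// ge0_ler_powR// ?nnegrE ltW//.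
Qed.

Lemma powRN_le_scale x y t g : 0 < x -> 0 < t -> x <= t * y -> 0 <= g ->
  y `^ (- g) <= t `^ g * x `^ (- g).
Proof.
move=> x0 t0 xy g0; have y0 : 0 < y by rewrite -(pmulr_rgt0 _ t0); exact: lt_le_trans xy.
have -> : y `^ (- g) = t `^ g * (t * y) `^ (- g).
  rewrite (powRM _ (ltW t0) (ltW y0)) mulrA -powRD; last by apply/implyP; rewrite (gt_eqF t0).
  by rewrite subrr powRr0 mul1r.
by apply: ler_wpM2l; [exact: powR_ge0|exact: powRN_anti].
Qed.

(** Lower bound for the integral of g t^(-1-g) over [x, y], obtained without calculus from (y/x)^g =
    exp (g ln (y/x)) >= 1 + g (1 - x/y). *)
Lemma powRN_telescope x y g : 0 < x -> x <= y -> 0 < g ->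
  g * ((y - x) * y `^ (- (1 + g))) <= x `^ (- g) - y `^ (- g).
Proof.
move=> x0 xy g0; have y0 : 0 < y by exact: lt_le_trans xy.
have E : x `^ (- g) = y `^ (- g) * (y / x) `^ g.
  rewrite powRM ?invr_ge0 ?ltW// mulrA -powRD; last by apply/implyP; rewrite (gt_eqF y0).
  by rewrite addNr powRr0 mul1r powRN -[x^-1]powR_inv1 ?ltW// -powRrM mulN1r powRN.
have yx0 : 0 < y / x by exact: divr_gt0.
have h1 : 1 + g * (1 - x / y) <= (y / x) `^ g.
  rewrite /powR gt_eqF//; apply: le_trans (expR_ge1Dx _).
  rewrite lerD2l; apply: ler_wpM2l; first exact: ltW.
  by rewrite -[x / y]invf_div ln_ge_1subV.
rewrite E -[X in _ <= _ - X]mulr1 -mulrBr opprD powRD; last by apply/implyP; rewrite (gt_eqF y0).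
rewrite (powR_inv1 (ltW y0)).
have -> : g * ((y - x) * (y^-1 * y `^ (- g))) = y `^ (- g) * (g * (1 - x / y)).
  by field; rewrite gt_eqF.
by rewrite ler_wpM2l ?powR_ge0// lerBrDl.
Qed.

End real_powers.

(** * Counting frequencies by sup norm *)

Section shells.
Context (R : realType) (d : nat).

(* For r > 0, the number of k with ninf k = r; the truncated predecessor makes
   it 0 for r = 0. *)
Definition shell (r : nat) : R := (r.*2.+1)%:R ^+ d - (r.*2.-1)%:R ^+ d.

Lemma sum_radial (M N : nat) (phi : nat -> R) :
  \sum_(k <- box d N | (M < ninf k)%N) phi (ninf k) =
  \sum_(M.+1 <= r < N.+1) phi r * shell r.
Proof.
have cnt (n m : nat) : (n <= m)%N -> \sum_(k <- box d m) ((ninf k <= n)%N)%:R = (n.*2.+1)%:R ^+ d :> R.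
  move=> nm; rewrite -natrX -size_box -[RHS]mulr1 -sum_cst_seq.
  rewrite -(sum_seq_sub (fun=> 1) (box_uniq d n) (box_uniq d m) (sub_box nm)) [RHS]big_mkcond.
  by apply: eq_bigr => k _; rewrite mem_box; case: leqP.
transitivity (\sum_(k <- box d N) \sum_(M.+1 <= r < N.+1) phi r * ((ninf k == r)%:R)).
  rewrite big_mkcond/= big_seq [RHS]big_seq; apply: eq_bigr => k.
  rewrite mem_box => kN.
  under eq_bigr do rewrite eq_sym.
  by rewrite (sum_seq_delta phi (ninf k) (iota_uniq _ _)) mem_index_iota ltnS kN andbT.
rewrite exchange_big/= big_nat [RHS]big_nat; apply: eq_bigr => r /andP[Mr rN].
rewrite -mulr_sumr; congr (_ * _); rewrite /shell.
have r1N : (r.-1 <= N)%N by rewrite (leq_trans (leq_pred r)).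
rewrite -(cnt r N rN) (_ : r.*2.-1 = (r.-1).*2.+1); last by case: (r) Mr.
rewrite -(cnt r.-1 N r1N) -sumrB; apply: eq_bigr => k _.
case: r Mr {rN r1N} => // r _; rewrite -[(ninf k <= r.+1.-1)%N]/(ninf k < r.+1)%N.
by case: ltngtP => _; rewrite ?subrr ?subr0.
Qed.

Lemma shell_ge (r : nat) : (0 < d)%N -> (0 < r)%N -> r%:R ^+ d.-1 <= shell r.
Proof.
rewrite /shell; case: (d) => // n _ r0; rewrite /= subrXX big_ord_recl/= subn0 expr0 mulr1.
have -> : (r.*2.+1)%:R - (r.*2.-1)%:R = 2 :> R.
  by case: (r) r0 => // s _; rewrite doubleS/= -[s.*2.+3]addn2 natrD addrC addKr.
have h : r%:R ^+ n <= (r.*2.+1)%:R ^+ n :> R.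
  by rewrite lerXn2r ?nnegrE// ler_nat -addnn; lia.
apply: le_trans h _; rewrite -[leLHS]mul1r; apply: ler_pM => //; first by rewrite ler1n.
by rewrite lerDl sumr_ge0// => i _; rewrite mulr_ge0.
Qed.

Lemma shell_le (r : nat) : (0 < r)%N -> shell r <= (2 * d)%:R * 3 ^+ d * r%:R ^+ d.-1.
Proof.
rewrite /shell; case: (d) => [|n] r0; first by rewrite !expr0 subrr muln0 mul0r mul0r.
rewrite /= subrXX.
have -> : (r.*2.+1)%:R - (r.*2.-1)%:R = 2 :> R.
  by case: (r) r0 => // s _; rewrite doubleS/= -[s.*2.+3]addn2 natrD addrC addKr.
have h3 : (r.*2.+1)%:R <= 3 * r%:R :> R by rewrite -natrM ler_nat -addnn; lia.
apply: (@le_trans _ _ (2 * \sum_(i < n.+1) (3 * r%:R) ^+ n)).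
  rewrite ler_wpM2l//; apply: ler_sum => i _.
  have i_n : (i <= n)%N by rewrite -ltnS.
  rewrite -[in leRHS](subnK i_n) exprD; apply: ler_pM => //.
    by rewrite lerXn2r ?nnegrE// mulr_ge0.
  apply: (@le_trans _ _ ((r.*2.+1)%:R ^+ i)); last by rewrite lerXn2r ?nnegrE// mulr_ge0.
  by rewrite lerXn2r ?nnegrE// ler_nat; lia.
rewrite sumr_const card_ord -[X in 2 * X]mulr_natl mulrA -natrM exprMn mulrA.
rewrite ler_wpM2r// ler_wpM2l// exprS ler_peMl ?exprn_ge0//.
by rewrite ler1n.
Qed.

End shells.

Section logarithmic_weights.
Context (R : realType).
Implicit Types (x y q t : R).

Definition Lg x : R := ln (expR 1 + x).

Lemma expR1_gt0 : 0 < expR 1 :> R. Proof. exact: expR_gt0. Qed.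

Lemma expR1_le4 : expR 1 <= 4 :> R.
Proof.
(* The bound 1 + t <= exp t at t = -1/2; its square gives exp (-1) >= 1/4. *)
have h : 2^-1 <= expR (- 2^-1) :> R by apply: le_trans (expR_ge1Dx _); lra.
have h2 : 4^-1 <= expR (- 1) :> R.
  have -> : - 1 = - 2^-1 + - 2^-1 :> R by lra.
  by rewrite expRD; nra.
have e0 := expR1_gt0; have := expRN (1 : R) => E.
have := ler_wpM2r (ltW e0) h2.
by rewrite E mulVf ?gt_eqF//; lra.
Qed.

Lemma Lg_mono x y : 0 <= x -> x <= y -> Lg x <= Lg y.
Proof.
move=> x0 xy; have e0 := expR1_gt0.
by rewrite ler_ln ?posrE ?lerD2l// ltr_wpDr//; exact: le_trans xy.
Qed.

Lemma Lg0 : Lg 0 = 1.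
Proof. by rewrite /Lg addr0 expRK. Qed.

Lemma Lg_ge1 x : 0 <= x -> 1 <= Lg x.
Proof. by move=> x0; rewrite -Lg0 Lg_mono. Qed.

Lemma Lg_gt0 x : 0 <= x -> 0 < Lg x.
Proof. by move=> /Lg_ge1; exact: lt_le_trans. Qed.

Lemma Lg_scale t x : 1 <= t -> 0 <= x -> Lg (t * x) <= (1 + ln t) * Lg x.
Proof.
move=> t1 x0; have e0 := expR1_gt0; have t0 : 0 < t by lra.
have ex0 : 0 < expR 1 + x by lra.
apply: (@le_trans _ _ (ln (t * (expR 1 + x)))).
  rewrite ler_ln ?posrE ?mulr_gt0//; last by rewrite ltr_wpDr// mulr_ge0// ltW.
  by rewrite mulrDr lerD2r ler_peMl// ltW.
rewrite lnM ?posrE// -/(Lg x) mulrDl mul1r addrC lerD2l.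
by rewrite ler_peMr ?ln_ge0// Lg_ge1.
Qed.

Context (d : nat) (gam : R).
Hypothesis gam0 : 0 < gam.
Local Notation g := (1 + gam).

(** The radial profile of the weight. The exponent is written 1 + gam because gam is the exponent
    left after summing over a tail. *)
Definition psi x : R := (1 + x) ^- d * Lg x `^ (- g).

Let g0 : 0 <= g. Proof. by rewrite addr_ge0// ltW. Qed.

Lemma psi_gt0 x : 0 <= x -> 0 < psi x.
Proof.
move=> x0; rewrite mulr_gt0 ?powR_gt0 ?Lg_gt0// invr_gt0 exprn_gt0//.
by rewrite ltr_wpDr.
Qed.

Lemma psi_anti x y : 0 <= x -> x <= y -> psi y <= psi x.
Proof.
move=> x0 xy; have y0 : 0 <= y by exact: le_trans xy.
apply: ler_pM.
- by rewrite invr_ge0 exprn_ge0// addr_ge0.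
- exact: powR_ge0.
- rewrite lef_pV2 ?posrE ?exprn_gt0 ?ltr_wpDr//.
  by rewrite lerXn2r ?nnegrE ?addr_ge0// lerD2l.
- by apply: powRN_anti => //; [exact: Lg_gt0|exact: Lg_mono].
Qed.

Lemma psi_scale t x : 1 <= t -> 0 <= x ->
  psi x <= t ^+ d * (1 + ln t) `^ g * psi (t * x).
Proof.
move=> t1 x0; have t0 : 0 < t by lra.
have l0 : 0 < 1 + ln t by rewrite ltr_wpDr// ln_ge0.
have tx0 : 0 <= t * x by rewrite mulr_ge0// ltW.
have a0 : 0 < 1 + x by lra.
have b0 : 0 < 1 + t * x by lra.
have h1 : (1 + x) ^- d <= t ^+ d * (1 + t * x) ^- d.
  rewrite -ler_pdivrMl ?exprn_gt0// -invfM -exprMn lef_pV2 ?posrE ?exprn_gt0 ?mulr_gt0//.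
  have h0 : 1 + t * x <= t * (1 + x) by rewrite mulrDr mulr1 lerD2r.
  by apply: lerXn2r; rewrite ?nnegrE ?(le_trans (ltW b0) h0) ?(ltW b0).
have h2 : Lg x `^ (- g) <= (1 + ln t) `^ g * Lg (t * x) `^ (- g).
  exact: (powRN_le_scale (Lg_gt0 tx0) l0 (Lg_scale t1 x0) g0).
rewrite /psi mulrACA; apply: ler_pM => //.
  by rewrite invr_ge0 exprn_ge0// ltW.
exact: powR_ge0.
Qed.

Hypothesis d0 : (0 < d)%N.

(** The factor (2 d) 3^d comes from [shell_le], 2^d from the halved argument of [psi], 2e + 1 from
    comparing 1/r with an increment of [Lg], and 1 / gam from telescoping. *)
Definition tail_cst : R :=
  (2 * d)%:R * 3 ^+ d * 2 ^+ d * (2 * expR 1 + 1) / gam.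

Lemma tail_cst_gt0 : 0 < tail_cst.
Proof.
have e0 := expR1_gt0.
by rewrite divr_gt0// !mulr_gt0 ?exprn_gt0 ?ltr0n ?muln_gt0//; lra.
Qed.

(* The increment of Lg over a shell is of order 1/r, and r^-1 Lg^(-1-gam) is then
   bounded by the increment of Lg^(-gam). *)
Lemma shell_term_le q r : 1 <= q -> (0 < r)%N ->
  psi (q * r%:R / 2) * shell R d r <= tail_cst * q ^- d *
    (Lg (q * r.-1%:R / 2) `^ (- gam) - Lg (q * r%:R / 2) `^ (- gam)).
Proof.
move=> q1 r0; have e0 := expR1_gt0; have q0 : 0 < q by lra.
have rr0 : 0 < r%:R :> R by rewrite ltr0n.
set x := q * r%:R / 2; set x' := q * _ / 2.
have x0 : 0 < x by rewrite /x !mulr_gt0.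
have x'0 : 0 <= x' by rewrite /x' divr_ge0// mulr_ge0// ltW.
have xx' : x - x' = q / 2.
  by rewrite /x /x' -mulrBl -mulrBr -[in r%:R](prednK r0) -natr1 addrC addKr mulr1.
have x'x : x' <= x by rewrite -subr_ge0 xx' divr_ge0// ltW.
have L0 : 0 < Lg x by apply: Lg_gt0; exact: ltW.
have ex0 : 0 < expR 1 + x by lra.
have ex'0 : 0 < expR 1 + x' by lra.
(* The increment is at least (q/2) / (e + q r/2), whose inverse 2e/q + r is at most (2e + 1) r since
   q and r are at least 1. *)
have step : r%:R^-1 <= (2 * expR 1 + 1) * (Lg x - Lg x').
  have -> : Lg x - Lg x' = ln ((expR 1 + x) / (expR 1 + x')) by rewrite ln_div.
  have := ln_ge_1subV (divr_gt0 ex0 ex'0); rewrite invf_div => h.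
  have : r%:R^-1 <= (2 * expR 1 + 1) * (1 - (expR 1 + x') / (expR 1 + x)).
    have -> : 1 - (expR 1 + x') / (expR 1 + x) = (q / 2) / (expR 1 + x).
      rewrite -xx' -[X in X - _](divff (lt0r_neq0 ex0)) -mulrBl.
      by congr (_ / _); ring.
    have r1 : 1 <= r%:R :> R by rewrite ler1n.
    rewrite mulrA ler_pdivlMr// mulrC ler_pdivrMr// /x.
    have qr1 : 1 <= q * r%:R by rewrite mulr_ege1.
    have := ler_wpM2l (ltW e0) qr1; lra.
  move=> /le_trans; apply; rewrite ler_wpM2l//; lra.
have tel := powRN_telescope (Lg_gt0 x'0) (Lg_mono x'0 x'x) gam0.
have h1 : psi x <= 2 ^+ d * q ^- d * r%:R ^- d * Lg x `^ (- g).
  rewrite /psi ler_wpM2r ?powR_ge0//.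
  have -> : 2 ^+ d * q ^- d * r%:R ^- d = x ^- d.
    by rewrite /x !expr_div_n !exprMn invf_div; field; rewrite !expf_neq0 ?gt_eqF.
  rewrite lef_pV2 ?posrE ?exprn_gt0// ?lerXn2r ?nnegrE ?ltW//; lra.
have h2 := shell_le R d r0.
have s0 : 0 <= shell R d r.
  by apply: le_trans (shell_ge R d0 r0); rewrite exprn_ge0.
apply: (@le_trans _ _ ((2 ^+ d * q ^- d * r%:R ^- d * Lg x `^ (- g)) *
    ((2 * d)%:R * 3 ^+ d * r%:R ^+ d.-1))).
  by apply: ler_pM => //; exact/ltW/psi_gt0/ltW.
have -> : (2 ^+ d * q ^- d * r%:R ^- d * Lg x `^ (- g)) *
    ((2 * d)%:R * 3 ^+ d * r%:R ^+ d.-1) =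
    ((2 * d)%:R * 3 ^+ d * 2 ^+ d * q ^- d) * (r%:R^-1 * Lg x `^ (- g)).
  rewrite -[X in r%:R ^- X](prednK d0) exprS.
  by field; rewrite !expf_neq0 ?gt_eqF.
rewrite /tail_cst [X in _ <= X * _](_ : _ = ((2 * d)%:R * 3 ^+ d * 2 ^+ d * q ^- d) *
    ((2 * expR 1 + 1) / gam)); last by ring.
rewrite -[leRHS]mulrA; apply: ler_wpM2l.
  by rewrite !mulr_ge0 ?exprn_ge0 ?invr_ge0 ?exprn_ge0// ltW.
apply: (@le_trans _ _ ((2 * expR 1 + 1) * (Lg x - Lg x') * Lg x `^ (- g))).
  by rewrite ler_wpM2r ?powR_ge0.
rewrite -!mulrA; apply: ler_wpM2l; first lra.
by rewrite ler_pdivlMl.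
Qed.

(** The argument q |k|_oo / 2 is the lower bound for the norm of an alias shifted by q k; with q = 2
    it is |k|_oo, which gives the plain tail. *)
Lemma radial_tail_le q (M N : nat) : 1 <= q ->
  \sum_(k <- box d N | (M < ninf k)%N) psi (q * (ninf k)%:R / 2) <=
  tail_cst * q ^- d * Lg (q * M%:R / 2) `^ (- gam).
Proof.
move=> q1; have q0 : 0 < q by lra.
have C0 : 0 <= tail_cst * q ^- d.
  by rewrite mulr_ge0 ?invr_ge0 ?exprn_ge0// ltW// tail_cst_gt0.
rewrite (sum_radial _ M N (fun r => psi (q * r%:R / 2))).
have [NM|MN] := leqP N M.
  by rewrite big_geq// mulr_ge0// powR_ge0.
apply: (@le_trans _ _ (\sum_(M.+1 <= r < N.+1) tail_cst * q ^- d *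
    (Lg (q * r.-1%:R / 2) `^ (- gam) - Lg (q * r%:R / 2) `^ (- gam)))).
  rewrite big_nat [leRHS]big_nat; apply: ler_sum => r /andP[Mr _].
  by apply: shell_term_le => //; exact: leq_ltn_trans Mr.
rewrite -mulr_sumr; apply: ler_wpM2l => //.
rewrite big_add1/= (eq_bigr (fun r => - (Lg (q * r.+1%:R / 2) `^ (- gam) - Lg (q * r%:R / 2) `^ (- gam)))); last first.
  by move=> r _; rewrite opprB.
rewrite sumrN (telescope_sumr (fun r => Lg (q * r%:R / 2) `^ (- gam)) (ltnW MN)).
by rewrite opprB gerBl powR_ge0.
Qed.

(* The bound m * (m + 2) = (m + 1)^2 - 1 makes the harmonic sum over the annulus
   at least ln (m + 1). *)
Lemma radial_lower (m : nat) : (0 < m)%N ->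
  2 ^- d * 2 `^ (- g) / 3 * Lg m%:R `^ (- gam) <=
  \sum_(k <- box d (m * (m + 2)) | (m < ninf k)%N) psi (ninf k)%:R.
Proof.
move=> m0; have e0 := expR1_gt0.
rewrite (sum_radial _ m _ (fun r => psi r%:R)).
set M := (m * (m + 2))%N.
have mM : (m <= M)%N by rewrite /M; nia.
have m1 : 1 <= m%:R :> R by rewrite ler1n.
have L0 : 0 < Lg m%:R by exact: Lg_gt0.
(* The logarithm at most doubles over the annulus, so its power is constant there up to 2^(-1-gam),
   and the harmonic sum remains. *)
have LM : Lg M%:R <= 2 * Lg m%:R.
  rewrite /Lg -[2]/(2%:R) mulr_natl -lnXn; last by rewrite ltr_wpDr.
  rewrite ler_ln ?posrE ?exprn_gt0 ?ltr_wpDr//.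
  rewrite /M natrM natrD; have : 1 <= expR 1 :> R by apply: le_trans (expR_ge1Dx 1); lra.
  by nra.
have term r : (m < r)%N -> (r <= M)%N ->
    2 ^- d * (2 `^ (- g) * Lg m%:R `^ (- g)) * (ln r.+1%:R - ln r%:R) <= psi r%:R * shell R d r.
  move=> mr rM; have r0 : (0 < r)%N by exact: leq_ltn_trans mr.
  have rr0 : 0 < r%:R :> R by rewrite ltr0n.
  have r1 : 1 <= r%:R :> R by rewrite ler1n.
  apply: (@le_trans _ _ ((1 + r%:R) ^- d * Lg r%:R `^ (- g) * r%:R ^+ d.-1)); last first.
    by rewrite ler_wpM2l ?shell_ge// mulr_ge0 ?powR_ge0// invr_ge0 exprn_ge0// addr_ge0.
  rewrite mulrAC [leRHS]mulrAC; apply: ler_pM; rewrite ?mulr_ge0 ?powR_ge0//.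
  - by rewrite subr_ge0 ler_ln ?posrE ?ltr0n// ler_nat.
  - apply: (@le_trans _ _ (2 ^- d * r%:R^-1)).
      rewrite ler_wpM2l ?invr_ge0 ?exprn_ge0//.
      have -> : ln r.+1%:R - ln r%:R = ln (1 + r%:R^-1) :> R.
        rewrite -ln_div ?posrE ?ltr0n//; congr ln.
        by rewrite -natr1 mulrDl mul1r divff// gt_eqF.
      by apply: le_ln1Dx; apply: lt_trans (_ : 0 < _); [lra|rewrite invr_gt0].
    have -> : 2 ^- d * r%:R^-1 = (2 * r%:R) ^- d * r%:R ^+ d.-1 :> R.
      rewrite exprMn; case: (d) d0 => // n _; rewrite [r%:R ^+ n.+1]exprS /=.
      by field; rewrite !expf_neq0 ?gt_eqF.
    rewrite ler_wpM2r ?exprn_ge0// lef_pV2 ?posrE ?exprn_gt0 ?mulr_gt0 ?ltr_wpDr//.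
    by apply: lerXn2r; rewrite ?nnegrE; lra.
  - rewrite -(powRM _ (ler0n R 2) (ltW L0)).
    apply: powRN_anti => //; first exact: Lg_gt0.
    by apply: le_trans LM; apply: Lg_mono => //; rewrite ler_nat.
apply: (@le_trans _ _ (\sum_(m.+1 <= r < M.+1)
    2 ^- d * (2 `^ (- g) * Lg m%:R `^ (- g)) * (ln r.+1%:R - ln r%:R))); last first.
  by rewrite big_nat [leRHS]big_nat; apply: ler_sum => r /andP[mr rM]; exact: term.
rewrite -mulr_sumr (telescope_sumr (fun r => ln r%:R)) ?ltnS//.
have -> : ln M.+1%:R - ln m.+1%:R = ln m.+1%:R :> R.
  rewrite (_ : M.+1 = (m.+1 ^ 2)%N); last by rewrite /M; nia.
  by rewrite natrX lnXn ?ltr0n// mulr2n addrK.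
have Lm : Lg m%:R / 3 <= ln m.+1%:R.
  rewrite ler_pdivrMr// mulr_natr -lnXn ?ltr0n//.
  rewrite ler_ln ?posrE ?exprn_gt0 ?ltr0n ?ltr_wpDr// -natr1.
  have e4 := expR1_le4; set y := m%:R in m1 *.
  apply: (@le_trans _ _ (4 + y)); first by rewrite lerD2r.
  (* Expanded in powers of y - 1 >= 0, the difference has positive coefficients. *)
  have -> : (y + 1) ^+ 3 = 4 + y + ((y - 1) ^+ 3 + 6 * (y - 1) ^+ 2 + 11 * (y - 1) + 3) by ring.
  by rewrite lerDl !addr_ge0 ?mulr_ge0 ?exprn_ge0 ?subr_ge0.
have -> : 2 ^- d * 2 `^ (- g) / 3 * Lg m%:R `^ (- gam) =
    2 ^- d * (2 `^ (- g) * Lg m%:R `^ (- g)) * (Lg m%:R / 3).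
  have -> : Lg m%:R `^ (- gam) = Lg m%:R `^ (- g) * Lg m%:R.
    rewrite -[X in _ = _ * X]powRr1 ?ltW// -powRD; last by apply/implyP; rewrite (gt_eqF L0).
    by congr (_ `^ _); ring.
  by ring.
by rewrite ler_wpM2l// !mulr_ge0 ?powR_ge0// invr_ge0 exprn_ge0.
Qed.

End logarithmic_weights.

(** * From the sup norm to the Euclidean weight *)

Section euclidean_weights.
Context (R : realType) (d : nat) (gam : R).
Hypotheses (d0 : (0 < d)%N) (gam0 : 0 < gam).
Local Notation psi := (@psi R d gam).
Implicit Types k l : 'rV[int]_d.

Definition wt k : R := psi (euclid R k).

Lemma euclid_ge0 k : 0 <= euclid R k.
Proof. exact: sqrtr_ge0. Qed.

Lemma sqr_intr_norm (z : int) : z%:~R ^+ 2 = `|z|%N%:R ^+ 2 :> R.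
Proof. by rewrite natr_absz intr_norm real_normK// num_real. Qed.

Lemma ninf_attained k : exists i, ninf k = `|(k 0 i)%R|%N.
Proof.
have c0 : (0 < #|'I_d|)%N by rewrite card_ord.
by have [i _] := eq_bigmax_cond (fun i => `|(k 0 i)%R|%N) c0; exists i.
Qed.

Lemma ninf_le_euclid k : (ninf k)%:R <= euclid R k.
Proof.
have [i ->] := ninf_attained k.
rewrite -[leLHS]ger0_norm// -sqrtr_sqr /euclid ler_sqrt; last first.
  by apply: sumr_ge0 => j _; exact: sqr_ge0.
rewrite -sqr_intr_norm (bigD1 i)//= lerDl.
by apply: sumr_ge0 => j _; exact: sqr_ge0.
Qed.

Lemma euclid_le_ninf k : euclid R k <= d%:R * (ninf k)%:R.
Proof.
rewrite -[leRHS]ger0_norm ?mulr_ge0// -sqrtr_sqr /euclid ler_sqrt ?sqr_ge0//.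
apply: (@le_trans _ _ (\sum_(i < d) (ninf k)%:R ^+ 2)).
  apply: ler_sum => i _; rewrite sqr_intr_norm.
  by apply: lerXn2r; rewrite ?nnegrE// ler_nat abs_le_ninf.
rewrite sumr_const card_ord -[leLHS]mulr_natl exprMn.
by rewrite ler_wpM2r ?sqr_ge0// expr2 ler_peMl// ler1n.
Qed.

Lemma wt_gt0 k : 0 < wt k.
Proof. by apply: psi_gt0; exact: euclid_ge0. Qed.

Lemma wt_le_psi k : wt k <= psi (ninf k)%:R.
Proof. by apply: psi_anti => //; exact: ninf_le_euclid. Qed.

(** The price of replacing the Euclidean norm by the sup norm: they differ by a factor at most d,
    and [psi_scale] is applied with t = d. *)
Definition dim_cst : R := d%:R ^+ d * (1 + ln d%:R) `^ (1 + gam).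

Lemma dim_cst_gt0 : 0 < dim_cst.
Proof.
by rewrite mulr_gt0 ?exprn_gt0 ?ltr0n// powR_gt0// ltr_wpDr// ln_ge0// ler1n.
Qed.

Lemma psi_dim_le_wt k : psi (d%:R * (ninf k)%:R) <= wt k.
Proof. by apply: psi_anti; [exact: gam0|exact: euclid_ge0|exact: euclid_le_ninf]. Qed.

Lemma psi_le_dim x : 0 <= x -> psi x <= dim_cst * psi (d%:R * x).
Proof. by move=> x0; apply: psi_scale; rewrite ?ler1n. Qed.

Lemma psi_le_wt k : psi (ninf k)%:R <= dim_cst * wt k.
Proof.
apply: le_trans (psi_le_dim (ler0n R (ninf k))) _.
by apply: ler_wpM2l; [exact: ltW dim_cst_gt0|exact: psi_dim_le_wt].
Qed.

(** Serves the autocorrelation bound: if k is a difference of two frequencies, the larger one, l,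
    satisfies the hypothesis. *)
Lemma wt_doubling k l : (ninf k <= (ninf l).*2)%N ->
  wt l <= 2 ^+ d * (1 + ln 2) `^ (1 + gam) * dim_cst * wt k.
Proof.
move=> kl; have c0 : 0 <= 2 ^+ d * (1 + ln 2) `^ (1 + gam) :> R.
  by rewrite mulr_ge0 ?exprn_ge0// powR_ge0.
have t1 : 1 <= 2 :> R by rewrite ler1n.
apply: le_trans (wt_le_psi l) _.
apply: le_trans (psi_scale d gam0 t1 (ler0n R (ninf l))) _.
rewrite -[leRHS]mulrA; apply: ler_wpM2l => //; apply: le_trans (psi_le_wt k).
apply: psi_anti => //.
by rewrite -natrM ler_nat mul2n.
Qed.

Lemma Lg_unbounded (x : R) : exists N, forall n, (N <= n)%N -> x <= Lg n%:R.
Proof.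
exists (Num.truncn (expR x)).+1 => n Nn.
rewrite -[leLHS]expRK ler_ln ?posrE ?expR_gt0// ?ltr_wpDr ?expR_gt0//.
apply: (@le_trans _ _ n%:R); last by rewrite lerDr expR_ge0.
apply: (@le_trans _ _ ((Num.truncn (expR x)).+1)%:R); last by rewrite ler_nat.
by apply/ltW/truncnS_gt.
Qed.

Lemma LgN_small (e : R) : 0 < e -> exists N, forall n, (N <= n)%N -> Lg n%:R `^ (- gam) <= e.
Proof.
move=> e0; pose x := e `^ (- gam^-1); have [N hN] := Lg_unbounded x.
exists N => n /hN xL; have x0 : 0 < x by exact: powR_gt0.
apply: le_trans (powRN_anti x0 xL (ltW gam0)) _.
by rewrite /x -powRrM mulrNN mulVf ?gt_eqF// powRr1// ltW.
Qed.

Lemma wt_tail (e : R) : 0 < e ->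
  exists N, forall M, \sum_(k <- box d M | k \notin box d N) wt k <= e.
Proof.
move=> e0; have c0 := tail_cst_gt0 gam0 d0.
have q0 : 0 < 2 ^- d :> R by rewrite invr_gt0 exprn_gt0.
have [N hN] := LgN_small (divr_gt0 e0 (mulr_gt0 c0 q0)).
exists N => M; rewrite (eq_bigl (fun k => (N < ninf k)%N)); last first.
  by move=> k; rewrite mem_box -ltnNge.
(* [radial_tail_le] is used with q = 2, which cancels the halving. *)
apply: (@le_trans _ _ (\sum_(k <- box d M | (N < ninf k)%N) psi (2 * (ninf k)%:R / 2))).
  by apply: ler_sum => k _; rewrite mulrAC divff// mul1r; exact: wt_le_psi.
have t1 : 1 <= 2 :> R by rewrite ler1n.
apply: le_trans (radial_tail_le gam0 d0 N M t1) _.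
rewrite [2 * _ / 2]mulrAC divff// mul1r mulrC -ler_pdivlMr; last exact: mulr_gt0.
exact: hN.
Qed.

Lemma psi_half_le (q : R) : 0 < q ->
  psi (q / 2) <= 2 ^+ d * q ^- d * Lg (q / 2) `^ (- gam).
Proof.
move=> q0; have h0 : 0 < q / 2 by exact: divr_gt0.
have L1 := Lg_ge1 (ltW h0).
apply: ler_pM; rewrite ?powR_ge0// ?invr_ge0 ?exprn_ge0 ?addr_ge0 ?(ltW h0)//.
  have -> : 2 ^+ d * q ^- d = (q / 2) ^- d by rewrite expr_div_n invf_div.
  rewrite lef_pV2 ?posrE ?exprn_gt0 ?addr_gt0//.
  by apply: lerXn2r; rewrite ?nnegrE ?addr_ge0 ?(ltW h0)// lerDr.
by apply: ler_powR => //; rewrite lerN2 lerDr.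
Qed.

Definition alias_cst : R := tail_cst d gam + 3 ^+ d * 2 ^+ d.

(** Telescoping from radius 0 would end at Lg 0 = 1 and lose the logarithm. The tail therefore
    starts beyond radius 1, and the innermost shell, at most 3^d frequencies, is bounded
    directly. *)
Lemma radial_sum_le (q : R) N : 1 <= q ->
  \sum_(k <- box d N | (0 < ninf k)%N) psi (q * (ninf k)%:R / 2) <=
  alias_cst * q ^- d * Lg (q / 2) `^ (- gam).
Proof.
move=> q1; have q0 : 0 < q by exact: lt_le_trans q1.
rewrite (bigID (fun k => (1 < ninf k)%N))/= /alias_cst !mulrDl; apply: lerD.
  rewrite (eq_bigl (fun k => (1 < ninf k)%N)); last by move=> k; case: (ninf k) => [|[]].
  by apply: le_trans (radial_tail_le gam0 d0 1 N q1) _; rewrite mulr1.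
rewrite (eq_bigl (fun k => ninf k == 1%N)); last by move=> k; case: (ninf k) => [|[]].
rewrite (eq_bigr (fun=> psi (q / 2))); last by move=> k /eqP ->; rewrite mulr1.
apply: (@le_trans _ _ (\sum_(k <- box d 1) psi (q / 2))); last first.
  rewrite sum_cst_seq size_box natrX -!mulrA; apply: ler_wpM2l; first exact: exprn_ge0.
  by have := psi_half_le q0; rewrite -!mulrA.
rewrite -big_filter; apply: (ler_sum_seq_sub (filter_uniq _ (box_uniq d N)) (box_uniq d 1)) => [k|_].
  by rewrite mem_filter !mem_box => /andP[/eqP ->].
by apply/ltW/psi_gt0/divr_ge0 => //; exact: ltW.
Qed.

Lemma alias_sum_le (m N : nat) k : k \in box d m ->
  \sum_(l <- box d N | divall m.*2 (l - k) && (l != k)) wt l <=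
  alias_cst * (m.*2.+1)%:R ^- d * Lg ((m.*2.+1)%:R / 2) `^ (- gam).
Proof.
rewrite mem_box => km; set q := m.*2.+1.
(* For an alias, the division is exact and l = k + q v with v nonzero; since |k|_oo <= m < q/2, the
   norm of l is at least q |v|_oo / 2. *)
pose v l : 'rV[int]_d := \row_i ((l 0 i - k 0 i)%R %/ q)%Z.
have vE l : divall m.*2 (l - k) -> forall i, l 0 i = k 0 i + v l 0 i * q%:Z.
  move=> /forallP h i; have := h i; rewrite !mxE => hi.
  by rewrite divzK// addrC subrK.
pose J := [seq l <- box d N | divall m.*2 (l - k) && (l != k)].
have vinf l : divall m.*2 (l - k) -> l != k ->
    (0 < ninf (v l))%N /\ (q * ninf (v l) <= (ninf l).*2)%N.
  move=> dl lk; have [i E] := ninf_attained (v l).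
  have v0 : (0 < ninf (v l))%N.
    rewrite lt0n ninf_eq0; apply: contraNneq lk => v0; apply/eqP/rowP => j.
    by rewrite (vE l dl) v0 mxE mul0r addr0.
  split=> //; have := abs_le_ninf l i; rewrite (vE l dl i).
  have := leq_trans (abs_le_ninf k i) km; move: v0; rewrite E /q.
  by move: (k 0 i) (v l 0 i) (ninf l) => a b c; nia.
rewrite -big_filter -/J.
apply: (@le_trans _ _ (\sum_(l <- J) psi (q%:R * (ninf (v l))%:R / 2))).
  rewrite big_seq [leRHS]big_seq; apply: ler_sum => l.
  rewrite mem_filter => /andP[/andP[dl lk] _]; have [_ h] := vinf l dl lk.
  apply: le_trans (wt_le_psi l) _; apply: psi_anti => //.
  by rewrite ler_pdivrMr// -!natrM ler_nat muln2.
(* As l is recovered from v, the sum over aliases becomes part of the radial sum over nonzero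
   vectors of norm at most N + m. *)
rewrite -(big_map v xpredT (fun w => psi (q%:R * (ninf w)%:R / 2))).
apply: le_trans (radial_sum_le (N + m) (_ : 1 <= q%:R)); last by rewrite ler1n.
rewrite -[leRHS]big_filter; apply: ler_sum_seq_sub.
- rewrite map_inj_in_uniq ?filter_uniq ?box_uniq// => l l'.
  rewrite !mem_filter => /andP[/andP[dl _] _] /andP[/andP[dl' _] _] E.
  by apply/rowP => i; rewrite (vE l dl) (vE l' dl') E.
- by rewrite filter_uniq ?box_uniq.
- move=> w /mapP[l]; rewrite !mem_filter !mem_box => /andP[/andP[dl lk] lN] ->.
  have [v0 h] := vinf l dl lk; rewrite v0/=; apply/ninf_leP => i.
  have := leq_trans (abs_le_ninf l i) lN; have := leq_trans (abs_le_ninf k i) km.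
  rewrite (vE l dl i) /q; move: (k 0 i) (v l 0 i) => a b; nia.
- by move=> w; apply/ltW/psi_gt0; rewrite divr_ge0// mulr_ge0.
Qed.

End euclidean_weights.

(** * The annulus in the quadrature bound *)

Section quadrature_weights.
Context (R : realType) (d : nat) (gam : R).
Hypotheses (d0 : (0 < d)%N) (gam0 : 0 < gam).
Local Notation psi := (@psi R d gam).
Local Notation wt := (@wt R d gam).
Implicit Types j k l : 'rV[int]_d.

(** Once k is fixed, each of j and l determines the other, so every F j occurs at most twice. *)
Lemma sum_correlation_le (J : seq 'rV[int]_d) k (F : 'rV[int]_d -> R) : uniq J ->
  (forall j, 0 <= F j) ->
  \sum_(j <- J) \sum_(l <- J | j - l == k) (F j + F l) <= 2 * \sum_(j <- J) F j.
Proof.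
move=> uJ F0.
have one (G : 'rV[int]_d -> R) a : (forall j, 0 <= G j) -> \sum_(l <- J | l == a) G l <= G a.
  move=> G0; rewrite big_mkcond/= (eq_bigr (fun l => G l * (l == a)%:R)); last first.
    by move=> l _; case: eqP; rewrite ?mulr1 ?mulr0.
  by rewrite sum_seq_delta//; case: ifP => // _; exact: G0.
under eq_bigr do rewrite big_split/=.
rewrite big_split/= [X in _ <= X]mulrDl mul1r; apply: lerD.
  apply: ler_sum => j _; apply: le_trans (one (fun=> F j) (j - k) (fun=> F0 j)).
  rewrite le_eqVlt; apply/orP; left; apply/eqP; apply: eq_bigl => l.
  by rewrite subr_eq [k + l]addrC -subr_eq eq_sym.
rewrite (exchange_big_dep xpredT)//=.
apply: ler_sum => l _; apply: le_trans (one (fun=> F l) (k + l) (fun=> F0 l)).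
by rewrite le_eqVlt; apply/orP; left; apply/eqP; apply: eq_bigl => j; rewrite subr_eq.
Qed.

Definition doubling_cst : R := 2 ^+ d * (1 + ln 2) `^ (1 + gam) * dim_cst d gam.

Lemma doubling_cst_gt0 : 0 < doubling_cst.
Proof.
apply: mulr_gt0; last exact: dim_cst_gt0.
by rewrite mulr_gt0 ?exprn_gt0// powR_gt0// ltr_wpDr// ln_ge0// ler1n.
Qed.

(** If k = j - l, the larger of j and l has norm at least |k|_oo / 2, and by doubling its weight is
    at most a constant times wt k. The product is then that constant times wt k times the other
    weight. *)
Lemma wt_correlation_le (J : seq 'rV[int]_d) k : uniq J ->
  \sum_(j <- J) \sum_(l <- J | j - l == k) wt j * wt l <=
  2 * doubling_cst * (\sum_(j <- J) wt j) * wt k.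
Proof.
move=> uJ; have c0 := ltW doubling_cst_gt0; have w0 j : 0 <= wt j by exact/ltW/wt_gt0.
apply: (@le_trans _ _ (\sum_(j <- J) \sum_(l <- J | j - l == k) doubling_cst * wt k * (wt j + wt l))).
  apply: ler_sum => j _; apply: ler_sum => l /eqP E.
  have h : (ninf k <= ninf j + ninf l)%N by rewrite -E -(ninfN l) ninfD.
  rewrite mulrDr; have [lj|jl] := leqP (ninf l) (ninf j).
    have := wt_doubling d0 gam0 (_ : (ninf k <= (ninf j).*2)%N).
    rewrite -addnn (leq_trans h) ?leq_add2l// => /(_ isT) hj.
    apply: le_trans (_ : doubling_cst * wt k * wt l <= _); first by rewrite ler_wpM2r.
    by rewrite lerDr; exact: mulr_ge0 (mulr_ge0 c0 (w0 k)) (w0 j).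
  have := wt_doubling d0 gam0 (_ : (ninf k <= (ninf l).*2)%N).
  rewrite -addnn (leq_trans h) ?leq_add2r ?(ltnW jl)// => /(_ isT) hl.
  apply: le_trans (_ : doubling_cst * wt k * wt j <= _); first by rewrite mulrC ler_wpM2r.
  by rewrite lerDl; exact: mulr_ge0 (mulr_ge0 c0 (w0 k)) (w0 l).
under eq_bigr do rewrite -mulr_sumr.
rewrite -mulr_sumr; have := sum_correlation_le k uJ w0.
move=> /(ler_wpM2l (mulr_ge0 c0 (w0 k))) /le_trans; apply.
by rewrite le_eqVlt; apply/orP; left; apply/eqP; ring.
Qed.

Definition annulus_cst : R := 2 ^- d * 2 `^ (- (1 + gam)) / 3 / dim_cst d gam.

Lemma annulus_cst_gt0 : 0 < annulus_cst.
Proof.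
apply: divr_gt0; last exact: dim_cst_gt0.
by rewrite !mulr_gt0 ?invr_gt0 ?exprn_gt0// powR_gt0.
Qed.

Lemma wt_annulus_ge (m : nat) : (0 < m)%N ->
  annulus_cst * Lg m%:R `^ (- gam) <=
  \sum_(k <- box d (m * (m + 2)) | (m < ninf k)%N) wt k.
Proof.
move=> m0; have D0 : 0 < dim_cst d gam by exact: dim_cst_gt0.
rewrite /annulus_cst mulrAC ler_pdivrMr// [leRHS]mulrC; apply: le_trans (radial_lower gam0 d0 m0) _.
by rewrite mulr_sumr; apply: ler_sum => k _; exact: psi_le_wt.
Qed.

(** On the annulus, of total weight T, the weights are at most psi m, so the first condition keeps
    the share of k = 0 below one half. The second uses wt 0 = 1, and the third says that the squared
    mass of mu, T / (2 [doubling_cst]), is at least 4 n b^2. *)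
Lemma min_quad_err_wt_ge (m n : nat) (b : R) : (0 < m)%N -> (0 < n)%N -> 0 <= b ->
  2 * n%:R * psi m%:R <= annulus_cst * Lg m%:R `^ (- gam) ->
  2 * b ^+ 2 <= 1 ->
  8 * doubling_cst * n%:R * b ^+ 2 <= annulus_cst * Lg m%:R `^ (- gam) ->
  (b%:E <= min_quad_err wt n)%E.
Proof.
move=> m0 n0 b0 h1 h2 h3; have C0 := doubling_cst_gt0.
have w0 j : 0 <= wt j by exact/ltW/wt_gt0.
pose J := [seq k <- box d (m * (m + 2)) | (m < ninf k)%N].
have uJ : uniq J by rewrite filter_uniq ?box_uniq.
pose T : R := \sum_(k <- J) wt k.
have T_ge : annulus_cst * Lg m%:R `^ (- gam) <= T.
  by rewrite /T big_filter; exact: wt_annulus_ge.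
have T0 : 0 < T.
  apply: lt_le_trans T_ge; rewrite mulr_gt0 ?annulus_cst_gt0// powR_gt0//.
  exact: Lg_gt0.
(* The largest scaling for which [wt_correlation_le] bounds the autocorrelation of s * wt by wt
   itself. *)
pose s : R := Num.sqrt (2 * doubling_cst * T)^-1.
have D0 : 0 < 2 * doubling_cst * T by exact: mulr_gt0 (mulr_gt0 (ltr0Sn R 1) C0) T0.
have s2 : s ^+ 2 = (2 * doubling_cst * T)^-1 by rewrite sqr_sqrtr// invr_ge0 ltW.
have s0 : 0 <= s by exact: sqrtr_ge0.
have sumE : \sum_(j <- J) s * wt j = s * T by rewrite -mulr_sumr.
apply: (min_quad_err_ge (mu := fun j => s * wt j) (J := J) (@wt_gt0 R d gam) n0 b0) => //.
- by move=> k; rewrite mulr_ge0.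
- move=> k; rewrite (eq_bigr (fun j => s ^+ 2 * \sum_(l <- J | j - l == k) wt j * wt l)); last first.
    by move=> j _; rewrite mulr_sumr; apply: eq_bigr => l _; rewrite expr2 mulrACA.
  rewrite -mulr_sumr s2 ler_pdivrMl//; exact: wt_correlation_le.
- rewrite sumE exprMn (eq_bigr (fun j => s ^+ 2 * wt j ^+ 2)); last by move=> j _; rewrite exprMn.
  rewrite -mulr_sumr mulrCA; apply: ler_wpM2l; first exact: sqr_ge0.
  apply: (@le_trans _ _ (2 * n%:R * (psi m%:R * T))).
    rewrite ler_wpM2l ?mulr_ge0// /T mulr_sumr !big_filter.
    apply: ler_sum => j mj; rewrite expr2; apply: ler_wpM2r => //.
    by apply: le_trans (wt_le_psi d0 gam0 j) _; apply: psi_anti => //; rewrite ler_nat ltnW.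
  rewrite mulrA expr2; apply: ler_wpM2r; [exact: ltW|exact: le_trans T_ge].
- apply: le_trans h2 _; rewrite /wt /psi.
  have -> : euclid R (0 : 'rV[int]_d) = 0.
    by rewrite /euclid big1 ?sqrtr0// => i _; rewrite mxE expr0n.
  by rewrite addr0 expr1n Lg0 powR1 invr1 mulr1.
- rewrite sumE exprMn s2 mulrC -ler_pdivlMr; last by rewrite mulr_gt0// ltr0n.
  have nn0 : 0 < n%:R :> R by rewrite ltr0n.
  have -> : (2 * doubling_cst * T)^-1 * T ^+ 2 / (4 * n%:R) = T / (8 * doubling_cst * n%:R).
    by field; rewrite !gt_eqF.
  rewrite ler_pdivlMr; last exact: mulr_gt0 (mulr_gt0 (ltr0Sn R 7) C0) nn0.
  by rewrite mulrC; exact: le_trans h3 T_ge.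
Qed.

End quadrature_weights.

(** * Asymptotics *)

Section rates.
Context (R : realType).
Implicit Types a b : nat -> \bar R.

Lemma lesssim_trans a b (c : nat -> \bar R) : lesssim a b -> lesssim b c -> lesssim a c.
Proof.
move=> [s s0 [N _ hN]] [t t0 [M _ hM]]; exists (s * t); first exact: mulr_gt0.
exists (maxn N M) => // n /=; rewrite geq_max => /andP[Nn Mn].
apply: le_trans (hN n Nn) _; rewrite EFinM -muleA lee_pmul2l ?fin_numE//.
exact: hM.
Qed.

Lemma log_rate_sqr (gamma : R) n : (1 < n)%N ->
  (n%:R `^ (- 2^-1) * ln n%:R `^ gamma) ^+ 2 = n%:R^-1 * ln n%:R `^ (2 * gamma) :> R.
Proof.
move=> n1; rewrite exprMn -!powR_mulrn ?powR_ge0// -!powRrM.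
by rewrite mulNr mulVf// powR_inv1// [2 * _]mulrC.
Qed.

(** The bounds at hand are square roots of weights, so the rates are compared through their
    squares. *)
Lemma lesssim_log_rate a (gamma K : R) N : 0 < K ->
  (forall n, (N <= n)%N -> exists2 b : R, 0 <= b /\ (a n <= b%:E)%E &
     b ^+ 2 <= K * (n%:R^-1 * ln n%:R `^ (2 * gamma))) ->
  lesssim a (log_rate gamma).
Proof.
move=> K0 h; exists (Num.sqrt K); first by rewrite sqrtr_gt0.
exists (maxn N 2) => // n /=; rewrite geq_max => /andP[Nn n1].
have [b [b0 ab] hb] := h n Nn; apply: le_trans ab _; rewrite /log_rate -EFinM lee_fin.
rewrite -(log_rate_sqr _ n1) in hb; set r := n%:R `^ _ * _ in hb *.
have r0 : 0 <= r by rewrite mulr_ge0 ?powR_ge0.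
rewrite -[leLHS]ger0_norm// -sqrtr_sqr -[X in _ <= _ * X]ger0_norm// -sqrtr_sqr -sqrtrM ?(ltW K0)//.
by rewrite ler_sqrt// mulr_ge0 ?sqr_ge0// ltW.
Qed.

Lemma log_rate_lesssim a (gamma K : R) N : 0 < K ->
  (forall n, (N <= n)%N -> exists2 b : R, 0 <= b /\ (b%:E <= a n)%E &
     K * (n%:R^-1 * ln n%:R `^ (2 * gamma)) <= b ^+ 2) ->
  lesssim (log_rate gamma) a.
Proof.
move=> K0 h; have s0 : 0 < Num.sqrt K by rewrite sqrtr_gt0.
exists (Num.sqrt K)^-1; first by rewrite invr_gt0.
exists (maxn N 2) => // n /=; rewrite geq_max => /andP[Nn n1].
have [b [b0 ab] hb] := h n Nn.
apply: (@le_trans _ _ ((Num.sqrt K)^-1%:E * b%:E)%E); last first.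
  by apply: lee_pmul => //; rewrite lee_fin ?invr_ge0 ltW.
rewrite /log_rate -EFinM lee_fin ler_pdivlMl//.
rewrite -(log_rate_sqr _ n1) in hb; set r := n%:R `^ _ * _ in hb *.
have r0 : 0 <= r by rewrite mulr_ge0 ?powR_ge0.
rewrite -[leRHS]ger0_norm// -sqrtr_sqr -[X in _ * X]ger0_norm// -sqrtr_sqr -sqrtrM ?(ltW K0)//.
by rewrite ler_sqrt// sqr_ge0.
Qed.

End rates.

Section box_size.
Context (R : realType) (d : nat).
Hypothesis d0 : (0 < d)%N.

Lemma box_size_exists n : (0 < n)%N ->
  exists p, (p.*2.+1 ^ d <= n)%N && (n < p.+1.*2.+1 ^ d)%N.
Proof.
move=> n0; pose P p := (p.*2.+1 ^ d <= n)%N.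
have P0 : exists p, P p by exists 0%N; rewrite /P exp1n.
have Pn p : P p -> (p <= n)%N.
  move=> h; apply: leq_trans h; apply: (@leq_trans (p.*2.+1)); first by rewrite -addnn; lia.
  by rewrite -[X in (X <= _)%N]expn1 leq_pexp2l.
have [p hp pmax] := ex_maxnP P0 Pn.
exists p; apply/andP; split=> //; rewrite ltnNge; apply/negP => h.
by have := pmax p.+1 h; rewrite ltnn.
Qed.

Variables (n p : nat).
Hypotheses (n1 : (1 < n)%N) (pn : (p.*2.+1 ^ d <= n)%N) (np : (n < p.+1.*2.+1 ^ d)%N).

Let nR : 0 < n%:R :> R. Proof. by rewrite ltr0n ltnW. Qed.

Let pnR : (p.*2.+1)%:R ^+ d <= n%:R :> R. Proof. by rewrite -natrX ler_nat. Qed.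

Let npR : n%:R <= (p.+1.*2.+1)%:R ^+ d :> R.
Proof. by rewrite -natrX ler_nat ltnW. Qed.

Let natrX_le (a b : nat) : (a <= b)%N -> a%:R ^+ d <= b%:R ^+ d :> R.
Proof. by move=> ab; apply: lerXn2r; rewrite ?nnegrE ?ler0n// ler_nat. Qed.

(** Frequencies outside [box d p] start at norm p + 1; the constant comes from 2p + 3 <= 2 (p +
    2). *)
Lemma inv_box_le : (1 + p.+1%:R) ^- d <= 2 ^+ d * n%:R^-1 :> R.
Proof.
rewrite ler_pdivlMr// mulrC ler_pdivrMr ?exprn_gt0 ?ltr_wpDr// -exprMn.
apply: le_trans npR _; rewrite nat1r -natrM; apply: natrX_le.
by rewrite -addnn; lia.
Qed.

Lemma inv_box_ge : 2 ^- d * n%:R^-1 <= (1 + p.+1%:R) ^- d :> R.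
Proof.
rewrite -invfM lef_pV2 ?posrE ?mulr_gt0 ?exprn_gt0 ?ltr_wpDr//.
apply: (@le_trans _ _ (2 ^+ d * (p.*2.+1)%:R ^+ d)); last by rewrite ler_wpM2l ?exprn_ge0.
rewrite -exprMn nat1r -natrM; apply: natrX_le.
by rewrite -addnn; lia.
Qed.

Lemma inv_nodes_le : (p.*2.+1)%:R ^- d <= 3 ^+ d * n%:R^-1 :> R.
Proof.
rewrite ler_pdivlMr// mulrC ler_pdivrMr ?exprn_gt0// -exprMn.
apply: le_trans npR _; rewrite -natrM; apply: natrX_le.
by rewrite -!addnn; lia.
Qed.

(** Since n <= (2p + 3)^d <= (e + x)^(2d), any x that grows like a power of p has a logarithm
    comparable to that of n; the square leaves room for small p. *)
Lemma ln_le_Lg (x : R) : 0 <= x -> (p.+1.*2.+1)%:R <= (2 + x) ^+ 2 ->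
  ln n%:R <= (2 * d)%:R * Lg x.
Proof.
move=> x0 h; have e2 : 2 <= expR 1 :> R by have := expR_ge1Dx (1 : R); lra.
have ex0 : 0 < expR 1 + x by lra.
have h' : (p.+1.*2.+1)%:R <= (expR 1 + x) ^+ 2.
  by apply: le_trans h _; apply: lerXn2r; rewrite ?nnegrE; lra.
rewrite mulr_natl -lnXn// ler_ln ?posrE ?exprn_gt0// exprM.
by apply: le_trans npR _; apply: lerXn2r; rewrite ?nnegrE ?exprn_ge0// ltW.
Qed.

Lemma ln_le_Lg_box : ln n%:R <= (2 * d)%:R * Lg p.+1%:R :> R.
Proof.
by apply: ln_le_Lg => //; rewrite -natrD -natrX ler_nat -addnn; nia.
Qed.

Lemma ln_le_Lg_nodes : ln n%:R <= (2 * d)%:R * Lg ((p.*2.+1)%:R / 2) :> R.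
Proof.
apply: ln_le_Lg; first by rewrite divr_ge0.
have -> : (p.*2.+1)%:R / 2 = p%:R + 2^-1 :> R.
  by rewrite -natr1 -addnn natrD; field.
have -> : (p.+1.*2.+1)%:R = 2 * p%:R + 3 :> R.
  by rewrite -natr1 -addnn natrD -!natr1; ring.
have p0 : 0 <= p%:R :> R by [].
by nra.
Qed.

Lemma Lg_le_ln : Lg p.+1%:R <= 3 * ln n%:R :> R.
Proof.
have e0 : 0 < expR 1 :> R by exact: expR_gt0.
rewrite -[3]/(3%:R) mulr_natl -lnXn// ler_ln ?posrE ?exprn_gt0 ?ltr_wpDr//.
have p1n : p.+1%:R <= n%:R :> R.
  rewrite ler_nat; apply: leq_trans pn.
  apply: (@leq_trans (p.*2.+1)); first by rewrite -addnn; lia.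
  by rewrite -[X in (X <= _)%N]expn1 leq_pexp2l.
have n2 : 2 <= n%:R :> R by rewrite ler_nat.
have e4 := expR1_le4 R; set y := n%:R in p1n n2 *.
(* As e <= 4 and p + 1 <= n, it remains to see 4 + n <= n^3, which holds from n = 2 on. *)
apply: (@le_trans _ _ (4 + y)); first exact: lerD.
have -> : y ^+ 3 = 4 + y + ((y - 2) ^+ 3 + 6 * (y - 2) ^+ 2 + 11 * (y - 2) + 2) by ring.
by rewrite lerDl !addr_ge0 ?mulr_ge0 ?exprn_ge0 ?subr_ge0.
Qed.

Lemma ln_box_gt0 : 0 < ln n%:R :> R.
Proof. by rewrite ln_gt0// ltr1n. Qed.

End box_size.

Section wt_rates.
Context (R : realType) (d : nat) (gam : R).
Hypotheses (d0 : (0 < d)%N) (gam0 : 0 < gam).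
Local Notation psi := (@psi R d gam).
Local Notation wt := (@wt R d gam).

Let g0 : 0 <= 1 + gam. Proof. by rewrite addr_ge0// ltW. Qed.

Let wt_gt k : 0 < wt k. Proof. exact: wt_gt0. Qed.

Let twice_half (x : R) : 2 * (- (x / 2)) = - x.
Proof. by rewrite mulrN mulrCA divff// mulr1. Qed.

Let two_d : 0 < (2 * d)%:R :> R. Proof. by rewrite ltr0n muln_gt0. Qed.

Let wt_notin_box m k : k \notin box d m -> wt k <= psi m.+1%:R.
Proof.
rewrite mem_box -ltnNge => mk; apply: le_trans (wt_le_psi d0 gam0 k) _.
by apply: psi_anti => //; rewrite ler_nat.
Qed.

Lemma approx_number_wt_upper : lesssim (approx_number wt) (log_rate (- ((1 + gam) / 2))).
Proof.
have K0 : 0 < 2 ^+ d * (2 * d)%:R `^ (1 + gam) :> R by rewrite mulr_gt0 ?exprn_gt0// powR_gt0.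
apply: (@lesssim_log_rate _ _ _ _ 2 K0) => n n1.
have [p /andP[pn np]] := box_size_exists d0 (ltnW n1).
have psi0 : 0 <= psi p.+1%:R by exact/ltW/psi_gt0.
exists (Num.sqrt (psi p.+1%:R)).
  split; first exact: sqrtr_ge0.
  apply: (approx_number_le wt_gt (wt_tail d0 gam0) pn (sqrtr_ge0 _)) => k kp.
  by rewrite sqr_sqrtr//; exact: wt_notin_box.
rewrite sqr_sqrtr// twice_half mulrACA; apply: ler_pM.
- by rewrite invr_ge0 exprn_ge0// addr_ge0.
- exact: powR_ge0.
- exact: (inv_box_le R d0 n1 pn np).
- exact: (powRN_le_scale (ln_box_gt0 R n1) two_d (ln_le_Lg_box R d0 n1 pn np) g0).
Qed.

Lemma approx_number_wt_lower : lesssim (log_rate (- ((1 + gam) / 2))) (approx_number wt).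
Proof.
have D0 : 0 < dim_cst d gam by exact: dim_cst_gt0.
have t0 : 0 < 3 `^ (- (1 + gam)) :> R by exact: powR_gt0.
have h0 : 0 < 2 ^- d :> R by rewrite invr_gt0 exprn_gt0.
have K0 : 0 < (dim_cst d gam)^-1 * (2 ^- d * 3 `^ (- (1 + gam))).
  by apply: mulr_gt0; [rewrite invr_gt0|exact: mulr_gt0].
apply: (@log_rate_lesssim _ _ _ _ 2 K0) => n n1.
have [p /andP[pn np]] := box_size_exists d0 (ltnW n1).
have dp0 : 0 <= d%:R * p.+1%:R :> R by rewrite mulr_ge0.
have psi0 : 0 <= psi (d%:R * p.+1%:R) by exact/ltW/psi_gt0.
exists (Num.sqrt (psi (d%:R * p.+1%:R))).
  split; first exact: sqrtr_ge0.
  apply: (approx_number_ge wt_gt np (sqrtr_ge0 _)) => k.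
  rewrite mem_box sqr_sqrtr// => kp; apply: le_trans (psi_dim_le_wt d0 gam0 k).
  by apply: psi_anti; rewrite ?mulr_ge0 ?ler_wpM2l ?ler_nat.
rewrite sqr_sqrtr// twice_half -mulrA ler_pdivrMl//.
apply: le_trans (psi_le_dim d0 gam0 (ler0n R p.+1)).
have L0 := ln_box_gt0 R n1.
rewrite mulrACA; apply: ler_pM.
- by rewrite mulr_ge0 ?invr_ge0 ?(ltW h0).
- by rewrite mulr_ge0 ?powR_ge0.
- exact: (inv_box_ge R d0 n1 pn np).
- rewrite -(powRM _ (ler0n R 3) (ltW L0)); apply: powRN_anti (Lg_le_ln R d0 n1 pn np) g0.
  exact: Lg_gt0.
Qed.

Lemma sampling_number_wt_upper : lesssim (sampling_number wt) (log_rate (- (gam / 2))).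
Proof.
have A0 : 0 < alias_cst d gam.
  by rewrite ltr_wpDr ?tail_cst_gt0// mulr_ge0 ?exprn_ge0.
pose t : R := (2 * d)%:R `^ gam; have t0 : 0 < t by exact: powR_gt0.
have K0 : 0 < (2 ^+ d + alias_cst d gam * 3 ^+ d) * t.
  apply: mulr_gt0 => //; apply: addr_gt0; first by rewrite exprn_gt0.
  by apply: mulr_gt0 => //; rewrite exprn_gt0.
apply: (@lesssim_log_rate _ _ _ _ 2 K0) => n n1.
have [p /andP[pn np]] := box_size_exists d0 (ltnW n1).
have psi0 : 0 <= psi p.+1%:R by exact/ltW/psi_gt0.
pose S := alias_cst d gam * (p.*2.+1)%:R ^- d * Lg ((p.*2.+1)%:R / 2) `^ (- gam).
have S0 : 0 <= S.
  apply: mulr_ge0; last exact: powR_ge0.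
  by apply: mulr_ge0; [exact: ltW|rewrite invr_ge0 exprn_ge0].
exists (Num.sqrt (psi p.+1%:R + S)).
  split; first exact: sqrtr_ge0.
  apply: (sampling_number_le wt_gt (wt_tail d0 gam0) pn psi0 S0) => [k|N k kp].
    exact: wt_notin_box.
  exact: alias_sum_le.
have L0 := ln_box_gt0 R n1.
rewrite sqr_sqrtr ?addr_ge0// twice_half -mulrA mulrDl; apply: lerD.
  (* The truncation term is smaller than the aliasing term by a logarithm; its exponent is weakened
     from 1 + gam to gam to match. *)
  rewrite [t * _]mulrCA [leRHS]mulrA; apply: ler_pM.
  - by rewrite invr_ge0 exprn_ge0// addr_ge0.
  - exact: powR_ge0.
  - exact: (inv_box_le R d0 n1 pn np).
  - apply: le_trans (powRN_le_scale L0 two_d (ln_le_Lg_box R d0 n1 pn np) (ltW gam0)).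
    by apply: ler_powR; [exact: Lg_ge1|rewrite lerN2 lerDr].
rewrite /S -!mulrA; apply: ler_wpM2l; first exact: ltW.
rewrite [t * _]mulrCA [leRHS]mulrA; apply: ler_pM.
- by rewrite invr_ge0 exprn_ge0.
- exact: powR_ge0.
- exact: (inv_nodes_le R d0 n1 pn np).
- exact: (powRN_le_scale L0 two_d (ln_le_Lg_nodes R n1 np) (ltW gam0)).
Qed.

Lemma min_quad_err_wt_lower : lesssim (log_rate (- (gam / 2))) (min_quad_err wt).
Proof.
have A0 : 0 < annulus_cst d gam by exact: annulus_cst_gt0.
have C0 : 0 < doubling_cst d gam by exact: doubling_cst_gt0.
(* Makes the last condition of [min_quad_err_wt_ge] an equality for b^2 = B. *)
pose c := annulus_cst d gam / (8 * doubling_cst d gam).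
have c8 : 0 < 8 * doubling_cst d gam by exact: mulr_gt0.
have c0 : 0 < c by exact: divr_gt0.
have t0 : 0 < 3 `^ (- gam) :> R by exact: powR_gt0.
have K0 : 0 < c * 3 `^ (- gam) by exact: mulr_gt0.
(* From N1 on, 2 B <= 1. From N2 on, [Lg p.+1%:R] exceeds 2 * 2^d / [annulus_cst]: the additional
   logarithm in the decay of [psi] then absorbs the constants of the condition on k = 0. *)
pose N1 := (Num.truncn (2 * c)).+1.
pose N2 := (Num.truncn (expR ((2 * d)%:R * (2 * 2 ^+ d / annulus_cst d gam)))).+1.
apply: (@log_rate_lesssim _ _ _ _ (maxn 2 (maxn N1 N2)) K0) => n.
rewrite !geq_max => /andP[n1 /andP[nN1 nN2]].
have [p /andP[pn np]] := box_size_exists d0 (ltnW n1).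
have nR : 0 < n%:R :> R by rewrite ltr0n ltnW.
have L0 := ln_box_gt0 R n1.
have Lp : 0 < Lg p.+1%:R :> R by exact: Lg_gt0.
pose B := c * (n%:R^-1 * Lg p.+1%:R `^ (- gam)).
have B0 : 0 <= B.
  by apply: mulr_ge0; [exact: ltW|rewrite mulr_ge0 ?powR_ge0// invr_ge0].
exists (Num.sqrt B).
  split; first exact: sqrtr_ge0.
  apply: (min_quad_err_wt_ge d0 gam0 (ltn0Sn p) (ltnW n1) (sqrtr_ge0 _)).
  - have h : 2 * 2 ^+ d / annulus_cst d gam <= Lg p.+1%:R.
      rewrite -(ler_pM2l two_d); apply: le_trans (ln_le_Lg_box R d0 n1 pn np).
      rewrite -[leLHS]expRK ler_ln ?posrE ?expR_gt0//; apply/ltW.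
      by apply: lt_le_trans (truncnS_gt _) _; rewrite ler_nat.
    have -> : Lg p.+1%:R `^ (- gam) = Lg p.+1%:R * Lg p.+1%:R `^ (- (1 + gam)).
      rewrite -[X in _ = X * _]powRr1 ?(ltW Lp)// -powRD; last by apply/implyP; rewrite (gt_eqF Lp).
      by congr (_ `^ _); ring.
    rewrite /psi !mulrA; apply: ler_wpM2r; first exact: powR_ge0.
    apply: (@le_trans _ _ (2 * 2 ^+ d)).
      rewrite -!mulrA; apply: ler_wpM2l => //.
      by rewrite mulrC -ler_pdivlMr//; exact: (inv_box_le R d0 n1 pn np).
    by rewrite -ler_pdivrMl// mulrC.
  - rewrite sqr_sqrtr// /B mulrA [2 * c * _]mulrA.
    have Lle : Lg p.+1%:R `^ (- gam) <= 1 :> R.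
      rewrite -[leRHS](powRr0 (Lg p.+1%:R)); apply: ler_powR; first exact: Lg_ge1.
      by rewrite oppr_le0 ltW.
    apply: (@le_trans _ _ (2 * c * n%:R^-1 * 1)).
      apply: (ler_wpM2l _ Lle); apply: mulr_ge0; last by rewrite invr_ge0 ltW.
      exact: mulr_ge0 (ler0n R 2) (ltW c0).
    rewrite mulr1 ler_pdivrMr// mul1r; apply/ltW.
    by apply: lt_le_trans (truncnS_gt _) _; rewrite ler_nat.
  - rewrite sqr_sqrtr// /B /c le_eqVlt; apply/orP; left; apply/eqP.
    by field; rewrite !gt_eqF.
rewrite sqr_sqrtr// twice_half /B -mulrA; apply: ler_wpM2l; first exact: ltW.
rewrite mulrCA; apply: ler_wpM2l; first by rewrite invr_ge0 ltW.
rewrite -(powRM _ (ler0n R 3) (ltW L0)).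
exact: (powRN_anti Lp (Lg_le_ln R d0 n1 pn np) (ltW gam0)).
Qed.

End wt_rates.

Lemma log_weightE (R : realType) (d : nat) (beta : R) :
  @log_weight R d beta = wt (2 * beta - 1).
Proof.
apply/funext => k; rewrite /log_weight /wt /psi /Lg.
by rewrite [1 + (_ - 1)]addrC subrK.
Qed.

Theorem corollary4 (R : realType) (d : nat) (beta : R)
    (hd : (0 < d)%N) (hbeta : 2^-1 < beta) :
  let lam := @log_weight R d beta in
  asymp (approx_number lam) (log_rate (- beta)) /\
  (asymp (min_quad_err lam) (sampling_number lam) /\
   asymp (sampling_number lam) (log_rate (- beta + 2^-1))).
Proof.
rewrite /= log_weightE; set gam := 2 * beta - 1.
have gam0 : 0 < gam by rewrite /gam; lra.
have -> : - beta = - ((1 + gam) / 2) by rewrite /gam; lra.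
have -> : - ((1 + gam) / 2) + 2^-1 = - (gam / 2) by lra.
(* With the two bounds that follow, e_n <= g_n closes a cycle through the rate, which yields all
   comparisons between the three sequences. *)
have quad_le : lesssim (min_quad_err (@wt R d gam)) (sampling_number (@wt R d gam)).
  exists 1 => //; exists 0%N => // n _; rewrite mul1e.
  exact: min_quad_err_le_sampling_number.
have samp_le := sampling_number_wt_upper hd gam0.
have quad_ge := min_quad_err_wt_lower hd gam0.
split; first by split; [exact: approx_number_wt_upper|exact: approx_number_wt_lower].
split; split=> //; first exact: lesssim_trans samp_le quad_ge.
exact: lesssim_trans quad_ge quad_le.
Qed.
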